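(* Let $k,\ell$ be integers such that $\ell\ge k\ge 3$. There are constants $s_0=s_0(k,\ell)$ and $n_0=n_0(k,\ell)$ such that for all integers $n,s$ with $s_0\le s<\dfrac{n}{8(k-1)^{k-2}(\ell-1)^3}$ and $n\ge n_0$, $$\mathrm{ex}_k\bigl(n,\{H_{\ell+1}^k,M_{s+1}^k\}\bigr)=s\,t_{k-1}(n-s,\ell-1).$$
   Context: A $k$-graph ($k$-uniform hypergraph) is a pair $(V,E)$ with $V$ finite and $E$ a set of $k$-element subsets of $V$. For a family $\mathcal F$ of $k$-graphs, a $k$-graph is $\mathcal F$-free if it contains no member of $\mathcal F$ as a subgraph; $\mathrm{ex}_k(n,\mathcal F)$ is the maximum number of edges in an $n$-vertex $\mathcal F$-free $k$-graph. $M_{s+1}^k$ is the $k$-graph consisting of $s+1$ pairwise disjoint edges. $H_{\ell+1}^k$ is the $k$-graph obtained from the complete graph $K_{\ell+1}$ by enlarging each edge with a set of $k-2$ new vertices, where all these sets of new vertices are pairwise disjoint (and disjoint from the vertex set of $K_{\ell+1}$). For $q\ge r\ge 2$, $T_r(m,q)$ is the $r$-graph on $[m]$ obtained from a partition of $[m]$ into $q$ parts, each of size $\lfloor m/q\rfloor$ or $\lceil m/q\rceil$, whose edges are all $r$-subsets containing at most one vertex from each part; $t_r(m,q)=|E(T_r(m,q))|$. *)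

(* Defs.v *)
From mathcomp Require Import all_boot all_order all_algebra.
From mathcomp Require Import zify.

Set Implicit Arguments.
Unset Strict Implicit.
Unset Printing Implicit Defensive.

Record hypergraph := Hypergraph {
  vertex : finType;
  edges : {set {set vertex}}
}.

Definition uniform (k : nat) (G : hypergraph) : bool :=
  [forall e in edges G, #|e| == k].

(* [F] is a (not necessarily induced) subgraph of [G], up to isomorphism. *)
Definition contains (G F : hypergraph) : bool :=
  [exists f : {ffun vertex F -> vertex G},
     injectiveb f && [forall e in edges F, (f @: e) \in edges G]].

Definition is_free (Fs : seq hypergraph) (G : hypergraph) : bool :=
  all (fun F => ~~ contains G F) Fs.

(* [ex_number k n Fs] is ex_k(n, Fs) for a finite family [Fs]; it is 0 if there is no
   [Fs]-free k-graph on n vertices (possible only if [Fs] has an edgeless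
   member). *)
Definition ex_number (k n : nat) (Fs : seq hypergraph) : nat :=
  \max_(E : {set {set 'I_n}} |
      uniform k (Hypergraph E) && is_free Fs (Hypergraph E)) #|E|.

(* M_s^k: the i-th edge is {i} * [k]. *)
Definition matching (k s : nat) : hypergraph :=
  @Hypergraph ('I_s * 'I_k)%type
    [set [set (i, t) | t : 'I_k] | i : 'I_s].

(* H_m^k (for k >= 2): the edge [p] of the complete graph K_m is enlarged by
   the k - 2 new vertices (p, 0), ..., (p, k - 3). *)
Definition pair_of (m : nat) : finType := {p : {set 'I_m} | #|p| == 2}.

Definition expanded_clique (k m : nat) : hypergraph :=
  @Hypergraph ('I_m + pair_of m * 'I_(k - 2))%type
    [set [set inl v | v in val p] :|: [set inr (p, t) | t : 'I_(k - 2)]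
       | p : pair_of m].

(* The parts of T_r(m, q) are the residue classes modulo q; their sizes are
   given by [card_turan_part] below. Any other partition with these part sizes
   gives an isomorphic r-graph. *)
Definition turan_part (m q j : nat) : {set 'I_m} :=
  [set i : 'I_m | i %% q == j].

Definition turan (r m q : nat) : hypergraph :=
  @Hypergraph 'I_m
    [set e : {set 'I_m} |
       (#|e| == r) && [forall j : 'I_q, #|e :&: turan_part m q j| <= 1]].

Definition turan_number (r m q : nat) : nat := #|edges (turan r m q)|.

Lemma card_turan_part (m q j : nat) : j < q ->
  #|turan_part m q j| = (m + (q.-1 - j)) %/ q.
Proof.
move=> jq; have q0 : 0 < q by exact: leq_ltn_trans jq.
have -> : #|turan_part m q j| = \sum_(i < m) (i %% q == j).
  by rewrite -sum1_card big_mkcond; apply: eq_bigr => i _; rewrite inE; case: eqP.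
elim: m => [|m IH]; first by rewrite big_ord0 add0n divn_small //; lia.
rewrite big_ord_recr /= IH addSn divnS // addnC; congr (nat_of_bool _ + _).
have -> : (m + (q.-1 - j)).+1 = m + (q - j) by lia.
rewrite -{1}(modn_small jq) -(eqn_modDr (q - j)) subnKC ?modnn //.
exact: ltnW.
Qed.

Lemma turan_part_balanced (m q j : nat) : j < q ->
  #|turan_part m q j| = m %/ q \/ #|turan_part m q j| = (m + q.-1) %/ q.
Proof.
move=> jq; rewrite card_turan_part //.
have q0 : 0 < q by exact: leq_ltn_trans jq.
have h1 : m %/ q <= (m + (q.-1 - j)) %/ q by apply: leq_div2r; lia.
have h2 : (m + (q.-1 - j)) %/ q <= (m + q.-1) %/ q by apply: leq_div2r; lia.
have h3 : (m + q.-1) %/ q <= (m %/ q).+1.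
  have -> : (m %/ q).+1 = (m + q) %/ q by rewrite divnDr // divnn q0 addn1.
  by apply: leq_div2r; lia.
case: (leqP ((m + (q.-1 - j)) %/ q) (m %/ q)) => h4; [left|right];
  apply/eqP; rewrite eqn_leq ?h4 ?h1 ?h2 //=.
exact: leq_trans h3 h4.
Qed.

Lemma uniform_matching (k s : nat) : uniform k (matching k s).
Proof.
apply/forall_inP => e /imsetP[i _ ->].
by rewrite card_imset ?card_ord // => t u [].
Qed.

Lemma uniform_expanded_clique (k m : nat) :
  2 <= k -> uniform k (expanded_clique k m).
Proof.
move=> k2; apply/forall_inP => e /imsetP[p _ ->].
rewrite cardsU (_ : _ :&: _ = set0) ?cards0 ?subn0; last first.
  by apply/setP => x; rewrite !inE; apply/andP => -[/imsetP[? _ ->] /imsetP[]].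
rewrite !card_imset ?(eqP (valP p)) ?card_ord ?subnKC // => [t u []|t u []] //.
Qed.

(* Main.v *)
Require Import Defs.
From mathcomp Require Import all_boot all_order all_algebra.
From mathcomp Require Import zify ring lra.

(* Throughout, [k = rho + 2] and [l = p + 2], so [p + 1 = l - 1] is the number of parts.

   Call a pair of vertices strong if it lies in edges avoiding, outside the pair, any
   prescribed set of [c] vertices, where [c] depends only on k and l.  Greedy embedding shows
   that the graph of strong pairs is K_{l+1}-free, and that outside an edge containing x and y
   it has no K_{l-1} in the common neighbourhood of x and y.  A pair that is not strong has
   codegree O(n^{k-3}).

   Let S be the set of vertices of degree greater than k s n^{k-2}.  Each of them extends any
   matching of size at most s, so [h = #|S| <= s] and only O((s - h) s n^{k-2}) edges avoid S,
   less than what is lost by passing from s to h in [s t_{k-1}(n - s, l - 1)].  It remains to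
   show that at most [h t_{k-1}(n - h, l - 1)] edges meet S.  Up to O(n^{k-1}) exceptions these
   edges are cliques of strong pairs; the strong neighbourhood of a vertex of S is K_l-free,
   which bounds its number of (k-1)-cliques by Erdős' recursion.  If the bound on the edges
   meeting S fails, almost all vertices of S attain this almost with equality, which yields
   large cores S1 of S and O1 of the complement of S such that S1 is almost completely joined
   to O1 and the vertices of O1 miss about a proportion [1 / (l - 1)] of O1.  Call a vertex
   typical if it sees the cores in this way.  The cores force the graph of pairs covered by
   edges to be K_l-free on the typical vertices outside S, and no edge contains two typical
   vertices of S, so the edges of typical vertices satisfy the exact bound.  An atypical vertex
   lies in fewer edges, by a constant factor, than it adds to [t_{k-1}] or to the factor h. *)

Set Implicit Arguments.
Unset Strict Implicit.
Unset Printing Implicit Defensive.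
Import Order.TTheory GRing.Theory Num.Theory.

(** * Counting cliques *)

(** The range of [s], from a constant to a fixed proportion of [n], shapes the proof. At the lower
    end the [O(n^{k-1})] exceptional edges are small against the main term only because [s >= s_0].
    At the upper end the edges with two vertices in [S], of order [s^2 n^{k-2}], are not negligible;
    they are paid for by a loss. Two strongly adjacent vertices of [S] have a K_{l-1}-free common
    neighbourhood, so one of their links is short by a proportion of order [1/P^2], where [P = l-1].
    Such a vertex regains at most [tau s n^{k-2}] edges, where [tau] is the limit density of
    (k-2)-cliques in a K_{l-1}-free graph, and [tau <= P r T] with [r = k-1] and [T] the density of
    the Turán (k-1)-graph. The loss prevails if [s] is at most a small multiple of [n / (r P^3)].
    The full power [(k-1)^{k-2}] is spent on the edges that avoid [S], through
    ['C(P, r) >= (P/r)^r]. Strong pairs alone cannot give an exact count, since an edge may contain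
    weak pairs. The last count therefore uses covered pairs, for which no clique bound is known
    beforehand; the cores supply it. *)

Section Cliques.
Variables (T : finType) (e : rel T).

Definition clique (X : {set T}) : bool :=
  [forall x in X, forall y in X, (x != y) ==> e x y].

Definition cliques (A : {set T}) (r : nat) : {set {set T}} :=
  [set X : {set T} | [&& X \subset A, #|X| == r & clique X]].

Definition nbr (x : T) : {set T} := [set y | e x y].

Definition omega_le (A : {set T}) (p : nat) : Prop :=
  forall X : {set T}, X \subset A -> clique X -> #|X| <= p.

Lemma cliqueP (X : {set T}) :
  reflect {in X &, forall x y, x != y -> e x y} (clique X).
Proof.
apply: (iffP forall_inP) => [H x y xX yX|H x xX].
  by have /forall_inP/(_ y yX)/implyP := H x xX.
by apply/forall_inP => y yX; apply/implyP; apply: H.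
Qed.

Lemma cliqueS (X Y : {set T}) : X \subset Y -> clique Y -> clique X.
Proof.
move=> /subsetP XY /cliqueP H; apply/cliqueP => x y /XY xY /XY yY; exact: H.
Qed.

Lemma clique0 : clique set0.
Proof. by apply/cliqueP => x y; rewrite inE. Qed.

Lemma cliques0 (A : {set T}) : #|cliques A 0| = 1.
Proof.
rewrite (_ : cliques A 0 = [set set0]) ?cards1 //.
apply/setP => X; rewrite !inE; apply/idP/eqP => [/and3P[_ /eqP/cards0_eq ->]//|->].
by rewrite sub0set cards0 clique0.
Qed.

Lemma cliques1 (A : {set T}) : #|cliques A 1| = #|A|.
Proof.
rewrite -(card_imset _ (@set1_inj T)); apply: eq_card => X; rewrite !inE.
apply/and3P/imsetP => [[XA /cards1P[x Xx] _]|[x xA ->]].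
  by exists x => //; rewrite -sub1set -Xx.
rewrite sub1set cards1; split=> //; apply/cliqueP => y z /set1P-> /set1P->.
by rewrite eqxx.
Qed.

Lemma sub_cliques (A B : {set T}) r : A \subset B -> cliques A r \subset cliques B r.
Proof.
move=> AB; apply/subsetP => X; rewrite !inE => /and3P[XA -> ->].
by rewrite (subset_trans XA AB).
Qed.

Lemma omega_leS (A B : {set T}) p : A \subset B -> omega_le B p -> omega_le A p.
Proof. by move=> AB H X XA; apply: H; apply: subset_trans AB. Qed.

Lemma omega_leP (A : {set T}) p :
  (forall X : {set T}, X \subset A -> clique X -> #|X| != p.+1) -> omega_le A p.
Proof.
move=> H X XA cX; rewrite leqNgt; apply/negP => pX.
have [Y /and3P[YX /eqP Y1 _]] : exists Y : {set T}, [&& Y \subset X, #|Y| == p.+1 & true].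
  have : 0 < #|[set Y : {set T} | Y \subset X & #|Y| == p.+1]|.
    by rewrite cards_draws bin_gt0.
  by case/card_gt0P => Y; rewrite inE => /andP[a b]; exists Y; rewrite a b.
by have /eqP := H Y (subset_trans YX XA) (cliqueS YX cX).
Qed.

Lemma omega_le0 (A : {set T}) : omega_le A 0 -> A = set0.
Proof.
move=> H; apply/eqP; apply: contraT => /set0Pn[x xA].
have := H [set x]; rewrite sub1set cards1 => /(_ xA) h.
by have : false by apply/h/cliqueP => a b /set1P-> /set1P->; rewrite eqxx.
Qed.

Hypothesis (e_sym : symmetric e) (e_irr : irreflexive e).

Lemma cliqueU1 (x : T) (X : {set T}) :
  X \subset nbr x -> clique X -> clique (x |: X).
Proof.
move=> /subsetP XN /cliqueP cX; apply/cliqueP => y z /setU1P[->|yX] /setU1P[->|zX].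
- by rewrite eqxx.
- by have := XN _ zX; rewrite inE.
- by have := XN _ yX; rewrite inE e_sym.
- exact: cX.
Qed.

Lemma nbr_notin (x : T) (X : {set T}) : X \subset nbr x -> x \notin X.
Proof. by move=> /subsetP H; apply/negP => /H; rewrite inE e_irr. Qed.

Lemma omega_le_nbr (A : {set T}) (x : T) p : x \in A ->
  omega_le A p.+1 -> omega_le (A :&: nbr x) p.
Proof.
move=> xA H X; rewrite subsetI => /andP[XA XN] cX.
have := H (x |: X); rewrite subUset sub1set xA XA cardsU1 nbr_notin //.
by apply=> //; apply: cliqueU1.
Qed.

(** Double count of the pairs formed by an [r.+1]-clique of [A] and one of its vertices [w] outside
    [B]: removing [w] leaves an [r]-clique in the neighbourhood of [w]. *)
Lemma sum_cliques_nbr (A B : {set T}) r :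
  \sum_(w in A :\: B) #|cliques (A :&: nbr w) r| =
  \sum_(X in cliques A r.+1) #|X :\: B|.
Proof.
under [RHS]eq_bigr => X _ do rewrite -sum1_card.
rewrite [RHS](exchange_big_dep (mem (A :\: B))) /=; last first.
  move=> X w; rewrite !inE => /and3P[/subsetP XA _ _] /andP[-> /XA ->]//.
apply: eq_bigr => w; rewrite inE => /andP[wB wA].
rewrite sum1dep_card -[LHS](card_in_imset (f := fun X => w |: X)); last first.
  move=> X Y; rewrite !inE !subsetI => /and3P[/andP[_ /nbr_notin wX] _ _].
  move=> /and3P[/andP[_ /nbr_notin wY] _ _] /(congr1 (fun Z => Z :\ w)).
  by rewrite !setU1K.
congr #|pred_of_set _|; apply/setP => Y; rewrite !inE; apply/imsetP/andP.
  case=> X; rewrite !inE subsetI => /and3P[/andP[XA XN] /eqP Xr cX] ->.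
  rewrite !inE eqxx wB; split=> //; apply/and3P; split.
  - by rewrite subUset sub1set wA.
  - by rewrite cardsU1 nbr_notin // Xr.
  - exact: cliqueU1.
case=> /and3P[YA /eqP Yr cY] /andP[_ wY]; exists (Y :\ w); last by rewrite setD1K.
rewrite inE subsetI; apply/and3P; split.
- rewrite (subset_trans _ YA) ?subsetDl //=; apply/subsetP => y.
  rewrite !inE => /andP[yw yY]; move/cliqueP: cY; apply => //; by rewrite eq_sym.
- by have := cardsD1 w Y; rewrite wY Yr add1n => -[<-].
- by apply: cliqueS cY; apply: subsetDl.
Qed.

(** A clique not contained in [B] has a vertex outside [B], hence is counted at least once in the
    sum. *)
Lemma cliques_split (A B : {set T}) r :
  #|cliques A r.+1| <=
  #|cliques (A :&: B) r.+1| + \sum_(w in A :\: B) #|cliques (A :&: nbr w) r|.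
Proof.
rewrite sum_cliques_nbr -(cardsID (cliques (A :&: B) r.+1) (cliques A r.+1)).
apply: leq_add; first by rewrite subset_leq_card // subsetIr.
rewrite -sum1_card big_mkcond [in X in _ <= X]big_mkcond; apply: leq_sum => X _.
rewrite in_setD; case: ifP => // /andP[XAB XA].
rewrite XA card_gt0; apply: contra XAB; rewrite setD_eq0 => XB.
by move: XA; rewrite !inE subsetI => /and3P[a b c]; rewrite a b c XB.
Qed.

(** Independence of [A :\: B] leaves a clique at most one vertex outside [B], so nothing is counted
    twice. *)
Lemma cliques_split_eq (A B : {set T}) r : {in A :\: B &, forall x y, ~~ e x y} ->
  #|cliques (A :&: B) r.+1| + \sum_(w in A :\: B) #|cliques (A :&: nbr w) r| =
  #|cliques A r.+1|.
Proof.
move=> ind; apply/eqP; rewrite eqn_leq cliques_split andbT sum_cliques_nbr.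
have sub : cliques (A :&: B) r.+1 \subset cliques A r.+1.
  by apply: sub_cliques; apply: subsetIl.
rewrite -[X in _ <= X](cardsID (cliques (A :&: B) r.+1)).
rewrite (setIidPr sub) leq_add2l -sum1_card.
rewrite big_mkcond [in X in _ <= X]big_mkcond; apply: leq_sum => X _.
rewrite in_setD; case: ifP => // XA; rewrite andbT.
move: (XA); rewrite inE => /and3P[XsA /eqP X1 cX].
case: ifP => /= [_|/negbFE]; last first.
  rewrite !inE subsetI => /and3P[/andP[_ XB] _ _].
  by move: XB; rewrite -setD_eq0 => /eqP->; rewrite cards0.
apply/card_le1_eqP => x y; rewrite !inE => /andP[xB xX] /andP[yB yX].
apply/eqP; apply: contraT => xy; have /cliqueP/(_ _ _ xX yX) := cX.
by rewrite eq_sym xy (negbTE (ind _ _ _ _)) ?inE ?xB ?yB ?(subsetP XsA) // => /(_ isT).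
Qed.

(* Erdős' recursion: with [B] the neighbourhood of a vertex of largest r-clique degree,
   every vertex outside [B] lies on at most [#|cliques B r|] cliques. *)
Lemma cliques_bound (F : nat -> nat -> nat -> rat) :
  (forall P a, 1 <= F 0 P a)%R ->
  (forall r P a, 0 <= F r P a)%R ->
  (forall r P a b : nat, b <= a -> (P = 0 -> b = 0) ->
     (F r.+1 P b + (a - b)%:R * F r P b <= F r.+1 P.+1 a)%R) ->
  forall P (A : {set T}) r, omega_le A P -> (#|cliques A r|%:R <= F r P #|A|)%R.
Proof.
move=> F0 Fge0 Frec; elim=> [|P IH] A [|r] oA; rewrite ?cliques0 ?F0 //.
  have A0 := omega_le0 oA; suff -> : cliques A r.+1 = set0 by rewrite cards0 Fge0.
  apply/setP => X; rewrite !inE A0 subset0; apply/and3P => -[/eqP->].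
  by rewrite cards0.
have [A0|[v0 v0A]] := set_0Vmem A.
  suff -> : cliques A r.+1 = set0 by rewrite cards0 Fge0.
  apply/setP => X; rewrite !inE A0 subset0; apply/and3P => -[/eqP->].
  by rewrite cards0.
pose d w := #|cliques (A :&: nbr w) r|.
case: (arg_maxnP d v0A) => v vA vmax.
set B := A :&: nbr v.
have oB : omega_le B P by apply: omega_le_nbr.
have BA : B \subset A by apply: subsetIl.
have h : #|cliques A r.+1| <= #|cliques B r.+1| + (#|A| - #|B|) * #|cliques B r|.
  apply: leq_trans (cliques_split A B r) _.
  rewrite (setIidPr BA) leq_add2l -(setIidPr BA) -cardsD (setIidPr BA) -sum_nat_const.
  by apply: leq_sum => w; rewrite inE => /andP[_ wA]; apply: vmax.
have h2 : (#|cliques A r.+1|%:R <=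
   #|cliques B r.+1|%:R + (#|A| - #|B|)%:R * #|cliques B r|%:R :> rat)%R.
  by rewrite -natrM -natrD ler_nat.
apply: (le_trans h2); apply: le_trans (Frec r P #|A| #|B| _ _).
- by apply: lerD; [apply: IH|apply: ler_wpM2l; [apply: ler0n|apply: IH]].
- exact: subset_leq_card.
- by move=> P0; move: oB; rewrite P0 => /omega_le0->; rewrite cards0.
Qed.

End Cliques.

(** * Turán numbers *)

(** The convex function [z^{r+1}] lies above its tangent at [y]; in the induction step the defect is
    [(r+1) y^r (z-y)^2]. *)
Lemma bernoulli_tangent (R : realDomainType) (y z : R) r : (0 <= y -> 0 <= z ->
  y ^+ r.+1 + r.+1%:R * y ^+ r * (z - y) <= z ^+ r.+1)%R.
Proof.
move=> y0 z0; elim: r => [|r IH]; first by rewrite !expr1 expr0; lra.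
apply: le_trans (_ : (z * (y ^+ r.+1 + r.+1%:R * y ^+ r * (z - y)) <= _)%R); last first.
  by rewrite [X in (_ <= X)%R]exprS ler_wpM2l.
rewrite -subr_ge0.
rewrite (_ : (_ - _ = r.+1%:R * y ^+ r * ((z - y) * (z - y)))%R); last first.
  rewrite !exprS -(natr1 r.+1); ring.
apply: mulr_ge0; last by rewrite -expr2 sqr_ge0.
by apply: mulr_ge0; [apply: ler0n|apply: exprn_ge0].
Qed.

Section CliqueBounds.
Variables (T : finType) (e : rel T).
Hypotheses (e_sym : symmetric e) (e_irr : irreflexive e).

(* For [P = 0] the junk value [a / 0 = 0] is harmless: then [A] is empty. *)
Lemma cliques_real_bound P (A : {set T}) r : omega_le e A P ->
  (#|cliques e A r|%:R <= 'C(P, r)%:R * (#|A|%:R / P%:R) ^+ r :> rat)%R.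
Proof.
pose F (r P a : nat) : rat := ('C(P, r)%:R * (a%:R / P%:R) ^+ r)%R.
apply: (@cliques_bound _ _ e_sym e_irr F) => {P A r} [P a|r P a|r P a b ba Pb].
- by rewrite /F bin0 expr0 mulr1.
- by rewrite /F mulr_ge0 ?ler0n // exprn_ge0 // divr_ge0 ?ler0n.
rewrite /F; set y := (b%:R / P%:R)%R; set z := (a%:R / P.+1%:R)%R.
have y0 : (0 <= y)%R by rewrite divr_ge0 ?ler0n.
have z0 : (0 <= z)%R by rewrite divr_ge0 ?ler0n.
have Eb : (b%:R = P%:R * y)%R.
  case: (P =P 0) => [P0|/eqP P0]; first by rewrite Pb // P0 mul0r.
  by rewrite mulrC divfK // pnatr_eq0.
have Ea : (a%:R = P.+1%:R * z)%R by rewrite mulrC divfK // pnatr_eq0.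
(* By the two binomial identities the left side of the recursion is exactly ['C(P.+1, r.+1)] times
   the value at [z] of the tangent to the power function at [y]. *)
have K1 : (P.+1%:R * 'C(P, r)%:R = r.+1%:R * 'C(P.+1, r.+1)%:R :> rat)%R.
  by rewrite -!natrM mul_bin_diag.
have K2 : ('C(P, r.+1)%:R = 'C(P.+1, r.+1)%:R - 'C(P, r)%:R :> rat)%R.
  by rewrite binS natrD addrK.
rewrite natrB // Ea Eb K2.
have /(ler_wpM2l (ler0n rat 'C(P.+1, r.+1))) := bernoulli_tangent r y0 z0.
apply: le_trans; rewrite le_eqVlt; apply/orP; left; apply/eqP.
rewrite !exprS.
transitivity ('C(P.+1, r.+1)%:R * (y * y ^+ r) +
   (P.+1%:R * 'C(P, r)%:R) * y ^+ r * (z - y))%R; last by rewrite K1; ring.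
by rewrite -(natr1 P); ring.
Qed.

End CliqueBounds.

(** The elementary symmetric polynomial of degree [r] in the entries of [s]: the number of
    [r]-cliques of the complete multipartite graph with part sizes [s]. As a coefficient of a
    product it is visibly invariant under permutation. *)
Definition elsym (s : seq nat) (r : nat) : nat :=
  ((\prod_(x <- s) (1 + x%:P * 'X) : {poly nat})`_r)%R.

Lemma elsym_nil r : elsym [::] r = (r == 0).
Proof. by rewrite /elsym big_nil coef1; case: eqP. Qed.

Lemma elsym_cons x s r : elsym (x :: s) r.+1 = elsym s r.+1 + x * elsym s r.
Proof.
rewrite /elsym big_cons mulrDl mul1r coefD -mulrA coefCM mulrC.
by rewrite -[RHS]/(_ + _ * _)%R; congr (_ + _)%R; rewrite mulrC; congr (_ * _)%R; rewrite mulrC coefMX.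
Qed.

Lemma elsym0 s : elsym s 0 = 1.
Proof.
elim: s => [|x s IH]; first by rewrite elsym_nil.
rewrite /elsym big_cons mulrDl mul1r coefD -mulrA coefCM.
rewrite [('X * _)%R]mulrC coefMX /= mulr0 addr0; exact: IH.
Qed.

Lemma elsym_perm s1 s2 r : perm_eq s1 s2 -> elsym s1 r = elsym s2 r.
Proof. by move=> p; rewrite /elsym (perm_big _ p). Qed.

Lemma elsym_cons2 x y s r : elsym [:: x, y & s] r.+2 =
  elsym s r.+2 + (x + y) * elsym s r.+1 + x * y * elsym s r.
Proof. rewrite !elsym_cons; lia. Qed.

Lemma elsym_le_expn s r : elsym s r <= sumn s ^ r.
Proof.
elim: s r => [|x s IH] [|r]; rewrite ?elsym0 ?elsym_nil ?expn0 //= elsym_cons.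
apply: leq_trans (_ : sumn s ^ r.+1 + x * sumn s ^ r <= _).
  by rewrite leq_add // leq_mul2l IH orbT.
rewrite !expnS; apply: leq_trans (_ : (x + sumn s) * sumn s ^ r <= _); first lia.
by rewrite leq_mul2l; case: r {IH} => [|r]; rewrite ?expn0 ?leqnn ?orbT // leq_exp2r // leq_addl orbT.
Qed.

Lemma elsym_ge s r q : all (leq q) s -> 'C(size s, r) * q ^ r <= elsym s r.
Proof.
elim: s r => [|x s IH] [|r] /=; rewrite ?elsym0 ?bin0 ?bin0n ?expn0 //.
case/andP=> qx qs; rewrite elsym_cons binS mulnDl leq_add ?IH // expnS.
have := IH r qs; nia.
Qed.

Definition balanced (s : seq nat) : bool := all (fun x => all (fun y => x <= y.+1) s) s.

Lemma balancedP s : reflect {in s &, forall x y, x <= y.+1} (balanced s).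
Proof.
apply: (iffP allP) => [H x y xs ys|H x xs]; first by have /allP := H x xs; apply.
by apply/allP => y; apply: H.
Qed.

(** Only the minimum [m] and [m.+1] occur, and the number of [m.+1] is the remainder of the sum
    modulo the length. Thus length and sum determine a balanced sequence up to order. *)
Lemma balanced_count s (x : nat) : 0 < size s -> balanced s ->
  count_mem x s = if x == (sumn s %/ size s).+1 then sumn s %% size s
    else if x == sumn s %/ size s then size s - sumn s %% size s else 0.
Proof.
move=> s0 /balancedP bs.
have [m ms mmin] : exists2 m : nat, m \in s & {in s, forall y, m <= y}.
  have ne : exists m, m \in s by case: s s0 {bs} => // a s _; exists a; rewrite inE eqxx.
  by case: (ex_minnP ne) => m ms H; exists m => // y; apply: H.
have ym (y : nat) : y \in s -> (y == m) || (y == m.+1).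
  move=> ys; have := bs _ _ ys ms; have := mmin _ ys; lia.
pose c := count_mem m.+1 s.
have C2 : forall t : seq nat, {subset t <= s} ->
   sumn t = size t * m + count_mem m.+1 t /\ count_mem m t + count_mem m.+1 t = size t.
  elim=> [//|a t IH] sub /=; have [|-> <-] := IH.
    by move=> z zt; apply: sub; rewrite inE zt orbT.
  have /ym/orP[/eqP->|/eqP->] : a \in s by apply: sub; rewrite inE eqxx.
    rewrite eqxx; have -> : (m == m.+1) = false by lia.
    by move: (count_mem m t) (count_mem m.+1 t) => u v /=; split; nia.
  rewrite eqxx; have -> : (m.+1 == m) = false by lia.
  by move: (count_mem m t) (count_mem m.+1 t) => u v /=; split; nia.
have [E1 E2] := C2 s (fun _ h => h).
(* The minimum does occur, so fewer than [size s] entries equal [m.+1]; this makes their number a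
   remainder. *)
have cm : 0 < count_mem m s by rewrite -has_count has_pred1.
have clt : c < size s by rewrite /c; lia.
have Eq : sumn s %/ size s = m by rewrite E1 mulnC divnMDl // divn_small ?addn0.
have Er : sumn s %% size s = c by rewrite E1 mulnC modnMDl modn_small.
rewrite Eq Er; case: eqP => [->//|/eqP xm1]; case: eqP => [->|/eqP xm]; first by rewrite -/c in E2; lia.
apply/count_memPn; apply: contra xm => /ym; by rewrite (negbTE xm1) orbF.
Qed.

Lemma balanced_perm s1 s2 : balanced s1 -> balanced s2 ->
  size s1 = size s2 -> sumn s1 = sumn s2 -> perm_eq s1 s2.
Proof.
move=> b1 b2 es en; case: (posnP (size s1)) => [z1|p1].
  have z2 : size s2 = 0 by rewrite -es.
  by rewrite (size0nil z1) (size0nil z2).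
apply/allP => x _; apply/eqP; rewrite balanced_count // balanced_count -?es //.
by rewrite en.
Qed.

(** If [x > y+1], moving one unit from [x] to [y] keeps the sum and raises the product [xy], so no
    [elsym] decreases, while the sum of squares drops. This sum is the induction measure. *)
Lemma elsym_balanced_max s t r : balanced t -> size s = size t -> sumn s = sumn t ->
  elsym s r <= elsym t r.
Proof.
move=> bt; have [k] := ubnP (sumn [seq x * x | x <- s]).
elim: k s => // k IH s sk es en.
have [bs|] := boolP (balanced s).
  by rewrite (elsym_perm _ (balanced_perm bs bt es en)).
case/allPn => x xs /allPn[y ys]; rewrite -ltnNge => yx.
have yx' : y \in rem x s.
  by have := perm_to_rem xs => /perm_mem/(_ y); rewrite ys inE => /esym/orP[/eqP?|//]; lia.
have ps : perm_eq s [:: x, y & rem y (rem x s)].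
  apply: perm_trans (perm_to_rem xs) _; by rewrite perm_cons perm_to_rem.
set u := rem y (rem x s) in ps.
have pss := perm_size ps; have psu := perm_sumn ps.
have psq := perm_sumn (perm_map (fun x => x * x) ps).
apply: leq_trans (IH [:: x.-1, y.+1 & u] _ _ _); rewrite /= in pss psu psq *; try lia; try nia.
rewrite (elsym_perm _ ps); case: r {IH} => [|[|r]]; rewrite ?elsym0 //.
  rewrite !elsym_cons !elsym0; lia.
rewrite !elsym_cons2; nia.
Qed.

Section ColorCliques.
Variables (T : finType) (col : T -> nat).

Definition bichromatic : rel T := [rel x y | col x != col y].

Lemma bichromatic_sym : symmetric bichromatic.
Proof. by move=> x y; rewrite /bichromatic /= eq_sym. Qed.

Lemma bichromatic_irr : irreflexive bichromatic.
Proof. by move=> x; rewrite /bichromatic /= eqxx. Qed.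

(** The colour class [Q] is independent and completely joined to the smaller colours, so splitting
    it off is the recursion of [elsym_cons]. *)
Lemma cliques_bichromatic Q r :
  #|cliques bichromatic [set x | col x < Q] r| =
  elsym [seq #|[set x | col x == j]| | j <- iota 0 Q] r.
Proof.
elim: Q r => [|Q IH] [|r]; rewrite ?cliques0 ?elsym0 //.
  rewrite elsym_nil; apply/eqP; rewrite cards_eq0 -subset0; apply/subsetP => X.
  rewrite !inE (_ : [set x | col x < 0] = set0); last by apply/setP => x; rewrite !inE.
  by rewrite subset0 => /and3P[/eqP->]; rewrite cards0.
have -> : iota 0 Q.+1 = rcons (iota 0 Q) Q by rewrite -addn1 iotaD cats1.
rewrite map_rcons; set s := map _ _.
rewrite (elsym_perm _ (s2 := #|[set x | col x == Q]| :: s)) ?perm_rcons // elsym_cons.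
have DE : [set x | col x < Q.+1] :\: [set x | col x < Q] = [set x | col x == Q].
  by apply/setP => x; rewrite !inE; lia.
rewrite -(cliques_split_eq bichromatic_sym bichromatic_irr (B := [set x | col x < Q])).
  rewrite DE; congr (_ + _).
    rewrite -IH; congr #|cliques _ _ _|; apply/setP => x; rewrite !inE; lia.
  rewrite -sum_nat_const; apply: eq_bigr => w; rewrite inE => /eqP cw.
  rewrite -IH; congr #|cliques _ _ _|; apply/setP => x; rewrite in_setI !in_set /bichromatic /= cw; lia.
by rewrite DE => x y; rewrite !in_set /bichromatic /= => /eqP-> /eqP->; rewrite eqxx.
Qed.

End ColorCliques.

Definition turan_sizes (P m : nat) : seq nat :=
  [seq #|turan_part m P j| | j <- iota 0 P].

Lemma balanced_turan_sizes P m : balanced (turan_sizes P m).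
Proof.
apply/balancedP => x y /mapP[i]; rewrite mem_iota add0n => /= iP -> /mapP[j].
rewrite mem_iota add0n => /= jP ->.
have P0 : 0 < P by apply: leq_ltn_trans iP.
have h3 : (m + P.-1) %/ P <= (m %/ P).+1.
  have -> : (m %/ P).+1 = (m + P) %/ P by rewrite divnDr // divnn P0 addn1.
  by apply: leq_div2r; lia.
have h1 : m %/ P <= (m + P.-1) %/ P by apply: leq_div2r; lia.
by case: (turan_part_balanced m iP) => ->; case: (turan_part_balanced m jP) => ->; lia.
Qed.

Lemma size_turan_sizes P m : size (turan_sizes P m) = P.
Proof. by rewrite size_map size_iota. Qed.

Lemma sumn_turan_sizes P m : 0 < P -> sumn (turan_sizes P m) = m.
Proof.
move=> P0; rewrite sumnE big_map -[RHS]card_ord -sum1_card.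
rewrite (partition_big (fun i : 'I_m => Ordinal (ltn_pmod i P0)) predT) //=.
rewrite (_ : iota 0 P = index_iota 0 P) ?big_mkord; last by rewrite /index_iota subn0.
apply: eq_bigr => j _.
by rewrite sum1dep_card; apply: eq_card => i; rewrite !inE.
Qed.

Lemma turan_number_elsym r m P : 0 < P -> turan_number r m P = elsym (turan_sizes P m) r.
Proof.
move=> P0; pose col (i : 'I_m) := i %% P.
rewrite /turan_sizes -(cliques_bichromatic col).
rewrite /turan_number /turan /=; apply: eq_card => X; rewrite !inE.
have -> : X \subset [set x | col x < P] by apply/subsetP => x _; rewrite inE ltn_pmod.
congr (_ && _); apply/forallP/cliqueP => [H x y xX yX xy|H j].
  apply/negP => /eqP cxy; have := H (Ordinal (ltn_pmod x P0)).
  move/card_le1_eqP/(_ x y); rewrite !inE xX yX /= -/(col x) cxy !eqxx.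
  by move=> h; move: xy; rewrite h ?eqxx.
apply/card_le1_eqP => x y; rewrite !inE => /andP[xX /eqP cx] /andP[yX /eqP cy].
apply/eqP; apply: contraT => xy; have := H _ _ yX xX; rewrite eq_sym /bichromatic /= /col cx cy eqxx.
by rewrite eq_sym xy => /(_ isT).
Qed.

Lemma elsym_le_turan s r m P : 0 < P -> size s = P -> sumn s = m ->
  elsym s r <= turan_number r m P.
Proof.
move=> P0 sz sm; rewrite turan_number_elsym //.
apply: elsym_balanced_max; rewrite ?balanced_turan_sizes ?size_turan_sizes //.
by rewrite sumn_turan_sizes // sz.
Qed.

Lemma all_turan_sizes P m : all (leq (m %/ P)) (turan_sizes P m).
Proof.
apply/allP => x /mapP[j]; rewrite mem_iota add0n => /= jP ->.
have P0 : 0 < P by apply: leq_ltn_trans jP.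
by case: (turan_part_balanced m jP) => -> //; apply: leq_div2r; lia.
Qed.

Lemma turan_number_ge r m P : 0 < P -> 'C(P, r) * (m %/ P) ^ r <= turan_number r m P.
Proof.
move=> P0; rewrite turan_number_elsym // -{1}(size_turan_sizes P m).
exact/elsym_ge/all_turan_sizes.
Qed.

(** Adding a vertex to one part of the balanced partition gains the [r]-cliques of the other [P-1]
    parts, each of size at least [m %/ P]; balancing the [m.+1] vertices does not lower the
    count. *)
Lemma turan_number_step_ge r m P : 0 < P ->
  turan_number r.+1 m P + 'C(P.-1, r) * (m %/ P) ^ r <= turan_number r.+1 m.+1 P.
Proof.
move=> P0; rewrite [turan_number _ m _]turan_number_elsym //.
have := sumn_turan_sizes m P0; have := size_turan_sizes P m.
have := all_turan_sizes P m.
case: (turan_sizes P m) => [|x s] /=; first by move=> _ P1; rewrite -P1 in P0.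
case/andP=> _ qs P1 sm.
have := @elsym_le_turan (x.+1 :: s) r.+1 m.+1 P P0 P1; rewrite /= addSn sm => /(_ erefl).
apply: leq_trans; rewrite !elsym_cons; have := elsym_ge r qs.
by rewrite -P1 /=; lia.
Qed.

Lemma turan_number_steps_ge r m x P : 0 < P ->
  turan_number r.+1 m P + x * ('C(P.-1, r) * (m %/ P) ^ r) <= turan_number r.+1 (m + x) P.
Proof.
move=> P0; elim: x => [|x IH]; first by rewrite mul0n !addn0.
rewrite addnS mulSn; apply: leq_trans (turan_number_step_ge r (m + x) P0).
rewrite addnCA addnC leq_add // leq_mul2l; apply/orP; right.
by case: r {IH} => // r; rewrite leq_exp2r // leq_div2r // leq_addr.
Qed.

(** Removing a vertex from a nonempty part loses the [r]-cliques of the other parts, at most [m^r]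
    of them. *)
Lemma turan_number_step_le r m P : 0 < P ->
  turan_number r.+1 m.+1 P <= turan_number r.+1 m P + m ^ r.
Proof.
move=> P0; rewrite turan_number_elsym //.
have S0 := sumn_turan_sizes m.+1 P0.
have [x xs x0] : exists2 x, x \in turan_sizes P m.+1 & 0 < x.
  apply/hasP; rewrite -[has _ _]negbK -all_predC; apply/negP => /allP H.
  suff : sumn (turan_sizes P m.+1) = 0 by lia.
  by elim: (turan_sizes P m.+1) H => //= a t IH H; rewrite IH => [|y yt]; [|apply: H];
     rewrite ?inE ?yt ?orbT //; have := H a; rewrite inE eqxx => /(_ isT) /=; lia.
have [y [s ps]] : exists y s, perm_eq (turan_sizes P m.+1) (y.+1 :: s).
  by exists x.-1, (rem x (turan_sizes P m.+1)); rewrite prednK // perm_to_rem.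
rewrite (elsym_perm _ ps).
have := perm_size ps; have := perm_sumn ps; rewrite size_turan_sizes S0 /= => sm sz.
have sm' : sumn (y :: s) = m by rewrite /=; lia.
have := elsym_le_turan r.+1 P0 (esym sz : size (y :: s) = P) sm'.
rewrite !elsym_cons; have := elsym_le_expn s r.
have : sumn s ^ r <= m ^ r by case: r => // r; rewrite leq_exp2r //; lia.
by lia.
Qed.

Section ExactCliqueBound.
Variables (T : finType) (e : rel T).
Hypotheses (e_sym : symmetric e) (e_irr : irreflexive e).

(** Zykov's form of Turán's theorem. The exact Turán numbers satisfy the same recursion, since
    [a - b] vertices added as a new part to a balanced [P]-partition of [b] vertices give a
    partition of [a] vertices into [P.+1] parts. *)
Lemma cliques_turan_bound P (A : {set T}) r : 0 < P -> omega_le e A P ->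
  #|cliques e A r| <= turan_number r #|A| P.
Proof.
move=> P0 oA; rewrite turan_number_elsym // -(ler_nat rat).
pose F (r P a : nat) : rat := (elsym (turan_sizes P a) r)%:R%R.
apply: (@cliques_bound _ _ e_sym e_irr F) oA => {P A r P0} [P a|r P a|r P a b ba Pb].
- by rewrite /F elsym0.
- exact: ler0n.
rewrite /F -natrM -natrD ler_nat -elsym_cons -turan_number_elsym //.
apply: elsym_le_turan => //=; first by rewrite size_turan_sizes.
case: P Pb => [|P] Pb; last by rewrite sumn_turan_sizes // subnK.
by rewrite Pb //= subn0 addn0.
Qed.

End ExactCliqueBound.

(** * Strong pairs *)

Lemma bin_le_expn n j : 'C(n, j) <= n ^ j.
Proof.
elim: n j => [|n IH] [|j] //; rewrite ?bin0 ?expn0 // binS.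
rewrite expnS mulSn addnC leq_add //.
  by apply: leq_trans (IH j) _; case: j => // j; rewrite leq_exp2r.
by apply: leq_trans (IH j.+1) _; rewrite expnS leq_mul2l; case: j => [|j]; rewrite ?expn0 ?leqnn ?orbT // leq_exp2r // leqnSn orbT.
Qed.

Lemma union_bound (T I : finType) (A : {set I}) (F : I -> {set T}) (B : {set T}) :
  (forall e, e \in B -> exists2 i, i \in A & e \in F i) ->
  #|B| <= \sum_(i in A) #|F i|.
Proof.
move=> H; apply: leq_trans (_ : #|\bigcup_(i in A) F i| <= _).
  by apply/subset_leq_card/subsetP => e /H[i iA eF]; apply/bigcupP; exists i.
elim/big_rec2: _ => [|i m X _ h]; first by rewrite cards0.
by apply: leq_trans (leq_card_setU _ _) _; rewrite leq_add2l.
Qed.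

Section Embedding.
Variables (V : finType) (E : {set {set V}}) (k c : nat).
Hypothesis unifE : uniform k (Hypergraph E).

Lemma card_edge e : e \in E -> #|e| = k.
Proof. by move=> eE; apply/eqP; have /forall_inP := unifE; apply. Qed.

Definition codeg (B : {set V}) : nat := #|[set e in E | B \subset e]|.

Lemma codeg_le B : codeg B * #|V| ^ #|B| <= #|V| ^ k.
Proof.
have [Bk|kB] := leqP #|B| k; last first.
  rewrite /codeg (_ : [set e in E | _] = set0) ?cards0 //; apply/setP => e.
  rewrite !inE; by apply/andP => -[eE /subset_leq_card]; rewrite (card_edge eE); lia.
rewrite -{1}(subnK Bk) expnD leq_mul2r; apply/orP; right.
apply: leq_trans (bin_le_expn _ _).
rewrite /codeg -(card_in_imset (f := fun e : {set V} => e :\: B)).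
  rewrite -card_draws; apply/subset_leq_card/subsetP => Y /imsetP[e].
  by rewrite !inE => /andP[eE Be] ->; rewrite cardsD (setIidPr Be) (card_edge eE).
move=> e e'; rewrite !inE => /andP[_ Be] /andP[_ Be'] h.
by rewrite -(setID e B) -(setID e' B) (setIidPr Be) (setIidPr Be') h.
Qed.

Definition strong_set (D : {set V}) : bool :=
  [forall A : {set V}, (#|A| <= c) ==>
     [exists e in E, (D \subset e) && (e :&: A \subset D)]].

Lemma strong_setP (D : {set V}) : reflect (forall A : {set V}, #|A| <= c ->
  exists2 e, e \in E & (D \subset e) && (e :&: A \subset D)) (strong_set D).
Proof.
apply: (iffP forallP) => [H A Ac|H A].
  by have /implyP/(_ Ac)/exists_inP := H A.
by apply/implyP => /H ?; apply/exists_inP.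
Qed.

Definition strong : rel V := [rel x y | (x != y) && strong_set [set x; y]].

Lemma strong_sym : symmetric strong.
Proof. by move=> x y; rewrite /strong /= eq_sym setUC. Qed.

Lemma strong_irr : irreflexive strong.
Proof. by move=> x; rewrite /strong /= eqxx. Qed.

(** The core goes to [X] and the new vertices of a pair go to the rest of the edge [f D]; the map is
    injective because these rests avoid [X] and each other. *)
Lemma embed_core (m : nat) (X : {set V}) (f : {set V} -> {set V}) :
  2 <= k -> #|X| = m ->
  (forall D : {set V}, D \subset X -> #|D| = 2 ->
     [/\ f D \in E, D \subset f D & f D :&: X \subset D]) ->
  (forall D D' : {set V}, D \subset X -> D' \subset X -> #|D| = 2 -> #|D'| = 2 ->
     D != D' -> f D :&: f D' \subset X) ->
  contains (Hypergraph E) (expanded_clique k m).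
Proof.
move=> k2 <- {m} f1 f2; set m := #|X|.
pose phi (i : 'I_m) : V := enum_val i.
have phi_inj : injective phi by apply: enum_val_inj.
have phiX i : phi i \in X by apply: enum_valP.
pose D (p : pair_of m) := phi @: val p.
have DX p : D p \subset X by apply/subsetP => _ /imsetP[i _ ->].
have D2 p : #|D p| = 2 by rewrite card_imset // (eqP (valP p)).
have D_inj : injective D.
  by move=> p q /(imset_inj phi_inj) /val_inj.
pose R p := f (D p) :\: D p.
have R2 p : #|R p| = k - 2.
  have [fE Df _] := f1 _ (DX p) (D2 p).
  by rewrite cardsD (setIidPr Df) card_edge // D2.
pose g (v : vertex (expanded_clique k m)) : V :=
  match v with inl i => phi i | inr (p, t) => enum_val (cast_ord (esym (R2 p)) t) end.
have gR p t : g (inr (p, t)) \in R p by apply: enum_valP.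
have RX p x : x \in R p -> x \notin X.
  have [_ _ /subsetP fX] := f1 _ (DX p) (D2 p).
  rewrite inE => /andP[xD xf]; apply: contra xD => xX; apply: fX; exact/setIP.
have g_inj : injective g.
  move=> [i|[p t]] [j|[q u]].
  - by move=> /phi_inj ->.
  - by move=> h; have := RX _ _ (gR q u); rewrite -h phiX.
  - by move=> h; have := RX _ _ (gR p t); rewrite h phiX.
  - move=> h; have [pq|pq] := eqVneq p q.
      by move: u h; rewrite -pq => u /enum_val_inj/cast_ord_inj->.
    have Dpq : D p != D q by apply: contra pq => /eqP/D_inj->.
    have /subsetP sX := f2 _ _ (DX p) (DX q) (D2 p) (D2 q) Dpq.
    have /negP[] := RX _ _ (gR p t); apply: sX; rewrite inE; apply/andP; split.
      by have := gR p t; rewrite inE => /andP[].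
    by have := gR q u; rewrite -h inE => /andP[].
apply/existsP; exists [ffun v => g v]; apply/andP; split.
  by apply/injectiveP => x y; rewrite !ffunE => /g_inj.
apply/forall_inP => _ /imsetP[p _ ->].
have [fE Df fX] := f1 _ (DX p) (D2 p).
rewrite (_ : _ @: _ = f (D p)) //; apply/eqP; rewrite eqEcard card_imset; last first.
  by move=> x y; rewrite !ffunE => /g_inj.
rewrite card_edge // (_ : #|_| = k) ?leqnn ?andbT; last first.
  apply/eqP; have /forall_inP := uniform_expanded_clique m k2; apply.
  by apply/imsetP; exists p.
apply/subsetP => _ /imsetP[v vp ->]; rewrite ffunE.
case/setUP: vp => /imsetP[].
  by move=> i ip ->; apply: (subsetP Df); apply/imsetP; exists i.
by move=> t _ ->; have := gR p t; rewrite inE => /andP[].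
Qed.

(** [U] holds [X] and the edges chosen so far. It grows by at most [k] per step, so it stays within
    the [c] vertices that a strong set can avoid. *)
Lemma greedy_edges (ds : seq {set V}) (X U : {set V}) :
  X \subset U -> uniq ds -> (forall D, D \in ds -> D \subset X /\ strong_set D) ->
  #|U| + size ds * k <= c ->
  exists f : {set V} -> {set V},
    (forall D, D \in ds -> [/\ f D \in E, D \subset f D & f D :&: U \subset D]) /\
    (forall D D', D \in ds -> D' \in ds -> D != D' -> f D :&: f D' \subset X).
Proof.
elim: ds U => [|D ds IH] U XU; first by exists id.
rewrite /= => /andP[Dds uds] H szU.
have [DX /strong_setP/(_ U)] := H D (mem_head _ _).
case=> [|e eE /andP[De eU]]; first by lia.
have H' D' : D' \in ds -> D' \subset X /\ strong_set D'.
  by move=> D'ds; apply: H; rewrite inE D'ds orbT.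
case: (IH (U :|: e)) => [|//|//||f [f1 f2]].
- by rewrite (subset_trans XU) // subsetUl.
- have := cardsU U e; rewrite (card_edge eE); lia.
have fe D' : D' \in ds -> f D' :&: e \subset X.
  move=> D'ds; have [_ _ f3] := f1 _ D'ds; have [D'X _] := H' _ D'ds.
  by apply: subset_trans D'X; apply: subset_trans f3; rewrite setIS // subsetUr.
exists (fun Z => if Z == D then e else f Z); split.
  move=> D'; rewrite inE; case: eqP => [-> _|_ /= /f1[fE Df fU]]; first by split.
  by split=> //; apply: subset_trans fU; rewrite setIS // subsetUl.
move=> D1 D2; rewrite !inE.
case: eqP => [->|_]; case: eqP => [->|_] /=; rewrite ?eqxx // => d1 d2 n12.
- by rewrite setIC fe.
- by rewrite fe.
- exact: f2.
Qed.

(** One pair [D0] may be weak if an edge [e0] for it is supplied: the greedy choice starts with [e0]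
    already among the vertices to be avoided. *)
Lemma embed_strong (m : nat) (X D0 e0 : {set V}) :
  2 <= k -> #|X| = m -> m + k + 'C(m, 2) * k <= c ->
  D0 \subset X -> e0 \in E -> D0 \subset e0 -> e0 :&: X \subset D0 ->
  (forall D : {set V}, D \subset X -> #|D| = 2 -> D != D0 -> strong_set D) ->
  contains (Hypergraph E) (expanded_clique k m).
Proof.
move=> k2 Xm mc D0X e0E De0 e0X H.
pose S := [set D : {set V} | [&& D \subset X, #|D| == 2 & D != D0]].
have [||f [f1 f2]] := @greedy_edges (enum S) X (X :|: e0) (subsetUl _ _) (enum_uniq _).
- by move=> D; rewrite mem_enum inE => /and3P[DX /eqP D2 DD0]; split=> //; apply: H.
- rewrite -cardE; have := cardsU X e0; rewrite (card_edge e0E) Xm.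
  have : #|S| <= 'C(m, 2).
    rewrite -Xm -cards_draws; apply/subset_leq_card/subsetP => D.
    by rewrite !inE => /and3P[-> -> _].
  move=> h; have : #|S| * k <= 'C(m, 2) * k by rewrite leq_mul2r h orbT.
  by lia.
have S1 (D : {set V}) : D \subset X -> #|D| = 2 -> D != D0 -> D \in enum S.
  by move=> a b d; rewrite mem_enum inE a b eqxx d.
pose g D := if D == D0 then e0 else f D.
have fe (D : {set V}) : D \in enum S -> f D :&: e0 \subset X.
  move=> DS; have [_ _ f3] := f1 _ DS.
  have DX : D \subset X by move: DS; rewrite mem_enum inE => /and3P[].
  by apply: subset_trans DX; apply: subset_trans f3; rewrite setIS // subsetUr.
apply: (@embed_core m X g k2 Xm) => [D DX D2|D1 D2 D1X D2X c1 c2 n12].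
  rewrite /g; case: eqP => [->|/eqP DD0]; first by split.
  have [fE Df fU] := f1 _ (S1 _ DX D2 DD0).
  by split=> //; apply: subset_trans fU; rewrite setIS // subsetUl.
rewrite /g; case: eqP => [e1|/eqP d1]; case: eqP => [e2|/eqP d2].
- by move: n12; rewrite e1 e2 eqxx.
- by rewrite setIC; apply/fe/S1.
- by apply/fe/S1.
- by apply: f2; rewrite ?S1.
Qed.

Section Free.
Variable P : nat.
Hypotheses (k2 : 2 <= k) (P0 : 0 < P) (large_c : P.+2 + k + 'C(P.+2, 2) * k <= c).
Hypothesis freeE : ~~ contains (Hypergraph E) (expanded_clique k P.+2).

Lemma pair_setP (D X : {set V}) : clique strong X -> D \subset X -> #|D| = 2 ->
  strong_set D.
Proof.
move=> /cliqueP cX /subsetP DX /eqP/cards2P[x [y [xy DE]]].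
have xX : x \in X by apply: DX; rewrite DE !inE eqxx.
have yX : y \in X by apply: DX; rewrite DE !inE eqxx orbT.
by have := cX _ _ xX yX xy; rewrite /strong /= DE => /andP[].
Qed.

Lemma strong_omega (A : {set V}) : omega_le strong A P.+1.
Proof.
apply: omega_leP => X _ cX; apply/eqP => XP.
(* An arbitrary pair of the clique serves as the exceptional [D0]; its edge comes from strength. *)
have : 0 < #|[set D : {set V} | D \subset X & #|D| == 2]|.
  by rewrite cards_draws bin_gt0 XP.
case/card_gt0P => D0; rewrite inE => /andP[D0X /eqP D02].
have [|e0 e0E /andP[De0 e0X]] := strong_setP _ (pair_setP cX D0X D02) X.
  by rewrite XP; lia.
case/negP: freeE; apply: (@embed_strong _ X D0 e0) => // D DX D2 _.
exact: pair_setP cX DX D2.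
Qed.

(** With a clique [Y] of [P] common strong neighbours off [e0], all pairs in [[set x; y] :|: Y]
    except perhaps [[set x; y]] are strong, and [e0] serves for this one. *)
Lemma covered_omega (x y : V) (e0 : {set V}) :
  x != y -> e0 \in E -> x \in e0 -> y \in e0 ->
  omega_le strong ((nbr strong x :&: nbr strong y) :\: e0) P.-1.
Proof.
move=> xy e0E xe ye; apply: omega_leP => Y YN cY; apply/eqP; rewrite prednK // => YP.
pose D0 := [set x; y]; pose X := D0 :|: Y.
have Ye : [disjoint Y & e0].
  by move: YN; rewrite subsetD => /andP[].
have D0e : D0 \subset e0 by rewrite subUset !sub1set xe.
have xY : x \notin Y by apply: contraL Ye => h; apply/pred0Pn; exists x; rewrite /= h.
have yY : y \notin Y by apply: contraL Ye => h; apply/pred0Pn; exists y; rewrite /= h.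
have XP : #|X| = P.+2.
  by rewrite /X /D0 -setUA !cardsU1 YP yY !inE negb_or xy xY.
case/negP: freeE; apply: (@embed_strong _ X D0 e0) => //.
- exact: subsetUl.
- rewrite setIUr subUset subsetIr setIC; move: Ye; rewrite -setI_eq0 => /eqP->.
  exact: sub0set.
move=> D DX /eqP/cards2P[u [v [uv DE]]] DD0.
have uX : u \in X by apply: (subsetP DX); rewrite DE !inE eqxx.
have vX : v \in X by apply: (subsetP DX); rewrite DE !inE eqxx orbT.
suff : strong u v by rewrite DE => /andP[].
have YN2 w : w \in Y -> strong x w /\ strong y w.
  by move=> wY; have := subsetP YN _ wY; rewrite !inE => /and3P[].
move: uX vX; rewrite !inE -!orbA.
case/or3P => [/eqP ux|/eqP uy|uY]; case/or3P => [/eqP vx|/eqP vy|vY].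
- by move: uv; rewrite ux vx eqxx.
- by move: DD0; rewrite DE ux vy eqxx.
- by rewrite ux; case: (YN2 _ vY).
- by move: DD0; rewrite DE uy vx setUC eqxx.
- by move: uv; rewrite uy vy eqxx.
- by rewrite uy; case: (YN2 _ vY).
- by rewrite strong_sym vx; case: (YN2 _ uY).
- by rewrite strong_sym vy; case: (YN2 _ uY).
- by move/cliqueP: cY; apply.
Qed.

End Free.

(** Some set of at most [c] vertices meets, outside the pair, every edge through the pair; each of
    its vertices shares at most [n^{k-3}] edges with the pair. *)
Lemma weak_codeg (x y : V) : x != y -> ~~ strong x y ->
  codeg [set x; y] * #|V| ^ 3 <= c * #|V| ^ k.
Proof.
move=> xy; rewrite /strong /= xy /= => /forallPn[A]; rewrite negb_imply => /andP[Ac].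
move=> /exists_inPn H; pose A' := A :\: [set x; y].
have h : codeg [set x; y] <= \sum_(a in A') codeg (a |: [set x; y]).
  apply: union_bound => e; rewrite inE => /andP[eE xye].
  have := H e eE; rewrite xye /= => /subsetPn[a /setIP[ae aA] axy].
  by exists a; [rewrite in_setD axy|rewrite inE eE subUset sub1set ae].
apply: leq_trans (leq_mul h (leqnn _)) _; rewrite big_distrl /=.
apply: leq_trans (_ : \sum_(a in A') #|V| ^ k <= _).
  apply: leq_sum => a; rewrite inE => /andP[axy _].
  have <- : #|a |: [set x; y]| = 3 by rewrite cardsU1 axy cards2 xy.
  exact: codeg_le.
by rewrite sum_nat_const leq_mul2r (leq_trans (subset_leq_card (subsetDl _ _)) Ac) orbT.
Qed.

End Embedding.

Local Open Scope ring_scope.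

(** * Estimates *)

(* [tdens p r] is the limit of [turan_number r N p / N ^ r]. *)
Definition tdens (p r : nat) : rat := 'C(p, r)%:R * p%:R^-1 ^+ r.

(* The limit of the degrees in [turan rho.+1 N p.+1], divided by [N ^ rho]. *)
Definition tdeg (p rho : nat) : rat := 'C(p, rho)%:R * p.+1%:R^-1 ^+ rho.

Lemma tdensE p rho : rho.+1%:R * tdens p.+1 rho.+1 = tdeg p rho.
Proof.
rewrite /tdens /tdeg mulrA -natrM -mul_bin_diag natrM exprS.
by rewrite mulrACA divff ?pnatr_eq0 // mul1r.
Qed.

Lemma tdens_ge0 p r : 0 <= tdens p r.
Proof. by rewrite mulr_ge0 ?ler0n // exprn_ge0 // invr_ge0 ler0n. Qed.

Section Densities.
Variables (rho p : nat).
Hypotheses (rho1 : (1 <= rho)%N) (rhop : (rho <= p)%N).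
Let P : rat := p.+1%:R.
Let tau := tdens p rho.
Let d := tdeg p rho.

Let p0 : (0 < p)%N. Proof. exact: leq_trans rhop. Qed.
Let p1 : 1 <= p%:R :> rat. Proof. by rewrite ler1n. Qed.
Let PE : P = p%:R + 1. Proof. by rewrite /P -natr1. Qed.

Lemma tdeg_gt0 : 0 < d.
Proof. by rewrite mulr_gt0 ?exprn_gt0 ?invr_gt0 ?ltr0n // bin_gt0. Qed.

Let g : rat := (p%:R / P) ^+ rho.

Let dE : d = tau * g.
Proof.
rewrite /d /tau /tdens /tdeg /g exprMn -!mulrA; congr (_ * _).
by rewrite mulrA -exprMn mulVf ?expr1n ?mul1r // pnatr_eq0 -lt0n.
Qed.

Let g_ge : 1 - rho%:R / P <= g.
Proof.
rewrite /g; case: (rho) rho1 => // r _.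
have P0 : P != 0 by rewrite pnatr_eq0.
have h : 0 <= p%:R / P by rewrite divr_ge0 ?ler0n.
have := bernoulli_tangent r ler01 h.
rewrite !expr1n mulr1 ; apply: le_trans.
rewrite (_ : 1 + _ = 1 - r.+1%:R / P) //.
have -> : p%:R = P - 1 by rewrite PE addrK.
by rewrite mulrBl divff //; ring.
Qed.

Let tau_gt0 : 0 < tau.
Proof. by rewrite mulr_gt0 ?exprn_gt0 ?invr_gt0 ?ltr0n // bin_gt0. Qed.

Lemma tdeg_le_tdens : d <= tau.
Proof.
rewrite dE ger_pMr // exprn_ile1 // ?divr_ge0 ?ler0n //.
by rewrite ler_pdivrMr ?ltr0n // mul1r ler_nat.
Qed.

Lemma tdens_le1 : tau <= 1.
Proof.
rewrite /tau /tdens exprVn ler_pdivrMr ?exprn_gt0 ?ltr0n // mul1r -natrX ler_nat.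
exact: bin_le_expn.
Qed.

(** Bernoulli gives [P (p/P)^rho >= P - rho >= 1]. This accounts for one of the three factors [P] in
    the bound on [s]. *)
Lemma tdens_le_tdeg : tau <= P * d.
Proof.
have P0 : 0 < P by rewrite ltr0n.
rewrite dE mulrCA ler_peMr ?(ltW tau_gt0) //.
have : P * (1 - rho%:R / P) <= P * g by rewrite ler_pM2l.
apply: le_trans; rewrite mulrBr mulr1 mulrCA divff ?gt_eqF // mulr1 PE.
have : rho%:R <= p%:R :> rat by rewrite ler_nat.
lra.
Qed.

(** The loss when the clique number of a neighbourhood drops from [p.+1] to [p]. Multiplied by
    [rho.+1], the two densities become [tau (p/P)^rho] and [tau (1 - rho/p)], which Bernoulli
    separates. *)
Lemma tdens_gap : tau / (2 * p%:R * P) <= tdens p.+1 rho.+1 - tdens p rho.+1.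
Proof.
have P0 : 0 < P by rewrite ltr0n.
have pp0 : 0 < p%:R :> rat by rewrite ltr0n.
set r : rat := rho.+1%:R; have r0 : 0 < r by rewrite ltr0n.
have rE : r = rho%:R + 1 by rewrite /r -natr1.
have r1 : 1 <= rho%:R :> rat by rewrite ler1n.
have e1 : r * tdens p.+1 rho.+1 = tau * g by rewrite tdensE -/d dE.
have e2 : r * tdens p rho.+1 = tau * (1 - rho%:R / p%:R).
  rewrite /r /tdens mulrA -natrM mul_bin_left natrM natrB // /tau /tdens exprS.
  by field; rewrite gt_eqF.
have h : r * (tau / (2 * p%:R * P)) <= tau * (rho%:R / (p%:R * P)).
  have -> : r * (tau / (2 * p%:R * P)) = tau * (r / 2 / (p%:R * P)).
    have E (x y a b : rat) : x != 0 -> y != 0 -> a * (b / (2 * x * y)) = b * (a / 2 / (x * y)).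
      by move=> x0 y0; field; rewrite x0 y0.
    by rewrite E ?gt_eqF.
  rewrite ler_pM2l // ler_wpM2r ?invr_ge0 ?mulr_ge0 ?ler0n //.
  by rewrite rE; lra.
rewrite -(ler_pM2l r0) mulrBr e1 e2 -mulrBr; apply: le_trans h _.
rewrite ler_pM2l //; have := g_ge.
have -> : rho%:R / (p%:R * P) = rho%:R / p%:R - rho%:R / P.
  have E (x y a : rat) : x != 0 -> y != 0 -> y = x + 1 -> a / (x * y) = a / x - a / y.
    by move=> x0 y0 yE; rewrite yE in y0 *; field; rewrite x0 y0.
  by rewrite E ?gt_eqF.
by move: (rho%:R / P) (rho%:R / p%:R) g => a b x; lra.
Qed.

Lemma tdens_le_half : tdens p.+1 rho.+1 <= tau / 2.
Proof.
have r2 : 2 <= rho.+1%:R :> rat by rewrite ler_nat.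
have := tdeg_le_tdens; rewrite /d -tdensE; have := tdens_ge0 p.+1 rho.+1.
set t := tdens _ _; set r := rho.+1%:R in r2 *; nra.
Qed.

End Densities.

Lemma sub1_exp_le (R : realDomainType) (x : R) r : 0 <= x <= 1 ->
  (1 - x) ^+ r <= 1 - r%:R * x + r%:R ^+ 2 * x ^+ 2.
Proof.
case/andP=> x0 x1; elim: r => [|r IH]; first by rewrite expr0; lra.
rewrite exprS; apply: le_trans (_ : (1 - x) * (1 - r%:R * x + r%:R ^+ 2 * x ^+ 2) <= _).
  by rewrite ler_wpM2l //; lra.
rewrite -subr_ge0 -(natr1 r).
rewrite (_ : _ - _ = r%:R * (x * x) + r%:R * r%:R * (x * x) * x + x * x); last by ring.
have a : 0 <= x * x by apply: mulr_ge0.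
by rewrite !addr_ge0 ?mulr_ge0 ?ler0n.
Qed.

Lemma add1_exp_le (R : realDomainType) (x : R) r : 0 <= x <= 1 ->
  (1 + x) ^+ r <= 1 + 2 ^+ r * x.
Proof.
case/andP=> x0 x1; suff : (1 + x) ^+ r <= 1 + (2 ^+ r - 1) * x.
  by move/le_trans; apply; rewrite lerD2l ler_wpM2r // gerBl ler01.
elim: r => [|r IH]; first by rewrite !expr0 subrr mul0r addr0.
have h : 1 <= 2 ^+ r :> R by rewrite -natrX ler1n expn_gt0.
rewrite !exprS; apply: le_trans (_ : (1 + x) * (1 + (2 ^+ r - 1) * x) <= _).
  by rewrite ler_wpM2l // addr_ge0.
rewrite -subr_ge0; set b := 2 ^+ r in h *.
rewrite (_ : _ - _ = (b - 1) * x * (1 - x)); last by ring.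
by rewrite !mulr_ge0 ?subr_ge0.
Qed.

(** A vertex of [S] with a strong neighbour in the core of [S] has a link of density about [T2] and
    not [T]. The loss, at least [tau / (2 P^2)], exceeds the roughly [tau / (28 P^2)] gained from
    edges through the core of [S], so its degree cannot be almost full. *)
Lemma dense_star_absurd (R : realFieldType) (N M s T T2 tau d th e4 B r P k1 k2 a : R) :
  0 < N -> 0 < M -> 0 <= th -> 0 <= e4 -> 1 <= B -> 2 <= r -> 2 <= P ->
  0 < d -> d <= tau -> tau <= 1 -> T <= tau / 2 -> tau <= (T - T2) * (2 * P ^+ 2) ->
  7 * r * P ^+ 3 * s <= N -> (8 * B * th + e4) * (4 * P ^+ 2) <= d ->
  0 <= a <= s -> 0 <= k2 <= tau * M + th * M -> k1 <= T2 * (N * M) + th * (N * M) ->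
  (1 - e4) * T * (N * M) <= k1 + a * k2 + 6 * B * th * (N * M) -> False.
Proof.
move=> N0 M0 t0 e0 B1 r2 P2 d0 dtau tau1 half gap2 sN K3 /andP[a0 as_] /andP[k20 hk2] hk1 main.
have m2 : a * k2 <= s * ((tau + th) * M) by apply: ler_pM => //; lra.
have m3 : (1 - e4) * T * N <= T2 * N + th * N + s * (tau + th) + 6 * B * th * N.
  by rewrite -(ler_pM2r M0); clear -main m2 hk1; lra.
have s0 : 0 <= s by apply: le_trans as_.
have Q4 : 4 <= P ^+ 2 by rewrite expr2; clear -P2; nra.
have m4 : s * (tau + th) * (28 * P ^+ 2) <= N * (tau + th).
  have tt : 0 <= tau + th by clear -d0 dtau t0; lra.
  have -> : s * (tau + th) * (28 * P ^+ 2) = s * (28 * P ^+ 2) * (tau + th) by ring.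
  rewrite ler_wpM2r //; apply: le_trans sN.
  have -> : 7 * r * P ^+ 3 * s = s * ((7 * r * P) * P ^+ 2) by ring.
  have rP : 28 <= 7 * r * P.
    have : 2 * 2 <= r * P by apply: ler_pM.
    by clear; lra.
  by rewrite ler_wpM2l // ler_wpM2r // (le_trans _ Q4).
have m5 : ((1 - e4) * T - T2 - th - 6 * B * th) * (28 * P ^+ 2) <= tau + th.
  rewrite -(ler_pM2r N0); apply: le_trans (_ : s * (tau + th) * (28 * P ^+ 2) <= _); last first.
    by rewrite [X in _ <= X]mulrC.
  rewrite mulrAC; apply: ler_wpM2r; first by clear -Q4; lra.
  by clear -m3; lra.
clear -gap2 m5 K3 Q4 B1 t0 e0 d0 dtau tau1 half; move: gap2 m5 K3 Q4.
set Q := P ^+ 2 => gap2 m5 K3 Q4.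
have Bth : th <= B * th by rewrite ler_peMl.
have e4Q : 0 <= e4 * Q by rewrite mulr_ge0 //; lra.
have e4T : e4 * T * Q <= e4 * Q * (1 / 2).
  by rewrite mulrAC ler_wpM2l //; lra.
have BQ : th * Q <= B * th * Q by rewrite ler_wpM2r //; lra.
have thQ : 4 * th <= th * Q by rewrite mulrC ler_wpM2l.
suff : (0 : R) < 0 by rewrite ltxx.
clear -gap2 m5 K3 dtau d0 e4Q e4T BQ thQ t0; lra.
Qed.

Lemma natr_divn_ge (m P : nat) : (0 < P)%N -> m%:R / P%:R - 1 <= (m %/ P)%:R :> rat.
Proof.
move=> P0; rewrite lerBlDr ler_pdivrMr ?ltr0n // natr1 -natrM ler_nat.
by rewrite ltnW // mulnC mulnC -ltn_divLR // ltnSn.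
Qed.

Lemma bernoulli_sub (R : realDomainType) (x : R) r : 0 <= x <= 1 ->
  1 - r%:R * x <= (1 - x) ^+ r.
Proof.
case/andP=> x0 x1; elim: r => [|r IH]; first by rewrite mul0r subr0 expr0.
rewrite exprS; apply: le_trans (_ : (1 - x) * (1 - r%:R * x) <= _); last first.
  by rewrite ler_wpM2l // subr_ge0.
rewrite -subr_ge0 -(natr1 r) (_ : _ - _ = r%:R * (x * x)); last by ring.
by rewrite !mulr_ge0 ?ler0n.
Qed.

(** [N] is a reference number of vertices and [x] the relative deficit of [m], which also has to
    cover the rounding in [m %/ p.+1]; hence the [p.+1] on the right of the hypothesis. *)
Lemma turan_term_real (m p r : nat) (N x : rat) : 0 <= N -> 0 <= x <= 1 ->
  N * (1 - x) <= m%:R - p.+1%:R ->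
  (p.+1%:R^-1 * N) ^+ r * (1 - r%:R * x) <= ((m %/ p.+1) ^ r)%:R :> rat.
Proof.
move=> N0 x01 h; have iP0 : 0 <= p.+1%:R^-1 :> rat by rewrite invr_ge0 ler0n.
have y0 : 0 <= p.+1%:R^-1 * N by rewrite mulr_ge0.
apply: le_trans (_ : (p.+1%:R^-1 * N) ^+ r * (1 - x) ^+ r <= _).
  by rewrite ler_wpM2l ?exprn_ge0 // bernoulli_sub.
rewrite natrX -exprMn lerXn2r ?nnegrE ?ler0n //.
  by rewrite mulr_ge0 // subr_ge0; case/andP: x01.
apply: le_trans (natr_divn_ge m (ltn0Sn p)); rewrite -mulrA.
apply: le_trans (_ : p.+1%:R^-1 * (m%:R - p.+1%:R) <= _); first by rewrite ler_wpM2l.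
by rewrite mulrBr mulVf ?pnatr_eq0 // mulrC.
Qed.

Lemma turan_number_real (m p r : nat) (N x : rat) : 0 <= N -> 0 <= x <= 1 ->
  N * (1 - x) <= m%:R - p.+1%:R ->
  tdens p.+1 r * N ^+ r * (1 - r%:R * x) <= (turan_number r m p.+1)%:R :> rat.
Proof.
move=> N0 x01 h; apply: le_trans (_ : ('C(p.+1, r) * (m %/ p.+1) ^ r)%:R <= _).
  rewrite natrM /tdens -!mulrA ler_wpM2l ?ler0n // mulrA -exprMn.
  exact: turan_term_real.
by rewrite ler_nat turan_number_ge.
Qed.

(** The final balance, with [s] typical and [y] atypical vertices in [S] and [x] atypical ones
    outside. An outer one lies in at most [(s+y)(d-e4)M] edges but raises the Turán number by [C],
    almost [d M]; an inner one has at most the proportion [1-e4] of [T N M] edges. The condition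
    [2 r th <= e4] lets both losses cover the errors. *)
Lemma core_sum (R : realFieldType) (N M d T th e4 r C s y x t2 tN : R) :
  0 <= N -> 0 < M -> 0 <= th -> 0 <= e4 -> 0 < d -> 0 <= T -> x <= th * N -> 2 <= r ->
  r * T = d -> d <= 1 -> 2 * r * th <= e4 -> 0 <= s -> 0 <= y -> 0 <= x ->
  t2 + x * C <= tN -> d * M * (1 - (r - 1) * (2 * th)) <= C ->
  T * (N * M) * (1 - r * th) <= tN ->
  s * t2 + (x * ((s + y) * ((d - e4) * M)) + y * ((1 - e4) * T * (N * M))) <= (s + y) * tN.
Proof.
move=> N0 M0 t0 e0 d0 T0 XN r2 rT d1 K4 s0 y0 x0 h1 h2 h3.
have a1 : s * (t2 + x * C) <= s * tN by apply: ler_wpM2l.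
have a2 : y * (T * (N * M) * (1 - r * th)) <= y * tN by apply: ler_wpM2l.
have a3 : (s * x) * (d * M * (1 - (r - 1) * (2 * th))) <= (s * x) * C.
  by apply: ler_wpM2l => //; apply: mulr_ge0.
have sxM : 0 <= s * x * M by rewrite !mulr_ge0 // ltW.
have a4 : (s * x * M) * (d * ((r - 1) * (2 * th))) <= (s * x * M) * e4.
  apply: ler_wpM2l => //; apply: le_trans K4.
  have : d * ((r - 1) * (2 * th)) <= 1 * ((r - 1) * (2 * th)).
    by apply: ler_wpM2r => //; rewrite !mulr_ge0 //; lra.
  lra.
have a5 : x * (d - e4) <= r * th * T * N.
  apply: le_trans (_ : x * d <= _); first by apply: ler_wpM2l => //; lra.
  have : x * d <= th * N * d by apply: ler_wpM2r => //; lra.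
  by rewrite -rT; lra.
have yM : 0 <= y * M by rewrite mulr_ge0 // ltW.
have a6 : (y * M) * (x * (d - e4)) <= (y * M) * (r * th * T * N) by apply: ler_wpM2l.
have a7 : (y * M * (T * N)) * (2 * r * th) <= (y * M * (T * N)) * e4.
  by apply: ler_wpM2l => //; apply: mulr_ge0 => //; apply: mulr_ge0.
clear -a1 a2 a3 a4 a6 a7; lra.
Qed.

(** The numerical reason for [e0 = 2/(7P^2)]: adjacent vertices with almost full links give
    [T - T2 <= 3/2 e0 tau = 3 tau/(7P^2)], but the gap is at least [tau/(2(P-1)P)], and
    [6(P-1) < 7P]. *)
Lemma rich_gap_absurd (R : realFieldType) (e0 T T2 tau P : R) :
  0 < e0 -> 2 <= P -> 0 < tau -> e0 * (7 * P ^+ 2) = 2 -> T <= tau / 2 ->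
  tau <= (T - T2) * (2 * (P - 1) * P) -> (1 - e0) * T <= T2 + e0 * tau -> False.
Proof.
move=> e00 P2 tau0 e0E half gap h.
have h2 : T - T2 <= e0 * (3 / 2 * tau).
  have : e0 * T <= e0 * (tau / 2) by rewrite ler_wpM2l // ltW.
  by clear -h; lra.
have h3 : (T - T2) * (7 * P ^+ 2) <= 3 * tau.
  apply: le_trans (_ : e0 * (3 / 2 * tau) * (7 * P ^+ 2) <= _).
    by rewrite ler_wpM2r // mulr_ge0 // exprn_ge0 // (le_trans _ P2).
  by rewrite mulrAC e0E; clear; lra.
have P1 : 0 < 2 * (P - 1) * P by rewrite !mulr_gt0 //; clear -P2; lra.
have g0 : 0 < T - T2 by rewrite -(pmulr_lgt0 _ P1); apply: lt_le_trans gap.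
have h4 : (T - T2) * (7 * P ^+ 2) <= (T - T2) * (6 * (P - 1) * P).
  by clear -h3 gap; lra.
rewrite ler_pM2l // expr2 in h4.
have : 0 < P * P by rewrite mulr_gt0 // (lt_le_trans _ P2).
by clear -h4 P2; lra.
Qed.

Lemma low_degree_absurd (R : realFieldType) (r mu th eps q : R) :
  0 < th -> 2 * r <= q * th -> 0 < q -> 2 <= r -> 4 * q * eps < th ->
  mu * q <= 1 -> 1 <= 2 * q * mu ->
  1 - eps <= 1 - r * mu + r ^+ 2 * mu ^+ 2 + r * mu * (1 - th) -> False.
Proof.
move=> t0 h1 q0 r2 h2 h3 h4 h5.
have m0 : 0 < mu.
  have : 0 < q * mu by lra.
  by rewrite pmulr_rgt0.
have r0 : 0 < r by lra.
have a1 : r * mu * th <= eps + (r * mu) * (r * mu) by rewrite !expr2 in h5; lra.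
have rm0 : 0 < r * mu by apply: mulr_gt0.
have a2 : 2 * (r * mu) <= th.
  have : 2 * r * mu <= q * th * mu by rewrite ler_pM2r.
  have : th * (mu * q) <= th * 1 by rewrite ler_pM2l.
  lra.
have a3 : (r * mu) * (2 * (r * mu)) <= (r * mu) * th by rewrite ler_pM2l.
have a4 : r * mu * th <= 2 * eps by lra.
have a5 : th * r * 1 <= th * r * (2 * q * mu) by rewrite ler_pM2l // mulr_gt0.
have a6 : q * (r * mu * th) <= q * (2 * eps) by rewrite ler_pM2l.
have a7 : th * 2 <= th * r by rewrite ler_pM2l.
have : (0 : R) < 0 by lra.
by rewrite ltxx.
Qed.

Section RealCounts.
Variables (V : finType) (E : {set {set V}}) (k c : nat).
Hypothesis unifE : uniform k (Hypergraph E).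
Let J := strong E c.
Let n : rat := #|V|%:R.
Hypothesis n_gt0 : 0 < n.

Lemma codeg_real (B : {set V}) : (codeg E B)%:R <= n ^+ k / n ^+ #|B| :> rat.
Proof.
rewrite ler_pdivlMr ?exprn_gt0 // -!natrX -natrM ler_nat; exact: codeg_le.
Qed.

Lemma codeg_weak_real x y : x != y -> ~~ J x y ->
  (codeg E [set x; y])%:R <= c%:R * (n ^+ k / n ^+ 3) :> rat.
Proof.
move=> xy wxy; rewrite mulrA ler_pdivlMr ?exprn_gt0 // -!natrX -!natrM ler_nat.
exact: weak_codeg.
Qed.

Lemma codeg_union (I : finType) (A : {set I}) (B : I -> {set V}) (D : {set {set V}}) (b : rat) :
  (forall e, e \in D -> e \in E /\ exists2 i, i \in A & B i \subset e) ->
  {in A, forall i, (codeg E (B i))%:R <= b} -> #|D|%:R <= #|A|%:R * b.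
Proof.
move=> H Hb; have h : (#|D| <= \sum_(i in A) codeg E (B i))%N.
  by apply: union_bound => e /H[eE [i iA Bi]]; exists i => //; rewrite inE eE.
apply: le_trans (_ : (\sum_(i in A) codeg E (B i))%:R <= _); first by rewrite ler_nat.
by rewrite natr_sum mulr_natl -sumr_const; apply: ler_sum => i; apply: Hb.
Qed.

End RealCounts.

Section CliqueReal.
Variables (V : finType) (J : rel V).
Hypotheses (J_sym : symmetric J) (J_irr : irreflexive J).

Lemma card_cliques_le (A : {set V}) r : #|cliques J A r|%:R <= #|A|%:R ^+ r :> rat.
Proof.
rewrite -natrX ler_nat; apply: leq_trans (bin_le_expn _ _).
rewrite -cards_draws; apply/subset_leq_card/subsetP => X.
by rewrite !inE => /and3P[-> ->].
Qed.

Lemma cliques_le_inter (A D : {set V}) r :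
  #|cliques J A r.+1|%:R <= #|cliques J (A :&: D) r.+1|%:R + #|A :\: D|%:R * #|A|%:R ^+ r :> rat.
Proof.
have := cliques_split J_sym J_irr A D r; rewrite -(ler_nat rat) natrD natr_sum => h.
apply: le_trans h _; rewrite lerD2l mulr_natl -sumr_const; apply: ler_sum => w _.
apply: le_trans (card_cliques_le _ _) _; rewrite lerXn2r ?nnegrE ?ler0n //.
by rewrite ler_nat subset_leq_card // subsetIl.
Qed.

Lemma cliques_tdens_bound (A : {set V}) P r (x : rat) :
  omega_le J A P -> #|A|%:R <= x -> #|cliques J A r|%:R <= tdens P r * x ^+ r.
Proof.
move=> oA Ax; apply: le_trans (cliques_real_bound J_sym J_irr r oA) _.
rewrite /tdens exprMn mulrA mulrAC ler_wpM2l //.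
  by rewrite mulr_ge0 ?ler0n // exprn_ge0 // invr_ge0 ler0n.
by rewrite lerXn2r ?nnegrE // (le_trans _ Ax).
Qed.

End CliqueReal.

Local Open Scope nat_scope.

(** * Typical vertices *)

Definition covered (V : finType) (E : {set {set V}}) : rel V :=
  [rel x y | (x != y) && [exists e in E, (x \in e) && (y \in e)]].

Lemma covered_sym (V : finType) (E : {set {set V}}) : symmetric (covered E).
Proof.
move=> x y; rewrite /covered /= eq_sym; congr (_ && _).
by apply: eq_existsb => e; rewrite [(x \in e) && _]andbC.
Qed.

Lemma covered_irr (V : finType) (E : {set {set V}}) : irreflexive (covered E).
Proof. by move=> x; rewrite /covered /= eqxx. Qed.

Lemma cardsU1_le (T : finType) (x : T) (A : {set T}) : #|x |: A| <= #|A|.+1.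
Proof. by rewrite cardsU1; case: (_ \notin _). Qed.

(** An element of [j >= 1] of the sets adds [j] on the left and [1 + j(j-1)] on the right; the pairs
    are ordered, so each intersection counts twice. *)
Lemma bonferroni (T I : finType) (X : {set I}) (A : I -> {set T}) (B : {set T}) :
  {in X, forall x, A x \subset B} ->
  \sum_(x in X) #|A x| <= #|B| + \sum_(x in X) \sum_(y in X :\ x) #|A x :&: A y|.
Proof.
move=> AB.
have cardE (D : {set T}) : D \subset B -> #|D| = \sum_(u in B) (u \in D).
  move=> DB; rewrite -sum1_card big_mkcond [RHS]big_mkcond /=; apply: eq_bigr => u _.
  by case: ifP => [/(subsetP DB) ->|_]; last case: ifP.
rewrite (eq_bigr (fun x => \sum_(u in B) (u \in A x))); last by move=> x /AB/cardE.
rewrite [X in _ <= _ + X](eq_bigr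
  (fun x => \sum_(u in B) \sum_(y in X :\ x) (u \in A x :&: A y))); last first.
  move=> x /AB xB; rewrite exchange_big /=; apply: eq_bigr => y _; apply: cardE.
  by apply: subset_trans xB; apply: subsetIl.
rewrite exchange_big [X in _ <= _ + X]exchange_big /= -sum1_card -big_split /=.
apply: leq_sum => u _; case: (pickP [pred x in X | u \in A x]) => [x /andP[xX ux]|none].
  rewrite (big_setD1 x) //= ux [X in _ <= 1 + X](big_setD1 x) //= leq_add2l.
  apply: leq_trans (leq_addr _ _); apply: leq_sum => y _.
  by rewrite inE ux.
by rewrite big1 // => x xX; have := none x; rewrite /= xX /= => ->.
Qed.

Section Core.
Variables (V : finType) (E : {set {set V}}) (rho p c : nat).
Hypotheses (rho1 : 1 <= rho) (rhop : rho <= p).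
Hypothesis unifE : uniform rho.+2 (Hypergraph E).
Hypothesis large_c : p.+3 + rho.+2 + 'C(p.+3, 2) * rho.+2 <= c.
Hypothesis freeE : ~~ contains (Hypergraph E) (expanded_clique rho.+2 p.+3).
Variable S : {set V}.
Let J := strong E c.
Let Nb := nbr J.

Let J_sym : symmetric J. Proof. exact: strong_sym. Qed.
Let J_irr : irreflexive J. Proof. exact: strong_irr. Qed.

Let J_omega (A : {set V}) : omega_le J A p.+2.
Proof. exact: (@strong_omega V E rho.+2 c unifE p.+1). Qed.

Let J_covered x y e : x != y -> e \in E -> x \in e -> y \in e ->
  omega_le J ((Nb x :&: Nb y) :\: e) p.
Proof. exact: (@covered_omega V E rho.+2 c unifE p.+1). Qed.

Variables (S1 O1 : {set V}) (th th2 : rat).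
Let s : rat := (#|S|%:R)%R.
Let N : rat := (#|~: S|%:R)%R.
Let iP : rat := (p.+1%:R^-1)%R.

Hypotheses (S1S : S1 \subset S) (O1O : O1 \subset ~: S).
Hypothesis S1_large : (#|S :\: S1|%:R <= th * s)%R.
Hypothesis O1_large : (#|~: S :\: O1|%:R <= th * N)%R.
Hypothesis S1_nbr : {in S1, forall v, (#|O1 :\: Nb v|%:R <= th * N)%R}.
Hypothesis O1_nbrO : {in O1, forall w, (#|O1 :\: Nb w|%:R <= (iP + th) * N)%R}.
Hypothesis O1_nbrS : {in O1, forall w, (#|S1 :\: Nb w|%:R <= th * s)%R}.
Hypotheses (th_ge0 : (0 <= th)%R) (th_th2 : (th <= th2)%R).
Hypothesis th2_small : (th2 * (p.+1%:R ^+ 2 * p.+2%:R * p.+4%:R) < 1)%R.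
Hypothesis s_large : (rho.+2%:R <= th2 * s)%R.
Hypothesis N_large : (rho.+2%:R <= th2 * N)%R.

(** The tolerance is [th2 >= th]: core vertices qualify automatically, and the room between the two
    lets every vertex of almost full degree qualify as well. *)
Definition typicalO : {set V} :=
  [set w in ~: S | (#|O1 :\: Nb w|%:R <= (iP + th2) * N)%R &&
                   (#|S1 :\: Nb w|%:R <= th2 * s)%R].

Definition typicalS : {set V} := [set z in S | (#|O1 :\: Nb z|%:R <= th2 * N)%R].

Let s_ge0 : (0 <= s)%R. Proof. exact: ler0n. Qed.
Let N_ge0 : (0 <= N)%R. Proof. exact: ler0n. Qed.
Let iP_gt0 : (0 < iP)%R. Proof. by rewrite invr_gt0 ltr0n. Qed.
Let iPP : (p.+1%:R * iP = 1)%R. Proof. by rewrite divff // pnatr_eq0. Qed.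
Let th2_gt0 : (0 < th2)%R.
Proof.
rewrite lt_neqAle (le_trans th_ge0) // andbT; apply/negP => /eqP t0.
by move: N_large; rewrite -t0 mul0r lern0.
Qed.

Lemma subset_O1_typical : O1 \subset typicalO.
Proof.
apply/subsetP => w wO; rewrite inE (subsetP O1O) //=; apply/andP; split.
  by apply: le_trans (O1_nbrO wO) _; rewrite ler_wpM2r // lerD2l.
by apply: le_trans (O1_nbrS wO) _; rewrite ler_wpM2r.
Qed.

Lemma subset_S1_typical : S1 \subset typicalS.
Proof.
apply/subsetP => w wS; rewrite inE (subsetP S1S) //=.
by apply: le_trans (S1_nbr wS) _; rewrite ler_wpM2r.
Qed.

(** Greedy descent: passing from [U] to the neighbourhood of one of its vertices discards at most
    [(iP + th) N] vertices and lowers the bound on the clique number by one. *)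
Lemma greedy_clique (U : {set V}) j : U \subset O1 -> omega_le J U j ->
  (#|U|%:R <= j%:R * ((iP + th) * N))%R.
Proof.
elim: j U => [|j IH] U UO oU; first by rewrite (omega_le0 oU) cards0 mul0r.
have [->|[u uU]] := set_0Vmem U.
  rewrite cards0; do 2?[apply: mulr_ge0 => //]; apply: addr_ge0 => //; exact: ltW.
rewrite -(cardsID (Nb u) U) natrD -natr1 mulrDl mul1r lerD //.
  apply: IH; first by apply: subset_trans UO; apply: subsetIl.
  exact: omega_le_nbr.
apply: le_trans (O1_nbrO (subsetP UO _ uU)).
by rewrite ler_nat subset_leq_card // setSD.
Qed.

Let S1_card : (s - th * s <= #|S1|%:R)%R.
Proof.
have := S1_large; rewrite cardsD (setIidPr S1S) natrB ?subset_leq_card //.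
by rewrite -/s; lra.
Qed.

Let O1_card : (N - th * N <= #|O1|%:R)%R.
Proof.
have := O1_large; rewrite cardsD (setIidPr O1O) natrB ?subset_leq_card //.
by rewrite -/N; lra.
Qed.

Let P_gt1 : (2%:R <= p.+1%:R :> rat)%R.
Proof. by rewrite ler_nat ltnS (leq_trans rho1). Qed.

Let th2_le : (th2 * (p.+1%:R * p.+4%:R) < 1)%R.
Proof.
have := P_gt1; have t0 := th2_gt0; have := th2_small.
have -> : (p.+2%:R = p.+1%:R + 1 :> rat)%R by rewrite natr1.
have : (0 < p.+4%:R :> rat)%R by rewrite ltr0n.
set P := (p.+1%:R)%R; set Q := (p.+4%:R)%R => Q0 h P2.
apply: le_lt_trans h; rewrite ler_wpM2l ?ltW //; nra.
Qed.

Let s_gt0 : (0 < s)%R.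
Proof.
rewrite lt_neqAle s_ge0 andbT; apply/negP => /eqP t0.
by move: s_large; rewrite -t0 mulr0 lern0.
Qed.

Let N_gt0 : (0 < N)%R.
Proof.
rewrite lt_neqAle N_ge0 andbT; apply/negP => /eqP t0.
by move: N_large; rewrite -t0 mulr0 lern0.
Qed.

(** The at most [p.+2] non-neighbourhoods in [S1], the set [e] and the part of [S] outside [S1] have
    at most [th2 * s] vertices each, together fewer than [s]. *)
Lemma exists_apex (W e : {set V}) : #|W| <= p.+2 -> #|e| <= rho.+2 ->
  {in W, forall w, (#|S1 :\: Nb w|%:R <= th2 * s)%R} ->
  exists2 v, v \in S1 :\: e & W \subset Nb v.
Proof.
move=> Wp ek H; apply/exists_inP; rewrite -[X in is_true X]negbK; apply/exists_inPn => none.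
pose F w := S1 :\: Nb w.
have h : #|S1 :\: e| <= \sum_(w in W) #|F w|.
  apply: union_bound => v vS; have /subsetPn[w wW wv] := none v vS.
  exists w => //; move: vS; rewrite /F !in_setD => /andP[_ ->]; rewrite andbT.
  by move: wv; rewrite /Nb !in_set J_sym.
have h1 : (#|S1|%:R <= rho.+2%:R + p.+2%:R * (th2 * s))%R.
  rewrite -(cardsID e S1) natrD lerD //.
    by rewrite ler_nat (leq_trans _ ek) // subset_leq_card // subsetIr.
  apply: le_trans (_ : (\sum_(w in W) #|F w|)%:R <= _)%R; first by rewrite ler_nat.
  rewrite natr_sum; apply: le_trans (_ : \sum_(w in W) (th2 * s) <= _)%R.
    by apply: ler_sum.
  rewrite sumr_const -[X in (X <= _)%R]mulr_natl; apply: ler_wpM2r; last by rewrite ler_nat.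
  by apply: mulr_ge0 => //; apply: ltW.
have := S1_card; have := s_large; have := th_th2; have := th2_le; have := P_gt1.
have -> : (p.+4%:R = p.+1%:R + 3 :> rat)%R by rewrite -natrD addn3.
have E2 : (p.+2%:R = p.+1%:R + 1 :> rat)%R by rewrite natr1.
move: h1; rewrite E2; have := s_gt0; have := th2_gt0.
set P := (p.+1%:R)%R; set k := (rho.+2%:R)%R => t0 s0 h1 P2 h2 h3 h4 h5.
have h6 : (th * s <= th2 * s)%R by rewrite ler_pM2r.
have h7 : (s * (th2 * (P + 3)) < s)%R.
  rewrite -[X in (_ < X)%R]mulr1 ltr_pM2l //; apply: le_lt_trans h2.
  by rewrite ler_pM2l //; nra.
nra.
Qed.

(** A [p]-clique of common strong neighbours in [O1] off [e] would extend by an apex in [S1] to a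
    [p.+1]-clique forbidden by [J_covered]. So the clique number there is at most [p.-1] and greedy
    descent applies. *)
Lemma common_nbr_covered x y e : x \in typicalO -> y \in typicalO -> x != y ->
  e \in E -> x \in e -> y \in e ->
  (#|O1 :&: Nb x :&: Nb y|%:R <= p.-1%:R * ((iP + th) * N) + rho.+2%:R)%R.
Proof.
rewrite !inE => /and3P[xO _ xS] /and3P[yO _ yS] xy eE xe ye.
have ek := card_edge unifE eE.
set A := _ :&: _; rewrite -(cardsID e A) natrD addrC lerD //; last first.
  by rewrite ler_nat -ek subset_leq_card // subsetIr.
apply: greedy_clique; first by rewrite subDset /A -setIA subsetU // subsetIl orbT.
apply: omega_leP => Y YU cY; rewrite prednK ?(leq_trans rho1) //; apply/eqP => Yp.
have YO y0 : y0 \in Y -> y0 \in O1.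
  by move=> /(subsetP YU); rewrite !inE => /andP[_ /andP[/andP[]]].
have [|||v vS /subsetP vN] := @exists_apex (x |: (y |: Y)) e.
- by rewrite (leq_trans (cardsU1_le _ _)) // ltnS -Yp cardsU1_le.
- by rewrite ek.
- move=> w /setU1P[->//|/setU1P[->//|/YO wO]].
  by apply: le_trans (O1_nbrS wO) _; rewrite ler_wpM2r.
have vx : J x v by have := vN x; rewrite !inE eqxx => /(_ isT); rewrite J_sym.
have vy : J y v by have := vN y; rewrite !inE eqxx orbT => /(_ isT); rewrite J_sym.
have vY : Y \subset Nb v by apply/subsetP => w wY; apply: vN; rewrite !inE wY !orbT.
have : #|v |: Y| <= p.
  apply: (J_covered xy eE xe ye); last exact: cliqueU1.
  apply/subsetP => w /setU1P[->|/(subsetP YU)].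
    by move: vS; rewrite !inE => /andP[-> _]; rewrite vx vy.
  by rewrite /A !inE => /andP[-> /andP[/andP[_ ->] ->]].
by rewrite cardsU1 (nbr_notin J_irr vY) Yp ltnn.
Qed.

(** A [p.+1]-clique here, together with [x] and an apex in [S1], would be a strong clique on [p.+3]
    vertices. *)
Lemma nbr_typical_omega x : x \in typicalO -> omega_le J (O1 :&: Nb x) p.
Proof.
rewrite !inE => /and3P[xO _ xS].
apply: omega_leP => Y; rewrite subsetI => /andP[YO YN] cY; apply/eqP => Yp.
have [|||v vS vN] := @exists_apex (x |: Y) set0.
- by rewrite -Yp cardsU1_le.
- by rewrite cards0.
- move=> w /setU1P[->//|/(subsetP YO) wO].
  by apply: le_trans (O1_nbrS wO) _; rewrite ler_wpM2r.
have cxY : clique J (x |: Y) by apply: cliqueU1.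
have := J_omega (subsetT _) (cliqueU1 J_sym vN cxY).
by rewrite cardsU1 (nbr_notin J_irr vN) cardsU1 (nbr_notin J_irr YN) Yp !add1n ltnn.
Qed.

Lemma nbr_typical_card x : x \in typicalO ->
  (#|O1 :&: Nb x|%:R <= p%:R * ((iP + th) * N))%R.
Proof.
by move=> /nbr_typical_omega; apply: greedy_clique; apply: subsetIl.
Qed.

(* The non-neighbourhoods in [O1] of pairwise covered typical vertices are nearly disjoint
   and have size about [N / P], so there cannot be [P + 1] of them. *)
Lemma covered_typical_omega : omega_le (covered E) typicalO p.+1.
Proof.
apply: omega_leP => X XO /cliqueP cX; apply/eqP => Xp.
pose A x := O1 :\: Nb x.
have AO x : x \in X -> A x \subset O1 by move=> _; apply: subsetDl.
have xO x : x \in X -> x \in typicalO by apply: (subsetP XO).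
have := bonferroni AO; rewrite -(ler_nat rat) natrD !natr_sum => bonf.
have t0 := th2_gt0; have N0 := N_gt0; have O1N := O1_card.
have O1le : (#|O1|%:R <= N)%R by rewrite ler_nat subset_leq_card.
have thN : (th * N <= th2 * N)%R by rewrite ler_pM2r.
have EP : (p%:R = p.+1%:R - 1 :> rat)%R by rewrite -natr1 addrK.
have EP1 : (p.-1%:R = p.+1%:R - 2 :> rat)%R.
  have p0 : 0 < p := leq_trans rho1 rhop.
  by rewrite -(prednK p0) -!natr1 /=; ring.
have P2 := P_gt1; have PE := iPP.
have Alow x : x \in X -> (iP * N - p.+1%:R * (th2 * N) <= #|A x|%:R)%R.
  move=> /xO xT; have := nbr_typical_card xT.
  have := cardsID (Nb x) O1; rewrite -/(A x) => /(congr1 (fun m => m%:R : rat)%R).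
  rewrite natrD EP; move: P2 PE O1N thN.
  set P := (p.+1%:R)%R; set a := (#|A x|%:R)%R; set b := (#|_|%:R)%R.
  move=> P2 PE O1N thN h1 h2.
  have : ((P - 1) * (th * N) <= (P - 1) * (th2 * N))%R by rewrite ler_wpM2l //; lra.
  have : (P * (iP * N) = N)%R by rewrite mulrA PE mul1r.
  lra.
(* Inclusion-exclusion bounds the intersection by [#|A x| + #|A y| - #|O1|] plus the common
   neighbourhood; the main terms [2N/P - N + (P-2)N/P] cancel. *)
have Aup x y : x \in X -> y \in X :\ x -> (#|A x :&: A y|%:R <= p.+3%:R * (th2 * N))%R.
  move=> xX; rewrite !inE => /andP[yx yX].
  have := cX _ _ yX xX yx; rewrite /covered /= => /andP[_ /exists_inP[e eE /andP[ye xe]]].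
  have := common_nbr_covered (xO _ yX) (xO _ xX) yx eE ye xe.
  have := xO _ xX; have := xO _ yX; rewrite !inE => /and3P[_ yN _] /and3P[_ xN _].
  have : #|A x :&: A y| + #|O1| <= #|A x| + #|A y| + #|O1 :&: Nb y :&: Nb x|.
    rewrite -(cardsUI (A x) (A y)) addnAC addnC leq_add2r.
    apply: leq_trans (leq_card_setU _ _); apply/subset_leq_card/subsetP => u uO.
    by rewrite /A !inE uO; case: (J x u); case: (J y u).
  rewrite -(ler_nat rat) !natrD -/(A x) -/(A y) in xN yN *.
  have -> : (p.+3%:R = p.+1%:R + 2 :> rat)%R by rewrite -natrD addn2.
  rewrite EP1; have kN := N_large; move: P2 PE O1N thN.
  set P := (p.+1%:R)%R => P2 PE O1N thN h1 h2.
  have : ((P - 2) * (th * N) <= (P - 2) * (th2 * N))%R by rewrite ler_wpM2l //; lra.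
  have : (P * (iP * N) = N)%R by rewrite mulrA PE mul1r.
  rewrite -/(A x) -/(A y) in xN yN; lra.
have Xr : (#|X|%:R = p.+1%:R + 1 :> rat)%R by rewrite Xp natr1.
have low : ((p.+1%:R + 1) * (iP * N - p.+1%:R * (th2 * N)) <= \sum_(x in X) #|A x|%:R)%R.
  rewrite -Xr mulr_natl -sumr_const; exact: ler_sum.
have up : (\sum_(x in X) (\sum_(y in X :\ x) #|A x :&: A y|)%:R <=
   (p.+1%:R + 1) * (p.+1%:R * (p.+3%:R * (th2 * N))))%R.
  rewrite -Xr mulr_natl -sumr_const; apply: ler_sum => x xX.
  have XD : #|X :\ x| = p.+1 by apply/eqP; rewrite -eqSS -Xp (cardsD1 x X) xX.
  rewrite (_ : p.+1%:R = #|X :\ x|%:R :> rat)%R; last by rewrite XD.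
  rewrite mulr_natl -sumr_const natr_sum; apply: ler_sum => y; exact: Aup.
have := th2_small; move: low up P2 PE O1N thN.
have -> : (p.+2%:R = p.+1%:R + 1 :> rat)%R by rewrite natr1.
have -> : (p.+3%:R = p.+1%:R + 2 :> rat)%R by rewrite -natrD addn2.
have -> : (p.+4%:R = p.+1%:R + 3 :> rat)%R by rewrite -natrD addn3.
set P := (p.+1%:R)%R => low up P2 PE O1N thN small.
have PiN : (P * (iP * N) = N)%R by rewrite mulrA PE mul1r.
(* Up to errors, Bonferroni says [(P+1)N/P <= N], which leaves [N/P] bounded by the errors.
   Multiplication by [P] produces the polynomial of [th2_small]. *)
have h1 : (iP * N <= (P + 1) * P * (P + 3) * (th2 * N))%R by lra.
have h2 : (P * (iP * N) <= P * ((P + 1) * P * (P + 3) * (th2 * N)))%R.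
  by rewrite ler_wpM2l //; lra.
have h3 : (N * (th2 * (P ^+ 2 * (P + 1) * (P + 3))) < N)%R.
  by rewrite -[X in (_ < X)%R]mulr1 ltr_pM2l.
move: h2 h3; rewrite PiN expr2; lra.
Qed.

(** The two vertices jointly see almost all of [O1], but off [e] the clique number there is at most
    [p], and greedy descent allows only about [p N / P] vertices. *)
Lemma covered_typicalS z z' e : z \in typicalS -> z' \in typicalS -> z != z' ->
  e \in E -> z \in e -> z' \notin e.
Proof.
rewrite !inE => /andP[_ zN] /andP[_ z'N] zz' eE ze; apply/negP => z'e.
have ek := card_edge unifE eE.
pose U := (O1 :&: (Nb z :&: Nb z')) :\: e.
have : (#|U|%:R <= p%:R * ((iP + th) * N))%R.
  apply: greedy_clique; first by rewrite /U subDset subsetU // subsetIl orbT.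
  by apply: omega_leS (J_covered zz' eE ze z'e); rewrite /U setSD // subsetIr.
have : #|O1| <= #|U| + (#|O1 :\: Nb z| + (#|O1 :\: Nb z'| + #|e|)).
  apply: leq_trans (_ : #|U :|: ((O1 :\: Nb z) :|: ((O1 :\: Nb z') :|: e))| <= _).
    apply/subset_leq_card/subsetP => u uO; rewrite !in_setU !in_setD !in_setI uO.
    by case: (u \in e); case: (u \in Nb z); case: (u \in Nb z').
  do 3![apply: leq_trans (leq_card_setU _ _) _; rewrite leq_add2l].
  by [].
rewrite ek -(ler_nat rat) !natrD.
have := O1_card; have := th2_le; have := N_large; have := P_gt1; have := N_gt0.
have := th2_gt0; have := iPP.
have -> : (p.+4%:R = p.+1%:R + 3 :> rat)%R by rewrite -natrD addn3.
have -> : (p%:R = p.+1%:R - 1 :> rat)%R by rewrite -natr1 addrK.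
set P := (p.+1%:R)%R; move: zN z'N.
set a := (#|O1|%:R)%R; set b := (#|U|%:R)%R.
set a1 := (#|_ :\: _|%:R)%R; set a2 := (#|_ :\: _|%:R)%R.
move=> h1 h2 iPE t0 N0 P2 h3 h4 h5 h6 h7.
have h8 : (th * N <= th2 * N)%R by rewrite ler_pM2r.
have h9 : ((P - 1) * ((iP + th) * N) <= N - iP * N + (P - 1) * (th2 * N))%R by nra.
have h10 : (iP * N <= (P + 3) * (th2 * N))%R by lra.
have h11 : (P * (iP * N) <= P * ((P + 3) * (th2 * N)))%R by rewrite ler_wpM2l //; lra.
rewrite mulrA iPE mul1r in h11.
have h12 : (N * (th2 * (P * (P + 3))) < N)%R by rewrite -[X in (_ < X)%R]mulr1 ltr_pM2l.
by move: h12; apply/negP; rewrite -leNgt; lra.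
Qed.

(** * Edges at a single vertex, and the exact bound from the cores *)

Local Open Scope ring_scope.

Let n : rat := (#|V|%:R)%R.
Hypothesis n_le : (n <= 2 * N)%R.

Let n_gt0 : (0 < n)%R.
Proof. by apply: lt_le_trans N_gt0 _; rewrite ler_nat max_card. Qed.

Let N_le_n : (N <= n)%R.
Proof. by rewrite ler_nat max_card. Qed.

Let codeg_real (B : {set V}) : (codeg E B)%:R <= n ^+ rho.+2 / n ^+ #|B| :> rat.
Proof. exact: codeg_real. Qed.

Let codeg_weak_real x y : x != y -> ~~ J x y ->
  (codeg E [set x; y])%:R <= c%:R * (n ^+ rho.+2 / n ^+ 3) :> rat.
Proof. exact: codeg_weak_real. Qed.

Lemma strong_covered x y : J x y -> covered E x y.
Proof.
rewrite /J /strong /= => /andP[xy /strong_setP/(_ set0)]; rewrite cards0 => /(_ isT).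
case=> e eE; rewrite subUset !sub1set => /andP[/andP[xe ye] _].
by rewrite /covered /= xy; apply/exists_inP; exists e => //; rewrite xe.
Qed.

Definition weak_pairs : {set V * V} :=
  [set q | [&& q.1 \in O1, q.2 \in O1, covered E q.1 q.2 & ~~ J q.1 q.2]].

(** On [O1] the covered pairs form a K_{p+2}-free graph, so at most [(1 - 1/P) x^2] ordered pairs
    are covered, [x = #|O1|], and the strong pairs alone nearly reach this number. A bound
    proportional to [th] is needed because the edges at one vertex leave no room for arbitrarily
    many weak pairs. *)
Lemma card_weak_pairs : #|weak_pairs|%:R <= 3 * th * N ^+ 2.
Proof.
pose C := covered E.
have E1 : (#|weak_pairs| + \sum_(x in O1) #|O1 :&: Nb x| = \sum_(x in O1) #|O1 :&: nbr C x|)%N.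
  rewrite -sum1_card (eq_bigl (fun q : V * V => (q.1 \in O1) &&
    (q.2 \in (O1 :&: nbr C q.1) :\: Nb q.1))); last first.
    move=> q; rewrite inE in_setD in_setI /Nb !in_set /C.
    by case: (q.1 \in O1); case: (q.2 \in O1); case: (covered E _ _); case: (J _ _).
  rewrite -(pair_big_dep (mem O1) (fun x y => y \in (O1 :&: nbr C x) :\: Nb x) (fun _ _ => 1%N)) /=.
  rewrite -big_split /=; apply: eq_bigr => x xO1.
  rewrite sum1_card addnC -[RHS](cardsID (Nb x)); congr (_ + _)%N.
  apply: eq_card => y; rewrite !in_setI /Nb !in_set /C.
  by case Jxy: (J x y); rewrite ?andbF ?(strong_covered Jxy) ?andbT.
have E2 : (\sum_(x in O1) #|O1 :&: nbr C x| = 2 * #|cliques C O1 2|)%N.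
  have := sum_cliques_nbr (@covered_sym V E) (@covered_irr V E) O1 set0 1.
  rewrite setD0; under eq_bigr do rewrite cliques1; move=> ->.
  rewrite mulnC -sum_nat_const; apply: eq_bigr => X; rewrite inE setD0.
  by case/and3P => _ /eqP.
have E3 : (2 * 'C(p.+1, 2))%:R = p.+1%:R * p%:R :> rat.
  by rewrite -natrM -[2%N]/(1.+1) -mul_bin_diag bin1.
have := cliques_real_bound (@covered_sym V E) (@covered_irr V E) 2
   (omega_leS subset_O1_typical covered_typical_omega).
have low : #|O1|%:R * (#|O1|%:R - (iP + th) * N) <= \sum_(x in O1) #|O1 :&: Nb x|%:R :> rat.
  rewrite mulr_natl -sumr_const; apply: ler_sum => x xO.
  have := O1_nbrO xO; rewrite cardsD natrB ?subset_leq_card ?subsetIl //; lra.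
have := congr1 (fun m => m%:R : rat) E1; rewrite E2 natrD natrM natr_sum.
move: low; have O1le : #|O1|%:R <= N by rewrite ler_nat subset_leq_card.
have := O1_card; have P2 := P_gt1; have PE := iPP.
have EP : p%:R = p.+1%:R - 1 :> rat by rewrite -natr1 addrK.
move: E3; rewrite EP; have N0 := N_gt0; have i0 := iP_gt0; have t0 := th_ge0.
set x := #|O1|%:R in O1le *; set K := \sum_(_ in _) _; set w := #|weak_pairs|%:R.
move: N0 i0 t0 PE P2; rewrite -/iP.
set b := 'C(_, _)%:R; set P := p.+1%:R.
move=> N0 i0 t0 PE P2; rewrite natrM -/b => E3 xlow low h1 h2.
have E4 : 2 * (b * (x * iP) ^+ 2) = x * x * (1 - iP).
  rewrite exprMn mulrA E3; transitivity (x * x * (P * iP) * (P * iP - iP)); first ring.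
  by rewrite PE; ring.
have iP1 : iP <= 1 by nra.
have h3 : w <= x * ((iP + th) * N - iP * x) by lra.
have h4 : (iP + th) * N - iP * x <= th * N * (1 + iP).
  have : iP * (N - th * N) <= iP * x by rewrite ler_wpM2l // ltW.
  lra.
have x0 : 0 <= x by apply: ler0n.
have a0 : 0 <= th * N by apply: mulr_ge0 => //; apply: ltW.
have h5 : th * N * (1 + iP) <= 3 * (th * N).
  by rewrite [X in _ <= X]mulrC ler_wpM2l //; lra.
apply: le_trans h3 _; apply: le_trans (_ : x * (3 * (th * N)) <= _).
  by rewrite ler_wpM2l // (le_trans h4).
have : x * (3 * (th * N)) <= N * (3 * (th * N)) by rewrite ler_wpM2r //; lra.
rewrite expr2; lra.
Qed.

Let q : rat := n ^+ rho.
Let q3 : n ^+ rho.+2 / n ^+ 3 = q / n.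
Proof. by rewrite !exprS /q; field; rewrite gt_eqF. Qed.
Let q2 : n ^+ rho.+2 / n ^+ 2 = q.
Proof. by rewrite !exprS /q; field; rewrite gt_eqF. Qed.
Let q4 : n ^+ rho.+2 / n ^+ 4 = q / n / n.
Proof. by rewrite !exprS /q; field; rewrite gt_eqF. Qed.
Let q_ge0 : 0 <= q. Proof. by apply: exprn_ge0; apply: ltW. Qed.

Definition clean_at (u : V) (e : {set V}) : bool :=
  [forall y in e, (y != u) ==> [&& J u y, (y \in O1) || (y \in S1) &
     [forall x in e, (x != u) ==> ((x, y) \notin weak_pairs)]]].

Lemma clean_atP (u : V) (e : {set V}) : reflect
  [/\ {in e, forall y, y != u -> J u y},
      {in e, forall y, y != u -> (y \in O1) || (y \in S1)} &
      {in e &, forall x y, x != u -> y != u -> (x, y) \notin weak_pairs}] (clean_at u e).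
Proof.
apply: (iffP forall_inP) => [H|[h1 h2 h3] y ye].
  split=> [y ye yu|y ye yu|x y xe ye xu yu]; have := H y ye; rewrite yu /= => /and3P[] //.
  by move=> _ _ /forall_inP/(_ x xe); rewrite xu.
apply/implyP => yu; rewrite h1 ?h2 //=; apply/forall_inP => x xe; apply/implyP => xu.
exact: h3.
Qed.

Lemma clean_unique (e : {set V}) (v v' : V) : e \in E -> v \in e -> v' \in e -> v \in S1 -> v' \in S1 -> v = v'.
Proof.
move=> eE ve v'e vS v'S; apply/eqP; apply: contraT => vv'.
have := covered_typicalS (subsetP subset_S1_typical _ vS) (subsetP subset_S1_typical _ v'S)
  vv' eE ve.
by rewrite v'e.
Qed.

Lemma clean_clique (u : V) (e f : {set V}) : e \in E -> clean_at u e ->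
  f \subset e -> u \notin f -> f \subset O1 -> f \in cliques J (O1 :&: Nb u) #|f|.
Proof.
move=> eE /clean_atP[c1 c2 c3] /subsetP fe uf /subsetP fO; rewrite inE eqxx /=.
have fu y : y \in f -> y != u by move=> yf; apply: contraNneq uf => <-.
apply/andP; split.
  by apply/subsetP => y yf; rewrite inE fO //= /Nb inE c1 ?fe ?fu.
apply/cliqueP => x y xf yf xy; have := c3 x y (fe _ xf) (fe _ yf) (fu _ xf) (fu _ yf).
rewrite inE /= !fO //=; suff -> : covered E x y by rewrite negbK.
by rewrite /covered /= xy; apply/exists_inP; exists e; rewrite // !fe.
Qed.

Definition star (w : V) : {set {set V}} := [set e in E | (w \in e) && (e :&: S != set0)].

Lemma clean_edge_S (w v : V) (e : {set V}) : e \in E -> w \in e -> clean_at w e ->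
  v \in e -> v \in S1 -> v != w ->
  let f := (e :\ w) :\ v in
  [/\ e = w |: (v |: f), f \in cliques J (O1 :&: Nb w) rho & v \in S1 :&: Nb w].
Proof.
move=> eE we cl ve vS vw f.
have f1 : v \in e :\ w by rewrite !inE vw.
have cf : #|f| = rho.
  have := card_edge unifE eE; rewrite (cardsD1 w) we (cardsD1 v (e :\ w)) f1.
  by rewrite !add1n => -[].
split; first by rewrite /f !setD1K.
  rewrite -cf; apply: (clean_clique eE cl) => //.
  - by apply: subset_trans (subsetDl _ _) (subsetDl _ _).
  - by rewrite !inE eqxx andbF.
  apply/subsetP => y; rewrite !inE => /and3P[yv yw ye].
  have /clean_atP[_ c2 _] := cl; have /orP[//|yS] := c2 y ye yw.
  by rewrite (clean_unique eE ye ve yS vS) eqxx in yv.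
by have /clean_atP[c1 _ _] := cl; rewrite inE vS /Nb inE c1.
Qed.

(** A clean edge at a vertex outside [S] has exactly one vertex in [S1], and its remaining [rho]
    vertices form a strong clique in [O1]. *)
Lemma clean_starO w : w \in ~: S ->
  (#|[set e in star w | clean_at w e]| <=
     #|S1 :&: Nb w| * #|cliques J (O1 :&: Nb w) rho|)%N.
Proof.
move=> wS; rewrite -cardsX.
apply: leq_trans (leq_imset_card (fun vf : V * {set V} => w |: (vf.1 |: vf.2)) _).
apply/subset_leq_card/subsetP => e; rewrite !in_set => /andP[/and3P[eE we]].
case/set0Pn => v /setIP[ve vS] cl.
have vw : v != w by move: wS; rewrite inE; apply: contraNneq => <-.
have vS1 : v \in S1.
  have /clean_atP[_ c2 _] := cl; have /orP[/(subsetP O1O)|//] := c2 v ve vw.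
  by rewrite inE vS.
have [eq_e fc vN] := clean_edge_S eE we cl ve vS1 vw.
by apply/imsetP; exists (v, (e :\ w) :\ v) => //; rewrite in_setX vN.
Qed.

(** Four defects are possible: a weak neighbour of [w], a vertex outside both [S] and [O1], a vertex
    of [S :\: S1], a weak pair. Besides [w] every edge contains a vertex of [S], which supplies the
    factor [s] in the second and fourth case. The shares are [1 + 1 + 1 + 3]. *)
Lemma dirty_starO w : w \in ~: S -> c%:R <= th * s ->
  #|[set e in star w | ~~ clean_at w e]|%:R <= 6 * th * s * q.
Proof.
move=> wS cs; set D := [set e in star w | _].
have wSn : w \notin S by move: wS; rewrite inE.
have DE e : e \in D -> [/\ e \in E, w \in e & exists2 v, v \in e & v \in S].
  rewrite inE => /andP[]; rewrite inE => /and3P[eE we /set0Pn[v /setIP[ve vS]]] _.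
  by split=> //; exists v.
pose A1 := [set y | (y != w) && ~~ J w y].
pose W1 := [set e in D | [exists y in A1, y \in e]].
pose A2 := setX ((~: S :\: O1) :\ w) S.
pose W2 := [set e in D | [exists y in (~: S :\: O1) :\ w, y \in e]].
pose A3 := S :\: S1.
pose W3 := [set e in D | [exists v in A3, v \in e]].
pose A4 := setX [set q0 in weak_pairs | (q0.1 != w) && (q0.2 != w)] S.
pose W4 := [set e in D | [exists q0 in weak_pairs,
   [&& q0.1 != w, q0.2 != w, q0.1 \in e & q0.2 \in e]]].
have n0 := n_gt0; have Q0 := q_ge0; have nN := N_le_n.
have sn : s <= n by rewrite ler_nat max_card.
have h1 : #|W1|%:R <= n * (c%:R * (q / n)).
  apply: le_trans (_ : #|A1|%:R * (c%:R * (q / n)) <= _); last first.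
    rewrite ler_wpM2r ?ler_nat ?max_card // mulr_ge0 ?ler0n // divr_ge0 //; exact: ltW.
  apply: (@codeg_union _ E _ A1 (fun y => [set w; y])) => [e|y].
    rewrite inE => /andP[/DE[eE we _]] /exists_inP[y yA ye]; split=> //; exists y => //.
    by rewrite subUset !sub1set we.
  by rewrite inE -q3 => /andP[yw Jwy]; apply: codeg_weak_real => //; rewrite eq_sym.
have h2 : #|W2|%:R <= (th * N * s) * (q / n).
  apply: le_trans (_ : #|A2|%:R * (q / n) <= _); last first.
    rewrite ler_wpM2r ?divr_ge0 // ?(ltW n0) // cardsX natrM ler_wpM2r //.
    by apply: le_trans O1_large; rewrite ler_nat subset_leq_card // subsetDl.
  apply: (@codeg_union _ E _ A2 (fun y => [set w; y.1; y.2])) => [e|[y v]].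
    rewrite inE => /andP[/DE[eE we [v ve vS]]] /exists_inP[y yA ye]; split=> //.
    exists (y, v); first by rewrite in_setX /= yA.
    by rewrite !subUset !sub1set we ye ve.
  rewrite in_setX !inE /= => /andP[/and3P[yw yO yS] vS]; rewrite -q3.
  suff <- : #|[set w; y; v]| = 3%N by apply: codeg_real.
  rewrite -setUA cardsU1 !inE negb_or eq_sym yw cards2.
  have -> : y != v by apply: contraNneq yS => ->.
  by have -> : w != v by apply: contraNneq wSn => ->.
have h3 : #|W3|%:R <= (th * s) * q.
  apply: le_trans (_ : #|A3|%:R * q <= _); last by rewrite ler_wpM2r.
  apply: (@codeg_union _ E _ A3 (fun y => [set w; y])) => [e|y].
    rewrite inE => /andP[/DE[eE we _]] /exists_inP[y yA ye]; split=> //; exists y => //.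
    by rewrite subUset !sub1set we.
  rewrite inE -q2 => /andP[_ yS].
  suff <- : #|[set w; y]| = 2%N by apply: codeg_real.
  by rewrite cards2; have -> : w != y by apply: contraNneq wSn => ->.
have h4 : #|W4|%:R <= (3 * th * N ^+ 2 * s) * (q / n / n).
  apply: le_trans (_ : #|A4|%:R * (q / n / n) <= _); last first.
    rewrite ler_wpM2r ?divr_ge0 // ?(ltW n0) // cardsX natrM ler_wpM2r //.
    apply: le_trans card_weak_pairs; rewrite ler_nat subset_leq_card //.
    by apply/subsetP => q0; rewrite inE => /andP[].
  apply: (@codeg_union _ E _ A4 (fun y => [set w; y.1.1; y.1.2; y.2])) => [e|[[x y] v]].
    rewrite inE => /andP[/DE[eE we [v ve vS]]] /exists_inP[[x y] xyw /and4P[/= xw yw xe ye]].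
    split=> //; exists ((x, y), v); first by rewrite in_setX /= vS inE xyw /= xw yw.
    by rewrite !subUset !sub1set we xe ye ve.
  rewrite in_setX inE => /andP[/andP[]]; rewrite inE /=.
  move=> /and4P[xO yO /andP[xy _] _] /andP[xw yw] vS; rewrite -q4.
  suff <- : #|[set w; x; y; v]| = 4%N by apply: codeg_real.
  have OS u : u \in O1 -> u != v.
    by move=> /(subsetP O1O); rewrite inE => uS; apply: contraNneq uS => ->.
  rewrite -!setUA !cardsU1 cards1 !inE !negb_or xy (OS x xO) (OS y yO) ![w == _]eq_sym xw yw.
  by have -> : v != w by apply: contraNneq wSn => <-.
have : (#|D| <= #|W1| + (#|W2| + (#|W3| + #|W4|)))%N.
  apply: leq_trans (_ : #|W1 :|: (W2 :|: (W3 :|: W4))| <= _)%N; last first.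
    by do 3![apply: leq_trans (leq_card_setU _ _) _; rewrite leq_add2l].
  apply/subset_leq_card/subsetP => e eD; rewrite !in_setU.
  have /negP dirty : ~~ clean_at w e by move: eD; rewrite /D in_set => /andP[].
  apply: contraT; rewrite !negb_or => /and4P[].
  rewrite in_set eD => /exists_inPn n1; rewrite in_set eD => /exists_inPn n2.
  rewrite in_set eD => /exists_inPn n3; rewrite in_set eD => /exists_inPn n4.
  case: dirty; apply/clean_atP.
  have c1 y : y \in e -> y != w -> J w y.
    move=> ye yw; apply: contraT => Jwy; have := n1 y; rewrite ye inE yw Jwy; exact.
  split=> // [y ye yw|x y xe ye xw yw].
    have [yS|yS] := boolP (y \in S).
      apply/orP; right; apply: contraT => yS1; have := n3 y; rewrite ye !inE yS1 yS; exact.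
    apply/orP; left; apply: contraT => yO1; have := n2 y; rewrite ye !inE yO1 yS yw; exact.
  by apply/negP => /n4; rewrite /= xw yw xe ye.
rewrite -(ler_nat rat) !natrD.
have E1 : n * (c%:R * (q / n)) = c%:R * q by field; rewrite gt_eqF.
have E2 : th * N * s * (q / n) <= th * s * q.
  have -> : th * N * s * (q / n) = th * s * q * (N / n) by ring.
  rewrite ler_piMr ?mulr_ge0 //; by rewrite ler_pdivrMr // mul1r.
have E4 : 3 * th * N ^+ 2 * s * (q / n / n) <= 3 * (th * s * q).
  have -> : 3 * th * N ^+ 2 * s * (q / n / n) = 3 * (th * s * q) * (N / n) ^+ 2 by field; rewrite gt_eqF.
  rewrite ler_piMr ?mulr_ge0 // exprn_ile1 // ?divr_ge0 // ?(ltW n0) //.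
  by rewrite ler_pdivrMr // mul1r.
have E0 : c%:R * q <= th * s * q by rewrite ler_wpM2r.
lra.
Qed.

Lemma clean_starS z : z \in S ->
  (#|[set e in star z | clean_at z e]| <= #|cliques J (O1 :&: Nb z) rho.+1| +
     #|S1 :&: Nb z| * #|cliques J (O1 :&: Nb z) rho|)%N.
Proof.
move=> zS; rewrite -cardsX.
have zO : z \notin O1 by apply: contraL zS => /(subsetP O1O); rewrite inE.
pose F1 (f : {set V}) := z |: f.
pose F2 (vf : V * {set V}) := z |: (vf.1 |: vf.2).
apply: leq_trans (leq_add (leq_imset_card F1 _) (leq_imset_card F2 _)).
apply: leq_trans (leq_card_setU _ _).
apply/subset_leq_card/subsetP => e; rewrite !in_set => /andP[/and3P[eE ze _]] cl.
have [/exists_inP[v ve /andP[vS vz]]|/exists_inPn none] :=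
    boolP [exists v in e, (v \in S1) && (v != z)].
  have [eq_e fc vN] := clean_edge_S eE ze cl ve vS vz.
  apply/orP; right; apply/imsetP; exists (v, (e :\ z) :\ v) => //.
  by rewrite in_setX vN.
apply/orP; left; apply/imsetP; exists (e :\ z); last by rewrite /F1 setD1K.
have <- : #|e :\ z| = rho.+1.
  by have := card_edge unifE eE; rewrite (cardsD1 z) ze add1n => -[].
apply: (clean_clique eE cl); rewrite ?subsetDl ?inE ?eqxx //.
apply/subsetP => y; rewrite !inE => /andP[yz ye].
have /clean_atP[_ c2 _] := cl; have /orP[//|yS] := c2 y ye yz.
by have := none y ye; rewrite yS yz.
Qed.

Lemma dirty_starS z : z \in S -> c%:R <= th * N -> s <= N ->
  #|[set e in star z | ~~ clean_at z e]|%:R <= 6 * th * N * q.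
Proof.
move=> zS cN sN; set D := [set e in star z | _].
have DE e : e \in D -> e \in E /\ z \in e.
  by rewrite inE => /andP[]; rewrite inE => /and3P[].
pose A1 := [set y | (y != z) && ~~ J z y].
pose W1 := [set e in D | [exists y in A1, y \in e]].
pose A2 := ~: S :\: O1.
pose W2 := [set e in D | [exists y in A2, y \in e]].
pose A3 := (S :\: S1) :\ z.
pose W3 := [set e in D | [exists v in A3, v \in e]].
pose W4 := [set e in D | [exists q0 in weak_pairs, (q0.1 \in e) && (q0.2 \in e)]].
have n0 := n_gt0; have Q0 := q_ge0; have nN := N_le_n.
have neqz u : u \in ~: S -> z != u.
  by rewrite inE; apply: contraNneq => <-.
have h1 : #|W1|%:R <= n * (c%:R * (q / n)).
  apply: le_trans (_ : #|A1|%:R * (c%:R * (q / n)) <= _); last first.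
    rewrite ler_wpM2r ?ler_nat ?max_card // mulr_ge0 ?ler0n // divr_ge0 //; exact: ltW.
  apply: (@codeg_union _ E _ A1 (fun y => [set z; y])) => [e|y].
    rewrite inE => /andP[/DE[eE ze]] /exists_inP[y yA ye]; split=> //; exists y => //.
    by rewrite subUset !sub1set ze.
  by rewrite inE -q3 => /andP[yz Jzy]; apply: codeg_weak_real => //; rewrite eq_sym.
have h2 : #|W2|%:R <= (th * N) * q.
  apply: le_trans (_ : #|A2|%:R * q <= _); last by rewrite ler_wpM2r.
  apply: (@codeg_union _ E _ A2 (fun y => [set z; y])) => [e|y].
    rewrite inE => /andP[/DE[eE ze]] /exists_inP[y yA ye]; split=> //; exists y => //.
    by rewrite subUset !sub1set ze.
  rewrite in_setD -q2 => /andP[_ yO].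
  suff <- : #|[set z; y]| = 2%N by apply: codeg_real.
  by rewrite cards2 neqz.
have h3 : #|W3|%:R <= (th * s) * q.
  apply: le_trans (_ : #|A3|%:R * q <= _); last first.
    by rewrite ler_wpM2r // (le_trans _ S1_large) // ler_nat subset_leq_card // subsetDl.
  apply: (@codeg_union _ E _ A3 (fun y => [set z; y])) => [e|y].
    rewrite inE => /andP[/DE[eE ze]] /exists_inP[y yA ye]; split=> //; exists y => //.
    by rewrite subUset !sub1set ze.
  rewrite in_setD1 -q2 => /andP[yz _].
  suff <- : #|[set z; y]| = 2%N by apply: codeg_real.
  by rewrite cards2 eq_sym yz.
have h4 : #|W4|%:R <= (3 * th * N ^+ 2) * (q / n).
  apply: le_trans (_ : #|weak_pairs|%:R * (q / n) <= _); last first.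
    by rewrite ler_wpM2r ?card_weak_pairs // divr_ge0 // ltW.
  apply: (@codeg_union _ E _ weak_pairs (fun y => [set z; y.1; y.2])) => [e|[x y]].
    rewrite inE => /andP[/DE[eE ze]] /exists_inP[[x y] xyw /andP[/= xe ye]].
    split=> //; exists (x, y) => //.
    by rewrite !subUset !sub1set ze xe ye.
  rewrite inE /= => /and4P[/(subsetP O1O) xO /(subsetP O1O) yO /andP[xy _] _]; rewrite -q3.
  suff <- : #|[set z; x; y]| = 3%N by apply: codeg_real.
  by rewrite -!setUA !cardsU1 cards1 !inE !negb_or xy !neqz.
have : (#|D| <= #|W1| + (#|W2| + (#|W3| + #|W4|)))%N.
  apply: leq_trans (_ : #|W1 :|: (W2 :|: (W3 :|: W4))| <= _)%N; last first.
    by do 3![apply: leq_trans (leq_card_setU _ _) _; rewrite leq_add2l].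
  apply/subset_leq_card/subsetP => e eD; rewrite !in_setU.
  have /negP dirty : ~~ clean_at z e by move: eD; rewrite /D in_set => /andP[].
  apply: contraT; rewrite !negb_or => /and4P[].
  rewrite in_set eD => /exists_inPn n1; rewrite in_set eD => /exists_inPn n2.
  rewrite in_set eD => /exists_inPn n3; rewrite in_set eD => /exists_inPn n4.
  case: dirty; apply/clean_atP.
  have c1 y : y \in e -> y != z -> J z y.
    move=> ye yz; apply: contraT => Jzy; have := n1 y; rewrite ye inE yz Jzy; exact.
  split=> // [y ye yz|x y xe ye xz yz].
    have [yS|yS] := boolP (y \in S).
      apply/orP; right; apply: contraT => yS1; have := n3 y; rewrite ye !inE yS1 yS yz; exact.
    apply/orP; left; apply: contraT => yO1; have := n2 y; rewrite ye !inE yO1 yS; exact.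
  by apply/negP => /n4; rewrite /= xe ye.
rewrite -(ler_nat rat) !natrD.
have E1 : n * (c%:R * (q / n)) = c%:R * q by field; rewrite gt_eqF.
have E3 : th * s * q <= th * N * q by rewrite ler_wpM2r // ler_wpM2l.
have E4 : 3 * th * N ^+ 2 * (q / n) <= 3 * (th * N * q).
  have -> : 3 * th * N ^+ 2 * (q / n) = 3 * (th * N * q) * (N / n) by field; rewrite gt_eqF.
  by rewrite ler_piMr ?mulr_ge0 // ler_pdivrMr // mul1r.
have E0 : c%:R * q <= th * N * q by rewrite ler_wpM2r.
lra.
Qed.

Variable e4 : rat.
(** The price of replacing [n^rho] by [N^rho], as [n <= 2 N]. *)
Let B : rat := 2 ^+ rho.
Let d : rat := tdeg p rho.
Hypothesis e4_ge0 : 0 <= e4.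

Let B_ge1 : 1 <= B. Proof. by rewrite /B -natrX ler1n expn_gt0. Qed.

Let q_le : q <= B * N ^+ rho.
Proof.
rewrite /q /B -exprMn; apply: lerXn2r; rewrite ?nnegrE ?mulr_ge0 //; exact: ltW.
Qed.

Let star_split w : #|star w|%:R =
  #|[set e in star w | clean_at w e]|%:R + #|[set e in star w | ~~ clean_at w e]|%:R :> rat.
Proof.
rewrite -natrD; congr _%:R; rewrite -(cardsID [set e | clean_at w e]); congr (_ + _)%N.
  by apply: eq_card => e; rewrite !inE.
by apply: eq_card => e; rewrite !inE andbC.
Qed.

(** The degree is at most about [a * K], where [a = #|S1 :&: Nb w|] and [K] counts the [rho]-cliques
    of [O1 :&: Nb w]. As [a <= s] and [K] is at most about [d N^rho], both factors are almost
    maximal, and each gives one of the two conditions for typicality. *)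
Lemma typicalO_of_degree w : w \in ~: S -> c%:R <= th * s ->
  e4 + 6 * B * th + B * p.+1%:R * th <= th2 * d ->
  s * ((d - e4) * N ^+ rho) <= #|star w|%:R -> w \in typicalO.
Proof.
move=> wO cs K1 Hdeg.
have d0 : 0 < d by apply: tdeg_gt0.
have d1 : d <= 1 := le_trans (tdeg_le_tdens rho1 rhop) (tdens_le1 rho1 rhop).
have s0 := s_gt0; have N0 := N_gt0; have t2 := th2_gt0; have P2 := P_gt1.
have t0 := th_ge0; have e0 := e4_ge0; have B1 := B_ge1.
set P := p.+1%:R in K1 P2; set M := N ^+ rho in Hdeg.
have M0 : 0 < M by apply: exprn_gt0.
have th21 : th2 < 1.
  have := th2_le; have := P2; have p4 : 1 <= p.+4%:R :> rat by rewrite ler1n.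
  rewrite -/P => h1 h2; apply: le_lt_trans h2; rewrite ler_peMr ?(ltW t2) //.
  by apply: le_trans (_ : 1 * 1 <= _); [rewrite mulr1|apply: ler_pM => //; lra].
set a : rat := #|S1 :&: Nb w|%:R; set x : rat := #|O1 :&: Nb w|%:R.
set K : rat := #|cliques J (O1 :&: Nb w) rho|%:R.
have as_ : a <= s by rewrite ler_nat subset_leq_card // (subset_trans (subsetIl _ _) S1S).
have a0 : 0 <= a by apply: ler0n.
have xN : x <= N by rewrite ler_nat subset_leq_card // (subset_trans (subsetIl _ _) O1O).
have x0 : 0 <= x by apply: ler0n.
have KM : K <= M.
  by apply: le_trans (card_cliques_le _ _ _) _; rewrite lerXn2r ?nnegrE.
have Bth : 0 <= 6 * B * th by rewrite !mulr_ge0 // (le_trans ler01).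
have BPth : P * th <= B * P * th.
  by rewrite -mulrA ler_peMl // mulr_ge0 // (le_trans _ P2).
have main : s * ((d - e4 - 6 * B * th) * M) <= a * K.
  have h1 : #|[set e in star w | clean_at w e]|%:R <= a * K.
    by rewrite -natrM ler_nat; apply: clean_starO.
  have h2 := dirty_starO wO cs.
  have h3 : 6 * th * s * q <= s * (6 * B * th * M).
    have -> : s * (6 * B * th * M) = 6 * th * s * (B * M) by ring.
    by apply: ler_wpM2l => //; rewrite !mulr_ge0.
  move: Hdeg; rewrite star_split; lra.
have thd : th2 * d < d by rewrite gtr_pMl.
have Pth1 : 0 <= P * th <= 1.
  by apply/andP; split; [rewrite mulr_ge0 // (le_trans _ P2)|lra].
(* The crude bound [K <= M] already forces [a] above [P th s], enough for any [p.+1] vertices of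
   [O1] to have a common neighbour in [S1 :&: Nb w]. *)
have a_large : P * (th * s) < a.
  have : s * (d - e4 - 6 * B * th) <= a.
    rewrite -(ler_pM2r M0) -[X in X <= _]mulrA; apply: le_trans main _.
    by rewrite ler_wpM2l.
  apply: lt_le_trans; have -> : P * (th * s) = s * (P * th) by ring.
  by rewrite ltr_pM2l //; lra.
have oN : omega_le J (O1 :&: Nb w) p.
  apply: omega_leP => Y; rewrite subsetI => /andP[YO YN] cY; apply/eqP => Yp.
  have [v vS vY] : exists2 v, v \in S1 :&: Nb w & Y \subset Nb v.
    apply/exists_inP; rewrite -[X in is_true X]negbK; apply/exists_inPn => none.
    move: a_large; apply/negP; rewrite -leNgt.
    apply: le_trans (_ : (\sum_(y in Y) #|S1 :\: Nb y|)%:R <= _).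
      rewrite ler_nat; apply: union_bound => v vS; have /subsetPn[y yY yv] := none v vS.
      exists y => //; move: vS; rewrite in_setI in_setD => /andP[-> _]; rewrite andbT.
      by move: yv; rewrite /Nb !in_set J_sym.
    rewrite natr_sum /P -Yp mulr_natl -sumr_const; apply: ler_sum => y yY.
    exact/O1_nbrS/(subsetP YO).
  have cwY : clique J (w |: Y) by apply: cliqueU1.
  have vN : w |: Y \subset Nb v.
    rewrite subUset sub1set vY andbT; move: vS; rewrite in_setI /Nb !inE J_sym.
    by case/andP.
  have := J_omega (subsetT _) (cliqueU1 J_sym vN cwY).
  by rewrite cardsU1 (nbr_notin J_irr vN) cardsU1 (nbr_notin J_irr YN) Yp !add1n ltnn.
have pp0 : 0 < p%:R :> rat by rewrite ltr0n (leq_trans rho1).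
have K_le : K <= 'C(p, rho)%:R * (x / p%:R) ^+ rho by apply: cliques_real_bound.
have xgr := greedy_clique (subsetIl _ _) oN; rewrite -/x in xgr.
have K_le2 : K <= d * M * (1 + B * (P * th)).
  apply: le_trans K_le _.
  apply: le_trans (_ : 'C(p, rho)%:R * ((iP + th) * N) ^+ rho <= _).
    rewrite ler_wpM2l ?ler0n // lerXn2r ?nnegrE ?divr_ge0 ?ler0n //.
      by rewrite mulr_ge0 // addr_ge0 // ltW.
    by rewrite ler_pdivrMr // mulrC.
  have -> : (iP + th) * N = iP * (N * (1 + P * th)).
    have iPE : P * iP = 1 := iPP.
    transitivity (iP * N + (P * iP) * (th * N)); last by ring.
    by rewrite iPE; ring.
  rewrite !exprMn /d /tdeg -/iP -/M -!mulrA ler_wpM2l ?ler0n // ler_wpM2l ?exprn_ge0 ?(ltW iP_gt0) //.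
  rewrite ler_wpM2l ?(ltW M0) //; exact: add1_exp_le.
have BPth0 : 0 <= B * (P * th).
  by apply: mulr_ge0; [apply: le_trans B1|case/andP: Pth1].
rewrite inE wO /=; apply/andP; split; last first.
  have h : s * (d - e4 - 6 * B * th) <= a * (d * (1 + B * (P * th))).
    rewrite -(ler_pM2r M0) -[X in X <= _]mulrA; apply: le_trans main _.
    by rewrite -[X in _ <= X]mulrA ler_wpM2l // mulrAC.
  have h2 : a * d * (B * (P * th)) <= s * (B * P * th).
    rewrite [X in _ <= X](_ : _ = s * (B * (P * th))); last by ring.
    rewrite ler_wpM2r //.
    by apply: le_trans (_ : a * 1 <= _); [rewrite ler_wpM2l|rewrite mulr1].
  have h3 : s * (e4 + 6 * B * th + B * P * th) <= s * (th2 * d) by rewrite ler_pM2l.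
  have h4 : d * (s * (1 - th2)) <= d * a by lra.
  have h5 : s * (1 - th2) <= a by rewrite ler_pM2l in h4.
  rewrite cardsD natrB ?subset_leq_card ?subsetIl // -/a.
  have : #|S1|%:R <= s by rewrite ler_nat subset_leq_card.
  lra.
(* [y] is the size of the neighbourhood relative to the share [p/P] of [N]. If [y <= 1], then
   [y^rho <= y] turns the bound on the power into one on [y]. *)
pose y := x * P / (p%:R * N).
have P0 : 0 < P by lra.
have y0 : 0 <= y by rewrite divr_ge0 ?mulr_ge0 // ltW.
have h : s * ((d - e4 - 6 * B * th) * M) <= s * (d * y ^+ rho * M).
  apply: le_trans main _; apply: ler_pM => //.
  apply: le_trans K_le _; rewrite /d /tdeg -!mulrA ler_wpM2l ?ler0n //.
  rewrite /M -!exprMn le_eqVlt; apply/orP; left; apply/eqP; congr (_ ^+ _).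
  have E5 (u1 u2 u3 u4 : rat) : u2 != 0 -> u3 != 0 -> u4 != 0 ->
    u1 / u2 = u3^-1 * (u1 * u3 / (u2 * u4) * u4).
    by move=> *; field; apply/and3P.
  by rewrite /y -E5 ?gt_eqF.
rewrite ler_pM2l // ler_pM2r // in h.
have h2 : d * (1 - th2) <= d * y ^+ rho.
  apply: le_trans h; rewrite mulrA in BPth0.
  lra.
rewrite ler_pM2l // in h2.
have hy : 1 - th2 <= y.
  have [y1|/ltW y1] := leP y 1; last by apply: le_trans y1; lra.
  apply: le_trans h2 _; rewrite -[X in _ <= X]expr1; exact: ler_wiXn2l.
have hx : (p%:R * N) * (1 - th2) <= x * P.
  have -> : x * P = (p%:R * N) * y by rewrite /y [RHS]mulrC divfK // gt_eqF // mulr_gt0.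
  by rewrite ler_pM2l // mulr_gt0.
rewrite cardsD natrB ?subset_leq_card ?subsetIl // -/x.
have O1N : #|O1|%:R <= N by rewrite ler_nat subset_leq_card.
have PE : P = p%:R + 1 by rewrite /P -natr1.
have iPE : P * iP = 1 := iPP.
have hx2 : iP * ((p%:R * N) * (1 - th2)) <= x.
  have -> : x = iP * (x * P) by rewrite mulrCA [iP * P]mulrC iPE mulr1.
  by rewrite ler_wpM2l // ltW.
have piP : iP * p%:R = 1 - iP by have : p%:R = P - 1 by [lra]; move=> ->; lra.
move: hx2; rewrite !mulrA piP => hx2.
have : 0 <= iP * N * th2 by rewrite !mulr_ge0 // ltW.
lra.
Qed.

Let P : rat := p.+1%:R.
Let tau : rat := tdens p rho.
Let T : rat := tdens p.+1 rho.+1.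

(** If [z] has no strong neighbour in [S1], its clean edges come from cliques of [A], and their
    number forces [A] to be almost all of [O1]. A strong neighbour in [S1] sees almost all of [O1],
    which makes [A] essentially K_{p+1}-free, and the degree falls short. *)
Lemma typicalS_of_degree z : z \in S -> c%:R <= th * N ->
  7 * rho.+1%:R * P ^+ 3 * s <= N ->
  e4 * d + 6 * B * rho.+1%:R * th <= th2 * d ->
  (8 * B * th + e4) * (4 * P ^+ 2) <= d ->
  (1 - e4) * T * N ^+ rho.+1 <= #|star z|%:R -> z \in typicalS.
Proof.
move=> zS cN sN K2 K3 Hdeg.
have s0 := s_gt0; have N0 := N_gt0; have t2 := th2_gt0; have P2 : 2 <= P := P_gt1.
have t0 := th_ge0; have e0 := e4_ge0; have B1 := B_ge1.
have d0 : 0 < d by apply: tdeg_gt0.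
have dtau : d <= tau := tdeg_le_tdens rho1 rhop.
have tau1 : tau <= 1 := tdens_le1 rho1 rhop.
set r : rat := rho.+1%:R in sN K2.
have r2 : 2 <= r by rewrite ler_nat.
have rT : r * T = d := tdensE p rho.
set M := N ^+ rho.
have M0 : 0 < M by apply: exprn_gt0.
have NM : N ^+ rho.+1 = N * M by rewrite exprS.
rewrite NM in Hdeg.
have sN1 : s <= N.
  apply: le_trans sN; rewrite ler_peMl // mulr_ege1 ?exprn_ege1 //; lra.
set A := O1 :&: Nb z; set x : rat := #|A|%:R.
have AN : x <= N by rewrite ler_nat subset_leq_card // (subset_trans (subsetIl _ _) O1O).
have x0 : 0 <= x by apply: ler0n.
have O1N : #|O1|%:R <= N by rewrite ler_nat subset_leq_card.
have main : (1 - e4) * T * (N * M) <= #|cliques J A rho.+1|%:R +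
    #|S1 :&: Nb z|%:R * #|cliques J A rho|%:R + 6 * B * th * (N * M).
  have h1 : #|[set e in star z | clean_at z e]|%:R <= #|cliques J A rho.+1|%:R +
    #|S1 :&: Nb z|%:R * #|cliques J A rho|%:R :> rat.
    by rewrite -natrM -natrD ler_nat; apply: clean_starS.
  have h2 := dirty_starS zS cN sN1.
  have h3 : 6 * th * N * q <= 6 * B * th * (N * M).
    have -> : 6 * B * th * (N * M) = 6 * th * N * (B * M) by ring.
    by apply: ler_wpM2l => //; rewrite !mulr_ge0 // ltW.
  move: Hdeg; rewrite star_split; lra.
have NM0 : 0 < N * M by apply: mulr_gt0.
have [SN|[v vSN]] := set_0Vmem (S1 :&: Nb z).
  have oA : omega_le J A p.+1.
    by apply: omega_leS (omega_le_nbr J_sym J_irr (in_setT z) (J_omega (A := [set: V]))); rewrite setTI subsetIr.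
  (* Only one factor keeps the size [x] of [A]; estimating the others by [N] gives a bound linear in
     [x]. *)
  have hA : #|cliques J A rho.+1|%:R <= T * M * x.
    apply: le_trans (cliques_real_bound J_sym J_irr rho.+1 oA) _.
    rewrite -/x /T /tdens exprMn -!mulrA ler_wpM2l ?ler0n //.
    rewrite mulrC ler_wpM2l ?exprn_ge0 ?(ltW iP_gt0) // exprS mulrC ler_wpM2r //.
    by rewrite lerXn2r ?nnegrE.
  move: main; rewrite SN cards0 mul0r addr0 => main.
  have h : ((1 - e4) * T * N - 6 * B * th * N) * M <= T * x * M.
    have -> : T * x * M = T * M * x by ring.
    by apply: le_trans hA; lra.
  rewrite ler_pM2r // in h.
  have h2 : r * ((1 - e4) * T * N - 6 * B * th * N) <= r * (T * x) by rewrite ler_pM2l //; lra.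
  have h3 : d * ((1 - e4) * N) - 6 * B * r * th * N <= d * x.
    by rewrite -!rT; lra.
  have h4 : (e4 * d + 6 * B * r * th) * N <= th2 * d * N by rewrite ler_pM2r.
  have h5 : d * ((1 - th2) * N) <= d * x by lra.
  rewrite ler_pM2l // in h5.
  rewrite inE zS /= cardsD natrB ?subset_leq_card ?subsetIl // -/A -/x; lra.
exfalso.
have vS : v \in S1 by move: vSN; rewrite inE => /andP[].
have vz : v \in Nb z by move: vSN; rewrite inE => /andP[].
have oAv : omega_le J (A :&: Nb v) p.
  apply: omega_leS (omega_le_nbr J_sym J_irr (A := setT :&: Nb z) (x := v) _ _).
  - by rewrite setTI setSI // subsetIr.
  - by rewrite setTI.
  - exact: omega_le_nbr (in_setT z) (J_omega (A := [set: V])).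
have AD : #|A :\: Nb v|%:R <= th * N.
  by apply: le_trans (S1_nbr vS); rewrite ler_nat subset_leq_card // setSD // subsetIl.
have AvN : #|A :&: Nb v|%:R <= N.
  by apply: le_trans AN; rewrite ler_nat subset_leq_card // subsetIl.
have bnd j : #|cliques J (A :&: Nb v) j|%:R <= tdens p j * N ^+ j.
  exact: cliques_tdens_bound.
set T2 := tdens p rho.+1.
have k1 : #|cliques J A rho.+1|%:R <= T2 * (N * M) + th * (N * M).
  apply: le_trans (cliques_le_inter J_sym J_irr _ (Nb v) _) _; apply: lerD.
    by rewrite -NM; apply: bnd.
  rewrite mulrA; apply: ler_pM => //; first by rewrite exprn_ge0.
  by rewrite lerXn2r ?nnegrE.
have k2 : #|cliques J A rho|%:R <= tau * M + th * M.
  rewrite /tau /M; case: (rho) rho1 bnd => // rho' _ bnd'.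
  apply: le_trans (cliques_le_inter J_sym J_irr _ (Nb v) _) _; apply: lerD; first exact: bnd'.
  rewrite exprS mulrA; apply: ler_pM => //; first by rewrite exprn_ge0.
  by rewrite lerXn2r ?nnegrE.
have gap : tau / (2 * p%:R * P) <= T - T2 := tdens_gap rho1 rhop.
have half : T <= tau / 2 := tdens_le_half rho1 rhop.
have pP : p%:R = P - 1 by rewrite /P -natr1 addrK.
have tau0 : 0 < tau by lra.
have gap2 : tau <= (T - T2) * (2 * P ^+ 2).
  have pp0 : 0 < p%:R :> rat by rewrite pP; lra.
  have c0 : 0 < 2 * p%:R * P by rewrite !mulr_gt0 //; lra.
  have g0 : 0 <= T - T2 by apply: le_trans gap; rewrite divr_ge0 // ltW.
  rewrite ler_pdivrMr // in gap; apply: le_trans gap _.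
  by rewrite ler_wpM2l // pP expr2; lra.
have aS : #|S1 :&: Nb z|%:R <= s by rewrite ler_nat subset_leq_card // (subset_trans (subsetIl _ _) S1S).
apply: (dense_star_absurd N0 M0 t0 e0 B1 r2 P2 d0 dtau tau1 half gap2 sN K3 _ _ k1 main).
  by rewrite ler0n.
by rewrite ler0n.
Qed.

Lemma core_bound : c%:R <= th * s -> c%:R <= th * N ->
  7 * rho.+1%:R * P ^+ 3 * s <= N -> P <= th * N ->
  e4 + 6 * B * th + B * p.+1%:R * th <= th2 * d ->
  e4 * d + 6 * B * rho.+1%:R * th <= th2 * d ->
  (8 * B * th + e4) * (4 * P ^+ 2) <= d -> 2 * rho.+1%:R * th <= e4 -> 2 * th <= 1 ->
  (#|[set e in E | e :&: S != set0]| <= #|S| * turan_number rho.+1 #|~: S| p.+1)%N.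
Proof.
move=> cs cN sN PN K1 K2 K3 K4 t1.
set ES := [set e in E | _].
pose X := ~: S :\: typicalO; pose Y := S :\: typicalS.
pose E2 := [set e in ES | e \subset typicalO :|: typicalS].
have O2S : typicalO \subset ~: S by apply/subsetP => w; rewrite inE => /andP[].
have S2S : typicalS \subset S by apply/subsetP => w; rewrite inE => /andP[].
have ESE : (#|ES| <= #|E2| + (\sum_(w in X) #|star w| + \sum_(z in Y) #|star z|))%N.
  rewrite -(cardsID [set e : {set V} | e \subset typicalO :|: typicalS] ES) leq_add //.
    by apply/subset_leq_card/subsetP => e; rewrite !inE.
  apply: leq_trans (_ : \sum_(u in X :|: Y) #|star u| <= _)%N; last first.
    rewrite (eq_bigl (mem [predU X & Y])); last by move=> u; rewrite !inE.
    rewrite bigU // disjoints_subset; apply/subsetP => w.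
    by rewrite !inE => /andP[_ /negbTE->]; rewrite andbF.
  apply: union_bound => e; rewrite in_setD !in_set => /andP[/subsetPn[u ue uT] /andP[eE eS]].
  exists u; last by rewrite inE eE ue.
  move: uT; rewrite in_setU negb_or => /andP[uO uS].
  by rewrite /X /Y in_setU !in_setD uO uS /= in_setC; case: (u \in S).
(* An edge of typical vertices has exactly one vertex in [S]; the others are pairwise covered, so
   Turán's theorem for the covered graph applies without an error term. *)
have E2le : (#|E2| <= #|typicalS| * turan_number rho.+1 #|typicalO| p.+1)%N.
  apply: leq_trans (_ : #|typicalS| * #|cliques (covered E) typicalO rho.+1| <= _)%N; last first.
    rewrite leq_mul2l; apply/orP; right; apply: cliques_turan_bound => //.
    - exact: covered_sym.
    - exact: covered_irr.
    - exact: covered_typical_omega.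
  rewrite -cardsX; apply: leq_trans (leq_imset_card (fun q0 : V * {set V} => q0.1 |: q0.2) _).
  apply/subset_leq_card/subsetP => e; rewrite !in_set => /andP[/andP[eE /set0Pn[z /setIP[ze zS]]] eT].
  have zT : z \in typicalS.
    by have /setUP[/(subsetP O2S)|//] := subsetP eT _ ze; rewrite inE zS.
  apply/imsetP; exists (z, e :\ z); last by rewrite /= setD1K.
  rewrite in_setX zT /= inE; apply/and3P; split.
  - apply/subsetP => y; rewrite !in_setD1 => /andP[yz ye].
    have /setUP[//|yT] := subsetP eT _ ye.
    by have := covered_typicalS yT zT yz eE ye; rewrite ze.
  - by have := card_edge unifE eE; rewrite (cardsD1 z) ze add1n => -[->].
  apply/cliqueP => x y; rewrite !in_setD1 => /andP[_ xe] /andP[_ ye] xy.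
  by rewrite /covered /= xy; apply/exists_inP; exists e; rewrite // xe.
have s0 := s_gt0; have N0 := N_gt0; have t0 := th_ge0; have e0 := e4_ge0.
have Xle : (\sum_(w in X) #|star w|)%:R <= #|X|%:R * (s * ((d - e4) * N ^+ rho)).
  rewrite natr_sum mulr_natl -sumr_const; apply: ler_sum => w /setDP[wO wT].
  by rewrite leNgt; apply/negP => /ltW h; move: wT; rewrite typicalO_of_degree.
have Yle : (\sum_(z in Y) #|star z|)%:R <= #|Y|%:R * ((1 - e4) * T * N ^+ rho.+1).
  rewrite natr_sum mulr_natl -sumr_const; apply: ler_sum => z /setDP[zS zT].
  by rewrite leNgt; apply/negP => /ltW h; move: zT; rewrite typicalS_of_degree.
have XN : #|X|%:R <= th * N.
  by apply: le_trans O1_large; rewrite ler_nat subset_leq_card // setDS // subset_O1_typical.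
have ecard (A D : {set V}) : A \subset D -> (#|D| = #|A| + #|D :\: A|)%N.
  by move=> AD; rewrite -(cardsID A D) (setIidPr AD).
have NE := ecard _ _ O2S; have SE := ecard _ _ S2S; rewrite -/X in NE; rewrite -/Y in SE.
set x := #|X| in Xle XN NE; set y := #|Y| in Yle SE.
set N2 := #|typicalO| in E2le NE; set s2 := #|typicalS| in E2le SE.
set t2 := turan_number rho.+1 N2 p.+1 in E2le; set tN := turan_number _ _ _.
(* Returning the [x] atypical vertices to the Turán graph gains nearly a full degree [d N^rho] for
   each, whereas by [Xle] such a vertex has on average at most [(d - e4) N^rho] edges per vertex of
   [S]. *)
have step : (t2 + x * ('C(p, rho) * (N2 %/ p.+1) ^ rho) <= tN)%N.
  by rewrite /tN NE; exact: turan_number_steps_ge.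
have r1 : 2 <= rho.+1%:R :> rat by rewrite ler_nat.
have st1 : d * N ^+ rho * (1 - rho%:R * (2 * th)) <= ('C(p, rho) * (N2 %/ p.+1) ^ rho)%:R.
  rewrite natrM /d /tdeg -!mulrA ler_wpM2l ?ler0n // mulrA -exprMn.
  apply: turan_term_real => //; first by rewrite mulr_ge0.
  have : N = N2%:R + x%:R by rewrite -natrD -NE.
  by rewrite -/P; lra.
have st2 : T * N ^+ rho.+1 * (1 - rho.+1%:R * th) <= tN%:R.
  apply: turan_number_real => //; first by rewrite t0 /=; lra.
  by rewrite -/P; lra.
have rT : rho.+1%:R * T = d := tdensE p rho.
have d0 : 0 < d by apply: tdeg_gt0.
have T0 : 0 <= T by apply: tdens_ge0.
have ES2 : #|ES|%:R <= s2%:R * t2%:R + (x%:R * (s * ((d - e4) * N ^+ rho)) +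
     y%:R * ((1 - e4) * T * N ^+ rho.+1)).
  apply: le_trans (_ : (s2 * t2 + (\sum_(w in X) #|star w| + \sum_(z in Y) #|star z|))%:R <= _).
    by rewrite ler_nat (leq_trans ESE) // leq_add2r.
  by rewrite !natrD natrM lerD2l lerD.
rewrite -(ler_nat rat) natrM; apply: le_trans ES2 _.
have sE : s = s2%:R + y%:R by rewrite -natrD -SE.
have M0 : 0 < N ^+ rho by apply: exprn_gt0.
move: step st1 st2; rewrite -(ler_nat rat) natrD natrM exprS.
rewrite -/s sE.
have rr : rho%:R = rho.+1%:R - 1 :> rat by rewrite -natr1 addrK.
rewrite rr => h1 h2 h3.
have d1 : d <= 1 := le_trans (tdeg_le_tdens rho1 rhop) (tdens_le1 rho1 rhop).
by apply: (core_sum (ltW N0) M0 t0 e0 d0 T0 XN r1 rT d1 K4 _ _ _ h1 h2 h3); rewrite ler0n.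
Qed.

End Core.

Local Open Scope ring_scope.

(** * Existence of cores *)

Section CoreExists.
Variables (V : finType) (E : {set {set V}}) (rho p c : nat).
Hypotheses (rho1 : (1 <= rho)%N) (rhop : (rho <= p)%N).
Hypothesis unifE : uniform rho.+2 (Hypergraph E).
Hypothesis large_c : (p.+3 + rho.+2 + 'C(p.+3, 2) * rho.+2 <= c)%N.
Hypothesis freeE : ~~ contains (Hypergraph E) (expanded_clique rho.+2 p.+3).
Variable S : {set V}.
Let J := strong E c.
Let Nb := nbr J.

Let J_sym : symmetric J. Proof. exact: strong_sym. Qed.
Let J_irr : irreflexive J. Proof. exact: strong_irr. Qed.

Let J_omega (A : {set V}) : omega_le J A p.+2.
Proof. exact: (@strong_omega V E rho.+2 c unifE p.+1). Qed.

Let Nb_omega v A : omega_le J (A :&: Nb v) p.+1.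
Proof.
by apply: omega_leS (omega_le_nbr J_sym J_irr (in_setT v) (@J_omega setT)); rewrite setTI subsetIr.
Qed.

Let Nb2_omega u v A : J u v -> omega_le J (A :&: Nb u :&: Nb v) p.
Proof.
move=> uv; apply: omega_leS (omega_le_nbr J_sym J_irr (A := setT :&: Nb u) (x := v) _ _).
- by rewrite setTI setSI // subsetIr.
- by rewrite setTI /Nb inE.
- exact: Nb_omega.
Qed.

Let s : rat := #|S|%:R.
Let N : rat := #|~: S|%:R.
Let n : rat := #|V|%:R.
Let P : rat := p.+1%:R.
Let r : rat := rho.+1%:R.
Let tau : rat := tdens p rho.
Let d : rat := tdeg p rho.
Let T : rat := tdens p.+1 rho.+1.
Let T2 : rat := tdens p rho.+1.
Let M : rat := N ^+ rho.

Hypothesis N_gt0 : 0 < N.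

Let s_ge0 : 0 <= s. Proof. exact: ler0n. Qed.
Let P_gt1 : 2 <= P. Proof. by rewrite ler_nat ltnS (leq_trans rho1). Qed.
Let r_ge2 : 2 <= r. Proof. by rewrite ler_nat. Qed.
Let M_gt0 : 0 < M. Proof. exact: exprn_gt0. Qed.
Let NM : N ^+ rho.+1 = N * M. Proof. by rewrite exprS. Qed.
Let d_gt0 : 0 < d. Proof. exact: tdeg_gt0. Qed.
Let d_tau : d <= tau. Proof. exact: tdeg_le_tdens. Qed.
Let tau_Pd : tau <= P * d. Proof. exact: tdens_le_tdeg. Qed.
Let rT : r * T = d. Proof. exact: tdensE. Qed.
Let T_gt0 : 0 < T.
Proof. by rewrite -(pmulr_rgt0 _ (_ : 0 < r)) ?rT ?ltr0n. Qed.
Let V_eq : n = s + N.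
Proof. by rewrite /n -cardsT -(setUCr S) cardsU setICr cards0 subn0 natrD. Qed.
Let n_gt0 : 0 < n. Proof. by have := s_ge0; have := N_gt0; rewrite V_eq; lra. Qed.

Definition link_cliques (v : V) : nat := #|cliques J (~: S :&: Nb v) rho.+1|.

Let card_link v : #|~: S :&: Nb v|%:R <= N.
Proof. by rewrite ler_nat subset_leq_card // subsetIl. Qed.

(** All factors but one are estimated by [N], so the bound is linear in the size of the
    neighbourhood and an almost maximal count forces an almost full neighbourhood. *)
Lemma link_cliques_le v : (link_cliques v)%:R <= T * M * #|~: S :&: Nb v|%:R.
Proof.
apply: le_trans (cliques_tdens_bound J_sym J_irr rho.+1 (@Nb_omega v _) (lexx _)) _.
rewrite -/T exprS -mulrA ler_wpM2l ?(ltW T_gt0) // mulrC ler_wpM2r ?ler0n //.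
by rewrite lerXn2r ?nnegrE ?ler0n // ltW.
Qed.

Lemma link_cliques_full v x : 0 <= x -> (1 - x) * (T * (N * M)) <= (link_cliques v)%:R ->
  #|~: S :\: Nb v|%:R <= x * N.
Proof.
move=> x0 h; have := le_trans h (link_cliques_le v).
have -> : (1 - x) * (T * (N * M)) = T * M * ((1 - x) * N) by ring.
have TM : 0 < T * M by apply: mulr_gt0; [apply: T_gt0|apply: M_gt0].
rewrite ler_pM2l // cardsD natrB ?subset_leq_card ?subsetIl // -/N; lra.
Qed.

(** Small enough for the loss caused by strong adjacency inside [S], yet large enough that under
    [s_small] the edges with two vertices in [S] add at most [e0/2] of a full link to each vertex
    that is not rich. *)
Let e0 : rat := 2 / (7 * P ^+ 2).

Definition rich : {set V} := [set v in S | (1 - e0) * (T * (N * M)) <= (link_cliques v)%:R].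

Let e0_gt0 : 0 < e0.
Proof. by have := P_gt1 => ?; rewrite divr_gt0 ?mulr_gt0 ?exprn_gt0 //; lra. Qed.

(* Adjacent vertices of [S] share a [K_P]-free neighbourhood, which costs each of them
   a definite proportion of its link. *)
Lemma rich_independent u v : u \in rich -> v \in rich -> ~~ J u v.
Proof.
rewrite !inE => /andP[_ ur] /andP[_ vr]; apply/negP => uv.
have vfull := link_cliques_full (ltW e0_gt0) vr.
have N0 := N_gt0; have M0 := M_gt0; have P2 := P_gt1; have T0 := T_gt0; have e00 := e0_gt0.
set A := ~: S :&: Nb u.
have AN : #|A|%:R <= N by apply: card_link.
have AD : #|A :\: Nb v|%:R <= e0 * N.
  by apply: le_trans vfull; rewrite ler_nat subset_leq_card // setSD // subsetIl.
have kA : (link_cliques u)%:R <= T2 * (N * M) + e0 * N * (tau * M).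
  have := cliques_split J_sym J_irr A (Nb v) rho; rewrite -(ler_nat rat) natrD natr_sum => h.
  apply: le_trans h _; apply: lerD.
    rewrite -NM; apply: cliques_tdens_bound => //; first exact: Nb2_omega.
    by apply: le_trans AN; rewrite ler_nat subset_leq_card // subsetIl.
  apply: le_trans (_ : #|A :\: Nb v|%:R * (tau * M) <= _); last first.
    by rewrite ler_wpM2r // mulr_ge0 ?tdens_ge0 // ltW.
  rewrite mulr_natl -sumr_const; apply: ler_sum => w; rewrite !inE => /andP[_ /andP[_ uw]].
  apply: cliques_tdens_bound => //; first exact: Nb2_omega.
  by apply: le_trans AN; rewrite ler_nat subset_leq_card // subsetIl.
have NM0 : 0 < N * M by apply: mulr_gt0.
have h : (1 - e0) * T <= T2 + e0 * tau.
  rewrite -(ler_pM2r NM0) -[X in X <= _]mulrA; apply: le_trans (le_trans ur kA) _.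
  by rewrite (_ : T2 * (N * M) + _ = (T2 + e0 * tau) * (N * M)) //; ring.
have gap : tau / (2 * p%:R * P) <= T - T2 := tdens_gap rho1 rhop.
have half : T <= tau / 2 := tdens_le_half rho1 rhop.
have tau0 : 0 < tau by apply: lt_le_trans d_tau; apply: d_gt0.
have pP : p%:R = P - 1 by rewrite /P -natr1 addrK.
have c0 : 0 < 2 * p%:R * P.
  by rewrite !mulr_gt0 // ?ltr0n ?(leq_trans rho1) // (lt_le_trans _ P2).
rewrite ler_pdivrMr // pP in gap.
apply: (rich_gap_absurd e00 P2 tau0 _ half gap h).
by rewrite divfK // mulf_neq0 // expf_neq0 // gt_eqF // (lt_le_trans _ P2).
Qed.

Definition touching : {set {set V}} := [set e in E | e :&: S != set0].

Lemma bad_edges_le :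
  #|[set e in touching | ~~ clique J e]|%:R <= c%:R * n ^+ rho.+1.
Proof.
have n0 := n_gt0.
pose A := [set q : V * V | (q.1 != q.2) && ~~ J q.1 q.2].
have h : #|[set e in touching | ~~ clique J e]|%:R <=
    #|A|%:R * (c%:R * (n ^+ rho.+2 / n ^+ 3)).
  apply: (@codeg_union _ E _ A (fun q => [set q.1; q.2])) => [e|[x y]]; last first.
    by rewrite inE /= => /andP[xy Jxy]; apply: codeg_weak_real.
  rewrite !in_set => /andP[/andP[eE _]] /forall_inPn[x xe /forall_inPn[y ye]].
  rewrite negb_imply => /andP[xy Jxy]; split=> //; exists (x, y); first by rewrite inE xy.
  by rewrite subUset !sub1set xe ye.
apply: le_trans h _; apply: le_trans (_ : n ^+ 2 * (c%:R * (n ^+ rho.+2 / n ^+ 3)) <= _).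
  apply: ler_wpM2r.
    by apply: mulr_ge0; rewrite ?ler0n // divr_ge0 // exprn_ge0 // ltW.
  by rewrite /n -natrX ler_nat expnS expn1 -card_prod max_card.
have -> : n ^+ 2 * (c%:R * (n ^+ rho.+2 / n ^+ 3)) = c%:R * n ^+ rho.+1.
  by rewrite !exprS; field; rewrite gt_eqF.
exact: lexx.
Qed.

(** An edge with one vertex in [S] belongs to the link of that vertex. With two, one of them is not
    rich; such an edge is given by this vertex, another vertex of [S] and a [rho]-clique in their
    common neighbourhood, whose clique number is at most [p]. *)
Lemma good_edges_le :
  #|[set e in touching | clique J e]|%:R <=
    \sum_(v in S) (link_cliques v)%:R + #|S :\: rich|%:R * (s * (tau * n ^+ rho)).
Proof.
set D := [set e in _ | _].
have DE e : e \in D -> [/\ e \in E, e :&: S != set0 & clique J e].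
  by rewrite !in_set => /andP[/andP[]].
pose D1 := [set e in D | #|e :&: S| == 1%N].
pose F1 v := [set v |: f | f in cliques J (~: S :&: Nb v) rho.+1].
pose F2 (q : V * V) := [set q.1 |: (q.2 |: f) | f in cliques J (setT :&: Nb q.1 :&: Nb q.2) rho].
pose A2 := [set q in setX (S :\: rich) S | J q.1 q.2].
have cD : (#|D| <= \sum_(v in S) #|F1 v| + \sum_(q in A2) #|F2 q|)%N.
  rewrite -(cardsID [set e : {set V} | #|e :&: S| == 1%N] D); apply: leq_add.
    apply: union_bound => e; rewrite in_setI in_set => /andP[/DE[eE _ cl] /cards1P[v ev]].
    have /setIP[ve vS] : v \in e :&: S by rewrite ev set11.
    exists v => //; apply/imsetP; exists (e :\ v); last by rewrite setD1K.
    rewrite inE; apply/and3P; split.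
    - apply/subsetP => y; rewrite in_setD1 => /andP[yv ye]; rewrite in_setI in_setC /Nb in_set.
      move/cliqueP: cl => cl; rewrite (cl v y) // ?andbT 1?eq_sym //.
      by apply: contra yv => yS; rewrite -in_set1 -ev inE ye.
    - by have := card_edge unifE eE; rewrite (cardsD1 v) ve add1n => -[->].
    - by apply: cliqueS cl; apply: subsetDl.
  apply: union_bound => e; rewrite in_setD in_set => /andP[e1 /DE[eE e0' /cliqueP cl]].
  have [u [v [ue ve uS vS uv]]] : exists u v, [/\ u \in e, v \in e, u \in S, v \in S & u != v].
    have : (1 < #|e :&: S|)%N by rewrite ltn_neqAle eq_sym e1 card_gt0.
    by case/card_gt1P => u [v [/setIP[ue uS] /setIP[ve vS] uv]]; exists u, v.
  have gen a b : a \in e -> b \in e -> a != b -> e \in F2 (a, b).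
    move=> ae be ab; apply/imsetP; exists ((e :\ a) :\ b) => /=; last first.
      by rewrite !setD1K // !inE be eq_sym ab.
    have be' : b \in e :\ a by rewrite !inE eq_sym ab.
    rewrite inE; apply/and3P; split.
    - apply/subsetP => y; rewrite !in_setD1 => /and3P[yb ya ye].
      by rewrite !in_setI in_setT /Nb !in_set !cl // eq_sym.
    - have := card_edge unifE eE; rewrite (cardsD1 a) ae (cardsD1 b (e :\ a)) be' !add1n.
      by move=> [->].
    - by apply/cliqueP => x y; rewrite !in_setD1 => /and3P[_ _ xe] /and3P[_ _ ye]; apply: cl.
  have [ur|ur] := boolP (u \in rich); last first.
    by exists (u, v); [rewrite in_set in_setX in_setD /= ur uS vS cl|apply: gen].
  have [vr|vr] := boolP (v \in rich); last first.
    exists (v, u); last by apply: gen; rewrite // eq_sym.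
    by rewrite in_set in_setX in_setD /= vr vS uS cl // eq_sym.
  by have := rich_independent ur vr; rewrite cl.
have c1 : (\sum_(v in S) #|F1 v| <= \sum_(v in S) link_cliques v)%N.
  by apply: leq_sum => v _; apply: leq_imset_card.
have c2 : (\sum_(q in A2) #|F2 q|)%:R <= #|S :\: rich|%:R * (s * (tau * n ^+ rho)).
  apply: le_trans (_ : #|A2|%:R * (tau * n ^+ rho) <= _).
    rewrite natr_sum mulr_natl -sumr_const; apply: ler_sum => q; rewrite in_set => /andP[_ Jq].
    apply: le_trans (_ : #|cliques J (setT :&: Nb q.1 :&: Nb q.2) rho|%:R <= _).
      by rewrite ler_nat leq_imset_card.
    apply: cliques_tdens_bound => //; first exact: Nb2_omega.
    by rewrite ler_nat max_card.
  rewrite [X in _ <= X]mulrA; apply: ler_wpM2r.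
    by rewrite mulr_ge0 ?tdens_ge0 // exprn_ge0 // ltW.
  rewrite -natrM ler_nat -cardsX subset_leq_card //.
  by apply/subsetP => q; rewrite in_set => /andP[].
rewrite -natr_sum; apply: le_trans (_ : (\sum_(v in S) #|F1 v|)%:R + (\sum_(q in A2) #|F2 q|)%:R <= _).
  by rewrite -natrD ler_nat.
by apply: lerD; rewrite ?ler_nat.
Qed.

Variables (th eps : rat) (q : nat).
Hypotheses (th_gt0 : 0 < th) (th_le : th <= 1 / 2) (eps_gt0 : 0 < eps).
Hypothesis eps_small : eps <= e0 / 2.
Hypothesis P_le_N : P <= N.
Hypothesis s_small : 7 * r * P ^+ 3 * (s * n ^+ rho) <= N * M.
Hypothesis s_large : T + c%:R * 2 ^+ rho.+1 <= eps * th * s * T.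
Hypothesis n_le : n <= 2 * N.
Hypothesis extremal : s * (turan_number rho.+1 #|~: S| p.+1)%:R <= #|touching|%:R.

Definition coreS : {set V} :=
  [set v in S | (1 - eps) * (T * (N * M)) <= (link_cliques v)%:R].

(** With [W = T N M], a vertex of [S] accounts for at most [W] edges, and for at most [(1 - eps) W]
    outside the core: one that is not rich loses [e0 W] and regains at most [e0/2 W]. By [extremal]
    the total is at least [s W] up to the lower-order terms of [s_large], so few vertices lie
    outside the core. *)
Lemma card_coreS : #|S :\: coreS|%:R <= th * s.
Proof.
have N0 := N_gt0; have M0 := M_gt0; have P2 := P_gt1; have T0 := T_gt0.
have r2 := r_ge2; have s0 := s_ge0; have ep0 := eps_gt0; have e00 := e0_gt0.
set W := T * (N * M).
have W0 : 0 < W by apply: mulr_gt0 => //; apply: mulr_gt0.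
have P30 : 0 < P ^+ 3 by rewrite exprn_gt0 //; lra.
have small : s * (tau * n ^+ rho) <= e0 / 2 * W.
  have e0E : e0 * (7 * P ^+ 2) = 2 by rewrite divfK // mulf_neq0 // expf_neq0 // gt_eqF //; lra.
  have tP : tau <= P * (r * T) by rewrite rT.
  have h1 : (s * n ^+ rho) * tau <= (s * n ^+ rho) * (P * (r * T)).
    by rewrite ler_wpM2l // mulr_ge0 // exprn_ge0 // ltW // n_gt0.
  have h2 : (7 * P ^+ 2) * ((s * n ^+ rho) * (P * (r * T))) <= W.
    have -> : (7 * P ^+ 2) * ((s * n ^+ rho) * (P * (r * T))) =
      T * (7 * r * P ^+ 3 * (s * n ^+ rho)) by rewrite !exprS; ring.
    by rewrite ler_pM2l.
  have c7 : 0 < 7 * P ^+ 2 by rewrite mulr_gt0 // exprn_gt0 //; lra.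
  rewrite -(ler_pM2l c7); have -> : 7 * P ^+ 2 * (e0 / 2 * W) = e0 * (7 * P ^+ 2) / 2 * W by ring.
  rewrite e0E divff // mul1r; apply: le_trans h2; rewrite ler_pM2l //.
  by rewrite mulrCA mulrC.
have point v : v \in S -> (link_cliques v)%:R + (v \notin rich)%:R * (s * (tau * n ^+ rho)) <=
    W - eps * W * (v \notin coreS)%:R.
  move=> vS; have lW : (link_cliques v)%:R <= W.
    apply: le_trans (link_cliques_le v) _; rewrite /W [N * M]mulrC mulrA.
    by rewrite ler_wpM2l ?card_link // mulr_ge0 // ltW.
  have epW : eps * W <= e0 / 2 * W by rewrite ler_wpM2r // ltW.
  have ep : 0 <= eps * W by rewrite mulr_ge0 // ltW.
  have [vr|] := boolP (v \in rich).
    rewrite mul0r addr0; have [vc|] := boolP (v \in coreS); first by rewrite mulr0 subr0.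
    by rewrite in_set vS /= -ltNge mulr1 -/W => /ltW; rewrite mulrBl mul1r.
  rewrite in_set vS /= -ltNge mul1r -/W => /ltW h.
  have : eps * W * (v \notin coreS)%:R <= eps * W.
    by rewrite ler_piMr //; case: (_ \notin _); rewrite ?lexx ?ler01.
  lra.
have sum_le : \sum_(v in S) (link_cliques v)%:R + #|S :\: rich|%:R * (s * (tau * n ^+ rho)) <=
    s * W - eps * W * #|S :\: coreS|%:R.
  have cnt (A : {set V}) : \sum_(v in S) (v \notin A)%:R = #|S :\: A|%:R :> rat.
    rewrite -natr_sum; congr _%:R; rewrite -sum1_card big_mkcond [RHS]big_mkcond /=.
    by apply: eq_bigr => v _; rewrite in_setD; case: (v \in A); case: (v \in S).
  have -> : s * W = \sum_(v in S) W by rewrite sumr_const /s mulr_natl.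
  rewrite -!cnt mulr_suml -big_split mulr_sumr -sumrB.
  by apply: ler_sum => v; apply: point.
have split_t : #|touching|%:R = #|[set e in touching | clique J e]|%:R +
    #|[set e in touching | ~~ clique J e]|%:R :> rat.
  rewrite -natrD; congr _%:R; rewrite -(cardsID [set e | clique J e] touching); congr (_ + _)%N.
    by apply: eq_card => e; rewrite !inE.
  by apply: eq_card => e; rewrite !inE andbC.
have tlow : W - T * (r * P * M) <= (turan_number rho.+1 #|~: S| p.+1)%:R.
  have := @turan_number_real #|~: S| p rho.+1 N (P / N) (ltW N0) _ _.
  rewrite -/N -/P -/T NM -/W -/r; have -> : W * (1 - r * (P / N)) = W - T * (r * P * M).
    by rewrite /W; field; rewrite gt_eqF.
  apply; first by rewrite divr_ge0 ?(ltW N0) //= ?ler_pdivrMr // ?mul1r //; lra.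
  by rewrite mulrBr mulr1 mulrC divfK // gt_eqF.
have nM : M <= n ^+ rho.
  by rewrite lerXn2r ?nnegrE ?(ltW N0) ?(ltW n_gt0) // V_eq; lra.
have srP : s * (r * P) <= N.
  have h1 : 7 * r * P ^+ 3 * (s * M) <= N * M.
    apply: le_trans s_small; apply: ler_wpM2l; last exact: ler_wpM2l.
    by rewrite !mulr_ge0 // ?ltW //; lra.
  rewrite mulrA ler_pM2r // in h1; apply: le_trans h1.
  have -> : 7 * r * P ^+ 3 * s = (s * (r * P)) * (7 * P ^+ 2) by rewrite !exprS; ring.
  rewrite ler_peMr ?mulr_ge0 //; try lra.
  by have : 1 <= P ^+ 2 by [rewrite exprn_ege1 //; lra]; lra.
have nr : c%:R * n ^+ rho.+1 <= c%:R * 2 ^+ rho.+1 * (N * M).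
  rewrite -mulrA ler_wpM2l ?ler0n // -NM -exprMn lerXn2r ?nnegrE ?mulr_ge0 ?(ltW N0) ?(ltW n_gt0) //.
have NM0 : 0 < N * M by apply: mulr_gt0.
have k1 : s * (T * (r * P * M)) <= W.
  have -> : s * (T * (r * P * M)) = (T * M) * (s * (r * P)) by ring.
  have -> : W = (T * M) * N by rewrite /W; ring.
  by rewrite ler_wpM2l // mulr_ge0 // ltW.
have k2 : s * (W - T * (r * P * M)) <= #|touching|%:R.
  by apply: le_trans extremal; rewrite ler_wpM2l.
have k3 : (T + c%:R * 2 ^+ rho.+1) * (N * M) <= eps * th * s * T * (N * M) by rewrite ler_pM2r.
have k4 := good_edges_le; have k5 := bad_edges_le.
have epW : 0 < eps * W by apply: mulr_gt0.
rewrite -(ler_pM2l epW).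
have -> : eps * W * (th * s) = eps * th * s * T * (N * M) by rewrite /W; ring.
apply: le_trans k3.
rewrite mulrDl -/W; lra.
Qed.

Hypotheses (q_large : 2 * r <= q%:R * th) (q_large3 : 3 <= q%:R * th).
Hypothesis eps_q : 4 * q%:R * eps < th.
Hypothesis eps_th : 3 * eps <= th ^+ 2.
Hypothesis N_q : 2 * q%:R <= N.

Let iP : rat := P^-1.

(** [O1] is the neighbourhood [Q] of a core vertex [v0] without two small sets. [W1], the vertices
    missing too much of [coreS], is small by double counting; [W2], those of low degree in [Q], is
    small because many of them would leave too few cliques in the link of [v0]. *)
Lemma core_exists : exists S1 O1 : {set V},
  [/\ S1 \subset S, O1 \subset ~: S, #|S :\: S1|%:R <= th * s & #|~: S :\: O1|%:R <= th * N] /\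
  [/\ {in S1, forall v, #|O1 :\: Nb v|%:R <= th * N},
      {in O1, forall w, #|O1 :\: Nb w|%:R <= (iP + th) * N} &
      {in O1, forall w, #|S1 :\: Nb w|%:R <= th * s}].
Proof.
have N0 := N_gt0; have M0 := M_gt0; have P2 := P_gt1; have T0 := T_gt0.
have r2 := r_ge2; have s0 := s_ge0; have ep0 := eps_gt0; have t0 := th_gt0.
have t1 : th <= 1 / 2 by exact: th_le.
have s_gt0 : 0 < s.
  rewrite lt_neqAle s0 andbT; apply/negP => /eqP z0; have := s_large; rewrite -z0 mulr0 mul0r.
  have : 0 <= c%:R * 2 ^+ rho.+1 :> rat by rewrite mulr_ge0 ?ler0n ?exprn_ge0.
  by move=> h1 h2; move: T0; apply/negP; rewrite -leNgt; lra.
have cS := card_coreS.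
have fullS v : v \in coreS -> #|~: S :\: Nb v|%:R <= eps * N.
  by rewrite in_set => /andP[_]; apply: link_cliques_full; apply: ltW.
have [v0 v0S] : exists v0, v0 \in coreS.
  apply/set0Pn; apply: contraTneq cS => ->; rewrite setD0 -/s -ltNge.
  have : th * s <= 1 / 2 * s by rewrite ler_pM2r.
  lra.
pose Q := ~: S :&: Nb v0.
have oQ : omega_le J Q p.+1 by apply: Nb_omega.
have QN : #|Q|%:R <= N by apply: card_link.
pose W1 := [set w in ~: S | th * s < #|coreS :\: Nb w|%:R].
pose W2 := [set w in Q | #|Q :&: Nb w|%:R < (1 - iP - th) * N].
have eth : eps <= th / 3.
  have : th ^+ 2 <= th * 1 by rewrite expr2 ler_pM2l //; lra.
  have := eps_th; lra.
have iP0 : 0 < iP by rewrite invr_gt0; lra.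
have iPE : P * iP = 1 by rewrite divff // gt_eqF //; lra.
have W1le : #|W1|%:R <= th / 3 * N.
  have dc : (\sum_(w in ~: S) #|coreS :\: Nb w| = \sum_(v in coreS) #|~: S :\: Nb v|)%N.
    under eq_bigr do rewrite -sum1_card. under [RHS]eq_bigr do rewrite -sum1_card.
    rewrite (exchange_big_dep (mem coreS)) /=; last by move=> w v _; rewrite in_setD => /andP[].
    apply: eq_bigr => v vS; apply: eq_bigl => w.
    by rewrite !in_setD vS andbT /Nb !in_set J_sym andbC.
  have h1 : (th * s) * #|W1|%:R <= s * (eps * N).
    apply: le_trans (_ : (\sum_(w in ~: S) #|coreS :\: Nb w|)%:R <= _).
      rewrite natr_sum mulr_natr -sumr_const.
      apply: le_trans (_ : \sum_(w in W1) #|coreS :\: Nb w|%:R <= _).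
        by apply: ler_sum => w; rewrite in_set => /andP[_ /ltW].
      rewrite [X in _ <= X](bigID (mem W1)) /=.
      rewrite (eq_bigl (fun w => (w \in ~: S) && (w \in W1))); last first.
        by move=> w; rewrite /W1 in_set; case: (w \in ~: S).
      by rewrite lerDl sumr_ge0.
    rewrite dc natr_sum; apply: le_trans (_ : #|coreS|%:R * (eps * N) <= _).
      rewrite mulr_natl -sumr_const; apply: ler_sum => v; exact: fullS.
    apply: ler_wpM2r; first by rewrite mulr_ge0 // ltW.
    by rewrite ler_nat subset_leq_card //; apply/subsetP => v; rewrite in_set => /andP[].
  have ths : 0 < th * s by apply: mulr_gt0.
  rewrite -(ler_pM2l ths); apply: le_trans h1 _.
  have -> : th * s * (th / 3 * N) = s * (th ^+ 2 / 3 * N) by rewrite expr2; ring.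
  rewrite ler_pM2l // ler_pM2r //; have := eps_th; lra.
have q0 : 0 < q%:R :> rat by rewrite -(pmulr_lgt0 _ t0); have := q_large3; lra.
have q0' : (0 < q)%N by rewrite -(ltr0n rat).
(* If [W2] were larger, exactly [m] of its vertices would be split off: [mu = m/N] is then small
   enough to control the quadratic term and large enough for the loss to exceed [eps]. *)
pose m := (#|~: S| %/ q)%N.
have mq : m%:R * q%:R <= N by rewrite -natrM ler_nat leq_trunc_div.
have mq2 : N <= 2 * q%:R * m%:R.
  have := natr_divn_ge #|~: S| q0'; rewrite -/m -/N lerBlDr ler_pdivrMr // => h.
  have := N_q; lra.
have W2le : (#|W2| <= m)%N.
  rewrite leqNgt; apply/negP => mW.
  have [W WW Wm] : exists2 W : {set V}, W \subset W2 & #|W| = m.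
    have : (0 < #|[set W : {set V} | W \subset W2 & #|W| == m]|)%N.
      by rewrite cards_draws bin_gt0 ltnW.
    by case/card_gt0P => W; rewrite inE => /andP[WW /eqP Wm]; exists W.
  have WQ : W \subset Q by apply: subset_trans WW _; apply/subsetP => w; rewrite in_set => /andP[].
  pose mu := m%:R / N.
  have muN : mu * N = m%:R by rewrite divfK // gt_eqF.
  have QW : #|Q :&: ~: W|%:R <= N * (1 - mu).
    rewrite -setDE cardsD (setIidPr WQ) natrB ?subset_leq_card // Wm mulrBr mulr1 [N * mu]mulrC muN.
    lra.
  have low w : w \in Q :\: ~: W -> #|cliques J (Q :&: Nb w) rho|%:R <= d * M * (1 - th).
    rewrite in_setD in_setC negbK => /andP[wW _].
    have := subsetP WW _ wW; rewrite in_set => /andP[wQ /ltW lw].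
    have ow : omega_le J (Q :&: Nb w) p by apply: omega_le_nbr.
    apply: le_trans (cliques_tdens_bound J_sym J_irr rho ow lw) _.
    have pP : p%:R = P - 1 by rewrite /P -natr1 addrK.
    have pp0 : 0 < p%:R :> rat by rewrite pP; lra.
    have le1 : (1 - iP - th) * N <= (p%:R * iP) * (N * (1 - th)).
      have -> : p%:R * iP = 1 - iP by rewrite pP mulrBl iPE mul1r.
      have : 0 <= iP * th * N by rewrite !mulr_ge0 // ltW.
      lra.
    have lw0 : 0 <= (1 - iP - th) * N by apply: le_trans lw.
    apply: le_trans (_ : tdens p rho * ((p%:R * iP) * (N * (1 - th))) ^+ rho <= _).
      rewrite ler_wpM2l ?tdens_ge0 // lerXn2r ?nnegrE // (le_trans lw0) //.
    rewrite !exprMn /tdens /d /tdeg -/P -/iP -/M.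
    have -> : 'C(p, rho)%:R * p%:R^-1 ^+ rho * (p%:R ^+ rho * iP ^+ rho * (M * (1 - th) ^+ rho)) =
      'C(p, rho)%:R * iP ^+ rho * M * (1 - th) ^+ rho * ((p%:R^-1 * p%:R) ^+ rho).
      by rewrite exprMn; ring.
    rewrite mulVf ?gt_eqF // expr1n mulr1; apply: ler_wpM2l.
      by rewrite !mulr_ge0 ?ler0n ?exprn_ge0 // ltW.
    by rewrite -[X in _ <= X]expr1; apply: ler_wiXn2l => //; lra.
  have := v0S; rewrite in_set => /andP[_]; rewrite /link_cliques -/Q.
  have := cliques_split J_sym J_irr Q (~: W) rho; rewrite -(ler_nat rat) natrD natr_sum => h1 h2.
  have h3 := le_trans h2 h1.
  have h4 : #|cliques J (Q :&: ~: W) rho.+1|%:R <= T * (N * M) * (1 - mu) ^+ rho.+1.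
    rewrite -NM -mulrA -exprMn; apply: cliques_tdens_bound => //.
    by apply: omega_leS oQ; apply: subsetIl.
  have h5 : \sum_(w in Q :\: ~: W) #|cliques J (Q :&: Nb w) rho|%:R <= mu * N * (d * M * (1 - th)).
    have -> : mu * N = #|Q :\: ~: W|%:R by rewrite muN setDE setCK (setIidPr WQ) Wm.
    by rewrite mulr_natl -sumr_const; apply: ler_sum.
  have W0 : 0 < T * (N * M) by apply: mulr_gt0 => //; apply: mulr_gt0.
  have mu01 : 0 <= mu <= 1.
    rewrite divr_ge0 ?ler0n ?(ltW N0) //= ler_pdivrMr // mul1r ler_nat.
    exact: leq_div.
  have h6 := sub1_exp_le rho.+1 mu01; rewrite -/r in h6.
  have h7 : 1 - eps <= 1 - r * mu + r ^+ 2 * mu ^+ 2 + r * mu * (1 - th).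
    rewrite -(ler_pM2l W0).
    have a1 : T * (N * M) * (1 - mu) ^+ rho.+1 <= T * (N * M) * (1 - r * mu + r ^+ 2 * mu ^+ 2).
      by rewrite ler_pM2l.
    have a2 : mu * N * (d * M * (1 - th)) = T * (N * M) * (r * mu * (1 - th)).
      by rewrite -rT; ring.
    rewrite a2 in h5; lra.
  apply: (low_degree_absurd t0 q_large q0 r2 eps_q _ _ h7).
    by rewrite -(ler_pM2r N0) mul1r mulrAC muN.
  rewrite -(ler_pM2r N0) mul1r; have -> : 2 * q%:R * mu * N = 2 * q%:R * (mu * N) by ring.
  by rewrite muN.
pose O1 := (Q :\: W1) :\: W2.
have O1Q : O1 \subset Q by rewrite /O1 !subDset !setUA subsetUr.
have O1O : O1 \subset ~: S by apply: subset_trans O1Q _; apply: subsetIl.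
exists coreS, O1; split; split=> //.
- by apply/subsetP => v; rewrite in_set => /andP[].
- have h : (#|~: S :\: O1| <= #|~: S :\: Nb v0| + (#|W1| + #|W2|))%N.
    apply: leq_trans (_ : #|(~: S :\: Nb v0) :|: (W1 :|: W2)| <= _)%N.
      apply/subset_leq_card/subsetP => w; rewrite /O1 !in_setU !in_setD in_setI.
      by case: (w \in W1); case: (w \in W2); case: (w \in Nb v0); case: (w \in ~: S).
    by do 2![apply: leq_trans (leq_card_setU _ _) _; rewrite leq_add2l].
  rewrite -(ler_nat rat) !natrD in h; apply: le_trans h _.
  have b1 := fullS _ v0S.
  have b2 : eps * N <= th / 3 * N by rewrite ler_pM2r.
  have b3 : #|W2|%:R <= m%:R :> rat by rewrite ler_nat.
  have b4 : m%:R <= th / 3 * N.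
    rewrite -(ler_pM2r q0); apply: le_trans mq _.
    have : N * 3 <= N * (q%:R * th) by rewrite ler_pM2l.
    lra.
  lra.
- move=> v /fullS h; apply: le_trans (_ : eps * N <= _).
    by apply: le_trans h; rewrite ler_nat subset_leq_card // setSD.
  rewrite ler_pM2r //; lra.
- move=> w wO; have wW2 : w \notin W2 by move: wO; rewrite in_setD => /andP[].
  have wQ := subsetP O1Q _ wO.
  move: wW2; rewrite in_set wQ /= -leNgt => h.
  have : (#|O1 :\: Nb w| <= #|Q| - #|Q :&: Nb w|)%N.
    by rewrite -cardsD subset_leq_card // setSD.
  rewrite -(ler_nat rat) natrB ?subset_leq_card ?subsetIl //; lra.
- move=> w wO; have : w \notin W1 by move: wO; rewrite !in_setD => /and3P[].
  by rewrite in_set (subsetP O1O _ wO) /= -leNgt.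
Qed.

End CoreExists.

(** * Choice of constants and the bound on the edges meeting a set *)

Lemma exists_nat_ge (x : rat) : exists m : nat, x <= m%:R.
Proof. by exists (Num.bound `|x|); apply: le_trans (ler_norm x) (ltW (archi_boundP _)). Qed.

Lemma nat_threshold (a b : rat) : 0 < b -> exists m0 : nat,
  forall m : nat, (m0 <= m)%N -> a <= b * m%:R.
Proof.
move=> b0; have [m0 h] := exists_nat_ge (a / b); exists m0 => m hm.
rewrite -ler_pdivrMl // mulrC; apply: le_trans h _; by rewrite ler_nat.
Qed.

(** The tangent bound gives [N^{rho+1} >= n^{rho+1} - (rho+1) n^rho s]; the subtracted term turns
    the [8] of the theorem into the [7] used above. *)
Lemma sub_power_bound (s N n rr P : rat) rho : 0 <= s -> 0 <= N -> n = s + N -> rr = rho.+1%:R ->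
  1 <= P -> 8 * rr * P ^+ 3 * s <= n -> 7 * rr * P ^+ 3 * (s * n ^+ rho) <= N * N ^+ rho.
Proof.
move=> s0 N0 nE rE P1 h; have n0 : 0 <= n by rewrite nE addr_ge0.
have := bernoulli_tangent rho n0 N0; rewrite -rE [in X in _ <= X -> _]exprS; apply: le_trans.
have -> : N - n = - s by rewrite nE; ring.
rewrite [n ^+ rho.+1]exprS; have q0 : 0 <= n ^+ rho by apply: exprn_ge0.
have P3 : 1 <= P ^+ 3 by apply: exprn_ege1.
have r0 : 0 <= rr by rewrite rE ler0n.
have h2 : rr * s <= rr * P ^+ 3 * s.
  by rewrite -mulrA ler_wpM2l // ler_peMl.
have h3 : 7 * rr * P ^+ 3 * s + rr * s <= n by lra.
have : (7 * rr * P ^+ 3 * s + rr * s) * n ^+ rho <= n * n ^+ rho by rewrite ler_wpM2r.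
by move: (n ^+ rho) (P ^+ 3) => y z; lra.
Qed.

(** [G] stands for the polynomial in [th2_small]. Each constant is small in terms of the preceding
    one: [th2 = 1/(2G)], [e4 = th2 d/(8P^2)], [th = e4/(32 B r P^2)]. *)
Lemma small_constants (R : realFieldType) (d B r P G : R) :
  0 < d -> d <= 1 -> 1 <= B -> 2 <= r -> 2 <= P -> 1 <= G ->
  exists th2 e4 th : R,
    [/\ 0 < th2, th2 * G < 1, 0 <= e4 & 2 * r * th <= e4] /\
    [/\ 0 < th, th <= th2, 2 * th <= 1 &
      [/\ e4 + 6 * B * th + B * P * th <= th2 * d, e4 * d + 6 * B * r * th <= th2 * d &
         (8 * B * th + e4) * (4 * P ^+ 2) <= d]].
Proof.
move=> d0 d1 B1 r2 P2 G1.
have Q4 : 4 <= P ^+ 2.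
  have : 2 * 2 <= P * P by apply: ler_pM.
  by rewrite expr2; clear; lra.
have PQ : P <= P ^+ 2 by rewrite expr2 ler_peMr //; clear -P2; lra.
move: (P ^+ 2) Q4 PQ => Q Q4 PQ.
have [th2 th20 th2G] : exists2 th2 : R, 0 < th2 & th2 * (2 * G) = 1.
  exists (2 * G)^-1; first by rewrite invr_gt0; clear -G1; lra.
  by rewrite mulVf // gt_eqF //; clear -G1; lra.
have th2_2 : th2 * 2 <= 1.
  have : th2 * 2 <= th2 * (2 * G) by rewrite ler_pM2l //; clear -G1; lra.
  by clear -th2G; lra.
have Q8 : 0 < 8 * Q by clear -Q4; lra.
have t2d : 0 < th2 * d by apply: mulr_gt0.
have [e4 e40 e4Q] : exists2 e4 : R, 0 < e4 & e4 * (8 * Q) = th2 * d.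
  by exists (th2 * d / (8 * Q)); [apply: divr_gt0|rewrite divfK // gt_eqF].
have B0 : 0 < B by clear -B1; lra.
have r0 : 0 < r by clear -r2; lra.
have Q0 : 0 < Q by clear -Q4; lra.
have Br : 2 <= B * r.
  have : 1 * 2 <= B * r by apply: ler_pM.
  by clear; lra.
have BQ : B * 4 <= B * Q by rewrite ler_pM2l.
have BPQ : B * P <= B * Q by rewrite ler_pM2l.
have rB : r <= B * r by rewrite ler_peMl // ltW.
have [K KE] : exists K : R, K = 32 * B * r * Q by exists (32 * B * r * Q).
have K32 : 32 <= K.
  have : 1 * 4 <= (B * r) * Q by apply: ler_pM => //; clear -Br; lra.
  by rewrite KE; clear; lra.
have KBQ : 64 * B * Q <= K.
  have : (B * Q) * 2 <= (B * Q) * r by rewrite ler_pM2l // mulr_gt0.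
  by rewrite KE; clear; lra.
have KBr : 128 * B * r <= K.
  have : (B * r) * 4 <= (B * r) * Q by rewrite ler_pM2l // mulr_gt0.
  by rewrite KE; clear; lra.
have K0 : 0 < K by clear -K32; lra.
have [th th0 thK] : exists2 th : R, 0 < th & th * K = e4.
  by exists (e4 / K); [apply: divr_gt0|rewrite divfK // gt_eqF].
have c_e4 (y : R) : y <= K -> y * th <= e4.
  by move=> yK; rewrite -thK mulrC ler_wpM2l // ltW.
have e4d : 8 * e4 <= th2 * d.
  have : e4 * 4 <= e4 * Q by rewrite ler_pM2l.
  by clear -e4Q e40; lra.
have th2d : th2 * d <= th2 by rewrite ger_pMr.
have the4 : 1 * th <= e4 by apply: c_e4; clear -K32; lra.
exists th2, e4, th; split; split=> //.
- have : 0 < th2 * G by rewrite mulr_gt0 // (lt_le_trans ltr01).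
  by clear -th2G; lra.
- exact: ltW.
- by apply: c_e4; clear -KBr rB K0 r0; lra.
- by clear -the4 e4d th2d e40; lra.
- by clear -the4 e4d th2d e40 th2_2; lra.
split.
- have h : (6 * B + B * P) * th <= e4 by apply: c_e4; clear -BPQ BQ KBQ B0; lra.
  by rewrite mulrDl in h; clear -h e4d e40; lra.
- have h : 6 * B * r * th <= e4.
    apply: c_e4; have : 0 < B * r by apply: mulr_gt0.
    by clear -KBr; lra.
  have : e4 * d <= e4 * 1 by rewrite ler_pM2l.
  by clear -h e4d e40; lra.
have h : (32 * B * Q) * th <= e4.
  apply: c_e4; have : 0 < B * Q by apply: mulr_gt0.
  by clear -KBQ; lra.
have : th2 * d * 2 <= d by rewrite mulrAC ger_pMl.
by clear -h e4d e4Q e40 d0; lra.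
Qed.

(** The witness is [eps = th^2/(8 q P^2)]; the last bound is half of the [e0] that defines
    richness. *)
Lemma small_eps (R : realFieldType) (th r P q : R) :
  0 < th -> 2 * th <= 1 -> 2 <= r -> 2 <= P -> 2 * r + 3 <= q * th ->
  exists eps : R,
    [/\ 4 * q * eps < th, 3 * eps <= th ^+ 2, 0 < eps & eps <= 2 / (7 * P ^+ 2) / 2].
Proof.
move=> th0 th1 r2 P2 qth.
have Q4 : 4 <= P ^+ 2.
  have : 2 * 2 <= P * P by apply: ler_pM.
  by rewrite expr2; clear; lra.
move: (P ^+ 2) Q4 => Q Q4; have Q0 : 0 < Q by clear -Q4; lra.
have q0 : 0 < q by rewrite -(pmulr_lgt0 _ th0); clear -qth r2; lra.
have q1 : 1 <= q.
  have : q * (2 * th) <= q * 1 by rewrite ler_pM2l.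
  by clear -qth r2; lra.
have q8 : 0 < 8 * q * Q by apply: mulr_gt0 => //; apply: mulr_gt0.
have t20 : 0 < th ^+ 2 by apply: exprn_gt0.
have [eps eps0 epsE] : exists2 eps : R, 0 < eps & eps * (8 * q * Q) = th ^+ 2.
  by exists (th ^+ 2 / (8 * q * Q)); [apply: divr_gt0|rewrite divfK // gt_eqF].
have t2 : th ^+ 2 * 2 <= th.
  have : th * (2 * th) <= th * 1 by rewrite ler_pM2l.
  by rewrite expr2; clear; lra.
have h1 : (eps * q) * 4 <= (eps * q) * Q by rewrite ler_pM2l // mulr_gt0.
have h2 : eps * 1 <= eps * q by rewrite ler_pM2l.
exists eps; split => //.
- by clear -h1 epsE t2 t20 th0; lra.
- by clear -h1 h2 epsE t20 eps0; lra.
have Q7 : 0 < 7 * Q by apply: mulr_gt0.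
rewrite -(ler_pM2r Q7) [X in _ <= X]mulrAC divfK ?gt_eqF //.
have h3 : (eps * Q) * 1 <= (eps * Q) * q by rewrite ler_pM2l // mulr_gt0.
have : th ^+ 2 <= 1 by clear -t2 th1; lra.
by clear -h3 epsE eps0; lra.
Qed.

Lemma large_n_facts (R : realFieldType) (s N n r P : R) : 0 <= s -> n = s + N -> 2 <= r -> 2 <= P -> 1 <= n ->
  8 * r * P ^+ 3 * s <= n -> [/\ n <= 2 * N, 0 < N & 7 * r * P ^+ 3 * s <= N].
Proof.
move=> s0 nE r2 P2 n1 small.
have P8 : 8 <= P ^+ 3.
  have h : 2 * 2 <= P * P by apply: ler_pM.
  have : 2 * (2 * 2) <= P * (P * P) by apply: ler_pM => //; clear; lra.
  by rewrite !exprS expr0 mulr1; clear; lra.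
have rP3 : 8 <= r * P ^+ 3.
  have : 1 * 8 <= r * P ^+ 3 by apply: ler_pM => //; clear -r2; lra.
  by clear; lra.
have : 8 * s <= (r * P ^+ 3) * s by rewrite ler_wpM2r.
move: small; rewrite -[8 * r * _]mulrA -[7 * r * _]mulrA; move: (r * P ^+ 3) rP3 => y _ h1 h2.
by rewrite nE in h1 n1 *; clear -h1 h2 s0 n1; split; lra.
Qed.

Lemma touching_bound (rho p : nat) : (1 <= rho)%N -> (rho <= p)%N ->
  exists s0 n0 : nat, forall (V : finType) (E : {set {set V}}) (S : {set V}),
    uniform rho.+2 (Hypergraph E) ->
    ~~ contains (Hypergraph E) (expanded_clique rho.+2 p.+3) ->
    (s0 <= #|S|)%N -> (n0 <= #|V|)%N ->
    (8 * rho.+1 * p.+1 ^ 3 * #|S| <= #|V|)%N ->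
    (#|touching E S| <= #|S| * turan_number rho.+1 #|~: S| p.+1)%N.
Proof.
move=> rho1 rhop.
pose c := (p.+3 + rho.+2 + 'C(p.+3, 2) * rho.+2)%N.
have d0 : 0 < tdeg p rho by apply: tdeg_gt0.
have d1 : tdeg p rho <= 1 := le_trans (tdeg_le_tdens rho1 rhop) (tdens_le1 rho1 rhop).
have r2 : 2 <= rho.+1%:R :> rat by rewrite ler_nat.
have P2 : 2 <= p.+1%:R :> rat by rewrite ler_nat ltnS (leq_trans rho1).
have B1 : 1 <= 2 ^+ rho :> rat by rewrite -natrX ler1n expn_gt0.
have T0 : 0 < tdens p.+1 rho.+1.
  have := tdensE p rho => rT; have r0 : 0 < rho.+1%:R :> rat by rewrite ltr0n.
  by rewrite -(pmulr_rgt0 _ r0) rT.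
have G1 : 1 <= p.+1%:R ^+ 2 * p.+2%:R * p.+4%:R :> rat.
  by rewrite -natrX -!natrM ler1n !muln_gt0.
have [th2 [e4 [th [[th20 th2G e40 K4] [th0 thth2 th1 [K1 K2 K3]]]]]] :=
  small_constants d0 d1 B1 r2 P2 G1.
have [q hq] := exists_nat_ge ((2 * rho.+1%:R + 3) / th).
have qth : 2 * rho.+1%:R + 3 <= q%:R * th by rewrite -ler_pdivrMr.
have [eps [eps_q eps_th eps0 eps_e0]] := small_eps th0 th1 r2 P2 qth.
have eT0 : 0 < eps * th * tdens p.+1 rho.+1 by apply: mulr_gt0 => //; apply: mulr_gt0.
have [m1 h1] := nat_threshold (tdens p.+1 rho.+1 + c%:R * 2 ^+ rho.+1) eT0.
have [m2 h2] := nat_threshold rho.+2%:R th20.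
have [m3 h3] := nat_threshold c%:R th0.
have hf (x : rat) : 0 < x -> 0 < x / 2 by move=> x0; apply: divr_gt0.
have [n1 g1] := nat_threshold rho.+2%:R (hf _ th20).
have [n2 g2] := nat_threshold c%:R (hf _ th0).
have [n3 g3] := nat_threshold p.+1%:R (hf _ th0).
have [n4 g4] := nat_threshold (2 * q%:R) (hf _ ltr01).
exists (maxn m1 (maxn m2 m3)), (maxn 1 (maxn n1 (maxn n2 (maxn n3 n4)))).
move=> V E S unifE freeE; rewrite !geq_max => /andP[/h1 k1 /andP[/h2 k2 /h3 k3]].
case/andP=> V1 /and4P[/g1 l1 /g2 l2 /g3 l3 /g4 l4] small.
have nE : #|V|%:R = #|S|%:R + #|~: S|%:R :> rat.
  by rewrite -cardsT -(setUCr S) cardsU setICr cards0 subn0 natrD.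
have [||n2N N0 sN7] := large_n_facts (ler0n _ _) nE r2 P2.
- by rewrite ler1n.
- by rewrite -natrX -!natrM ler_nat.
(* [n <= 2 N] carries the thresholds, set up with halved constants, from [#|V|] over to the
   complement of [S]. *)
have up (x y : rat) : 0 < x -> y <= x / 2 * #|V|%:R -> y <= x * #|~: S|%:R.
  move=> x0 h; apply: le_trans h _; rewrite -mulrA ler_pM2l // mulrC ler_pdivrMr //.
  by rewrite mulrC.
have {}l1 := up _ _ th20 l1; have {}l2 := up _ _ th0 l2; have {}l3 := up _ _ th0 l3.
have {}l4 := up _ _ ltr01 l4; rewrite mul1r in l4.
have th_half : th <= 1 / 2 by rewrite ler_pdivlMr // mulrC.
have PN : p.+1%:R <= #|~: S|%:R :> rat.
  apply: le_trans l3 _; rewrite ger_pMl //; apply: le_trans th_half _.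
  by rewrite ler_pdivrMr // mul1r ler1n.
have P1 : 1 <= p.+1%:R :> rat by rewrite ler1n.
have smallR : 8 * rho.+1%:R * p.+1%:R ^+ 3 * #|S|%:R <= #|V|%:R :> rat.
  by rewrite -natrX -!natrM ler_nat.
have pw := sub_power_bound (rho := rho) (ler0n _ #|S|) (ltW N0) nE (erefl _) P1 smallR.
(* The cores are built from the failure of the bound, so failure is assumed; the cores then prove
   the bound, a contradiction. *)
have [//|lt] := leqP #|touching E S| (#|S| * turan_number rho.+1 #|~: S| p.+1)%N.
have ext : #|S|%:R * (turan_number rho.+1 #|~: S| p.+1)%:R <= #|touching E S|%:R :> rat.
  by rewrite -natrM ler_nat ltnW.
have q3 : 3 <= q%:R * th.
  by apply: le_trans qth; rewrite lerDr mulr_ge0 // (le_trans _ r2).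
have q2 : 2 * rho.+1%:R <= q%:R * th by apply: le_trans qth; rewrite lerDl.
rewrite [eps * th * _ * _]mulrAC in k1.
have [S1 [O1 [[a1 a2 a3 a4] [b1 b2 b3]]]] := core_exists rho1 rhop unifE (leqnn c) freeE N0
  th0 th_half eps0 eps_e0 PN pw k1 n2N ext q2 q3 eps_q eps_th l4.
have := (core_bound rho1 rhop unifE (leqnn c) freeE a1 a2 a3 a4 b1 b2 b3 (ltW th0) thth2 th2G
  k2 l1 n2N e40 k3 l2 sN7 l3 K1 K2 K3 K4 th1).
by rewrite -/(touching E S) leqNgt lt.
Qed.

Local Open Scope nat_scope.

(** * Heavy vertices and matchings *)

Section Matchings.
Variables (V : finType) (E : {set {set V}}) (rho : nat).
Hypothesis unifE : uniform rho.+2 (Hypergraph E).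
Let k := rho.+2.

Lemma contains_matching (s : nat) (M : {set {set V}}) :
  M \subset E -> trivIset M -> s <= #|M| -> contains (Hypergraph E) (matching k s).
Proof.
move=> ME tM sM.
pose e (i : 'I_s) : {set V} := enum_val (widen_ord sM i).
have eM i : e i \in M by apply: enum_valP.
have ek i : #|e i| = k by apply: (card_edge unifE); apply: (subsetP ME).
pose g (v : vertex (matching k s)) : V := enum_val (cast_ord (esym (ek v.1)) v.2).
have ge v : g v \in e v.1 by apply: enum_valP.
have g_inj : injective g.
  move=> [i t] [j u] h; have [ij|ij] := eqVneq i j.
    by move: u h; rewrite -ij => u /enum_val_inj/cast_ord_inj /= ->.
  have eij : e i != e j.
    by apply: contra ij => /eqP/enum_val_inj/(congr1 val) /= h'; apply/eqP/val_inj.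
  have := trivIsetP tM _ _ (eM i) (eM j) eij; rewrite -setI_eq0 => /eqP/setP/(_ (g (i, t))).
  by rewrite !inE (ge (i, t)) h (ge (j, u)).
apply/existsP; exists [ffun v => g v]; apply/andP; split.
  by apply/injectiveP => x y; rewrite !ffunE => /g_inj.
apply/forall_inP => _ /imsetP[i _ ->].
rewrite (_ : _ @: _ = e i); first exact: (subsetP ME).
apply/eqP; rewrite eqEcard ek -imset_comp card_imset ?card_ord ?leqnn ?andbT.
  by apply/subsetP => _ /imsetP[t _ ->] /=; rewrite ffunE; apply: ge.
by move=> t u /=; rewrite !ffunE => /g_inj[].
Qed.

Let n := #|V|.

Lemma codeg_le_expn (B : {set V}) : #|B| <= k -> codeg E B <= n ^ (k - #|B|).
Proof.
move=> Bk; have [n0|n0] := posnP n.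
  have /cards0_eq-> : #|B| = 0 by apply/eqP; rewrite -leqn0 -n0 max_card.
  rewrite cards0 subn0; have := codeg_le unifE set0.
  by rewrite cards0 muln1.
by rewrite -(leq_pmul2r (_ : 0 < n ^ #|B|)) ?expn_gt0 ?n0 // -expnD subnK // codeg_le.
Qed.

Variable s : nat.
Let D := k * s * n ^ rho.

Definition heavy : {set V} := [set v | D < codeg E [set v]].

(** Each vertex of [F] shares at most [n^rho] edges with [v], too few to exhaust the edges at a
    heavy vertex. *)
Lemma avoiding_edge (v : V) (F : {set V}) : v \in heavy -> v \notin F -> #|F| <= k * s ->
  exists2 e, e \in E & (v \in e) && [disjoint e & F].
Proof.
rewrite inE => vD vF Fk; apply/exists_inP; rewrite -[X in is_true X]negbK; apply/exists_inPn => none.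
move: vD; apply/negP; rewrite -leqNgt.
apply: leq_trans (_ : \sum_(u in F) codeg E [set v; u] <= _).
  apply: union_bound => e; rewrite inE sub1set => /andP[eE ve].
  have := none e eE; rewrite ve /= => /pred0Pn[u /andP[/= ue uF]].
  by exists u => //; rewrite inE eE subUset !sub1set ve.
apply: leq_trans (_ : \sum_(u in F) n ^ rho <= _); last by rewrite sum_nat_const leq_mul2r Fk orbT.
apply: leq_sum => u uF; have vu : v != u by apply: contraNneq vF => ->.
have := @codeg_le_expn [set v; u]; rewrite cards2 vu /= => /(_ isT).
by rewrite /k subSS subSS subn0.
Qed.

(** An edge at a vertex of [A] is chosen off the matching and also off the rest of [A], whose
    vertices thus stay uncovered. At most [k s] vertices have to be avoided, because [#|M| + #|A|]
    stays at most [s.+1]. *)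
Lemma extend_matching (A : {set V}) (M : {set {set V}}) :
  M \subset E -> trivIset M -> A \subset heavy -> [disjoint A & cover M] ->
  #|M| + #|A| <= s.+1 ->
  exists M' : {set {set V}}, [/\ M' \subset E, trivIset M' & #|M'| = #|M| + #|A|].
Proof.
have [a] := ubnP #|A|; elim: a A M => // a IH A M Aa ME tM AH AM MA.
have [A0|[v vA]] := set_0Vmem A; first by exists M; rewrite A0 cards0 addn0.
have cA := cardsD1 v A; rewrite vA add1n in cA.
have vM : v \notin cover M.
  by apply: contraL AM => vM; apply/pred0Pn; exists v; rewrite /= vA.
have covM : #|cover M| <= k * #|M|.
  rewrite mulnC -sum_nat_const; apply: leq_trans (leq_card_cover M) _.
  by apply: leq_sum => e /(subsetP ME)/(card_edge unifE)->.
have [||e eE /andP[ve eF]] := @avoiding_edge v (cover M :|: (A :\ v)) (subsetP AH _ vA).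
- by rewrite !inE negb_or vM eqxx.
- apply: leq_trans (leq_card_setU _ _) _; apply: leq_trans (leq_add covM (leqnn _)) _.
  apply: leq_trans (_ : k * (#|M| + #|A :\ v|) <= _); first by rewrite mulnDr leq_add2l leq_pmull.
  by rewrite leq_mul2l; move: MA; rewrite cA addnS ltnS => ->; rewrite orbT.
have eM : e \notin M.
  by apply: contra vM => eM; apply/bigcupP; exists e.
have dis B : B \in M -> [disjoint e & B].
  move=> BM; apply: disjointWr eF; apply: subset_trans (subsetUl _ _).
  exact: bigcup_sup.
have M0 : set0 \notin M.
  by apply/negP => /(subsetP ME)/(card_edge unifE); rewrite cards0.
have [tM1 _] := trivIsetU1 dis tM M0.
have cM1 : #|e |: M| = #|M|.+1 by rewrite cardsU1 eM.
have [|||||| M' [h1 h2 h3]] := IH (A :\ v) (e |: M).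
- by rewrite -ltnS -cA.
- by rewrite subUset sub1set eE.
- exact: tM1.
- by apply: subset_trans AH; apply: subsetDl.
- rewrite /cover big_setU1 //= disjoint_sym disjoints_subset subUset; apply/andP; split.
    by rewrite -disjoints_subset; apply: disjointWr eF; apply: subsetUr.
  rewrite -disjoints_subset disjoint_sym; apply: disjointWl AM; exact: subsetDl.
- by move: MA; rewrite cM1 cA addnS addSn.
by exists M'; split=> //; rewrite h3 cM1 cA addnS addSn.
Qed.

Hypothesis no_matching : ~~ contains (Hypergraph E) (matching k s.+1).

Lemma matching_heavy (M : {set {set V}}) : M \subset E -> trivIset M ->
  [disjoint heavy & cover M] -> #|M| + #|heavy| <= s.
Proof.
move=> ME tM dis; rewrite leqNgt; apply/negP => big; case/negP: no_matching.
have [sM|Ms] := leqP s.+1 #|M|; first exact: contains_matching ME tM sM.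
have [A AH Ac] : exists2 A : {set V}, A \subset heavy & #|A| = s.+1 - #|M|.
  have : 0 < #|[set A : {set V} | A \subset heavy & #|A| == s.+1 - #|M|]|.
    by rewrite cards_draws bin_gt0 leq_subLR.
  by case/card_gt0P => A; rewrite inE => /andP[AH /eqP Ac]; exists A.
have [||M' [h1 h2 h3]] := extend_matching ME tM AH.
- exact: disjointWl AH dis.
- by rewrite Ac subnKC // ltnW.
by apply: contains_matching h1 h2 _; rewrite h3 Ac subnKC // ltnW.
Qed.

Lemma card_heavy : #|heavy| <= s.
Proof.
have := @matching_heavy set0 (sub0set _); rewrite cards0; apply.
  by apply/trivIsetP => A B; rewrite inE.
by rewrite /cover big_set0 disjoints_subset setC0 subsetT.
Qed.

(** Every edge avoiding the heavy vertices meets the cover of a maximal matching of such edges. This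
    matching has at most [s - #|heavy|] edges, and the vertices it covers are not heavy. *)
Lemma edges_heavy_le : #|E| <= #|touching E heavy| + k * (s - #|heavy|) * D.
Proof.
pose E' := [set e in E | e :&: heavy == set0].
have EE : #|E| = #|touching E heavy| + #|E'|.
  rewrite -(cardsID [set e : {set V} | e :&: heavy != set0] E); congr (_ + _).
    by apply: eq_card => e; rewrite !inE.
  by apply: eq_card => e; rewrite !inE negbK andbC.
rewrite EE leq_add2l.
pose good (M : {set {set V}}) := (M \subset E') && trivIset M.
have good0 : good set0 by rewrite /good sub0set; apply/trivIsetP => A B; rewrite inE.
have [M Mmax _] := maxset_exists good0.
have /maxsetP[/andP[ME' tM] Mmax'] := Mmax.
have ME : M \subset E by apply: subset_trans ME' _; apply/subsetP => e; rewrite inE => /andP[].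
have disM : [disjoint heavy & cover M].
  rewrite disjoint_sym disjoints_subset; apply/bigcupsP => e /(subsetP ME').
  by rewrite inE -disjoints_subset -setI_eq0 => /andP[].
have Ms := matching_heavy ME tM disM.
have covM : #|cover M| <= k * (s - #|heavy|).
  apply: leq_trans (_ : k * #|M| <= _); last first.
    by rewrite leq_mul2l leq_subRL ?card_heavy // addnC Ms orbT.
  rewrite mulnC -sum_nat_const; apply: leq_trans (leq_card_cover M) _.
  by apply: leq_sum => e /(subsetP ME)/(card_edge unifE)->.
apply: leq_trans (_ : \sum_(u in cover M) codeg E [set u] <= _); last first.
  apply: leq_trans (_ : \sum_(u in cover M) D <= _); last first.
    by rewrite sum_nat_const leq_mul2r covM orbT.
  apply: leq_sum => u uM; rewrite leqNgt; apply: contraL uM => uH.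
  by move: disM; rewrite disjoints_subset => /subsetP/(_ u); rewrite !inE uH => /(_ isT).
apply: union_bound => e eE'; have := eE'; rewrite inE => /andP[eE eH].
have [eM|eM] := boolP (e \in M).
  have : 0 < #|e| by rewrite (card_edge unifE eE).
  case/card_gt0P => u ue; exists u; first by apply/bigcupP; exists e.
  by rewrite inE eE sub1set.
have : ~~ good (e |: M).
  apply/negP => g; have := Mmax' _ g (subsetUr _ _) => h; move: eM; rewrite -{1}h => /negP[].
  by rewrite setU11.
rewrite /good subUset sub1set eE' ME' /= => ntriv.
have [dis|] := boolP [forall B in M, [disjoint e & B]].
  have M0 : set0 \notin M.
    by apply/negP => /(subsetP ME)/(card_edge unifE); rewrite cards0.
  by have [t _] := trivIsetU1 (fun B BM => forall_inP dis B BM) tM M0; rewrite t in ntriv.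
case/forall_inPn => B BM /pred0Pn[u /andP[/= ue uB]]; exists u.
  by apply/bigcupP; exists B.
by rewrite inE eE sub1set.
Qed.

End Matchings.

(** * Order of magnitude of the extremal number *)

(** ['C(P, r) >= (P/r)^r] without division, so the Turán density is at least [r^{-r}]. *)
Lemma bin_mul_expn_ge P r : r <= P -> P ^ r <= r ^ r * 'C(P, r).
Proof.
elim: r P => [|r IH] [|P] //; rewrite ltnS => rP.
have -> : r.+1 ^ r.+1 * 'C(P.+1, r.+1) = P.+1 * (r.+1 ^ r * 'C(P, r)).
  by rewrite expnS mulnAC -mul_bin_diag -mulnA ['C(P, r) * _]mulnC.
rewrite expnS leq_mul2l /=; have [->|r0] := posnP r; first by rewrite !expn0 bin0.
rewrite -(leq_pmul2r (_ : 0 < r ^ r)) ?expn_gt0 ?r0 // -expnMn.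
apply: leq_trans (_ : (r.+1 * P) ^ r <= _); first by rewrite leq_exp2r // mulSn mulnC; lia.
by rewrite expnMn -mulnA leq_mul2l [_ * r ^ r]mulnC IH ?orbT.
Qed.

Local Open Scope ring_scope.

(** Here [r = k-1], [ra = r^{k-2}], [P3 = (l-1)^3] and [t] is the Turán number. The first bound
    outweighs what a vertex missing from [S] lets other edges gain; the second compares [t] with the
    trivial degree bound [n^{k-1}]. *)
Lemma turan_order_facts (R : realFieldType) (n s N nr Nr ra rra P3 r t : R) :
  0 <= s -> 0 <= nr -> nr - r * (s * (nr / n)) <= Nr -> 0 < n -> 2 <= r -> 0 <= ra ->
  8 * ra * P3 * s <= n -> r ^+ 3 <= P3 -> 8 <= P3 -> r <= ra ->
  Nr * (7 / 8) <= (r * ra) * t ->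
  2 * ((r + 1) ^+ 2 + 1) * s * (nr / n) * (r * ra) <= (r * ra) * t /\ nr <= 4 * ((r * ra) * t).
Proof.
move=> s0 nr0 hN n0 r2 ra0 small rP P8 rra7 ht.
have q0 : 0 <= nr / n by apply: divr_ge0 => //; apply: ltW.
have nrE : nr = n * (nr / n) by rewrite mulrC divfK // gt_eqF.
move: (nr / n) q0 nrE hN => q q0 nrE hN.
have h1 : r * s * 64 <= n.
  have a1 : r * 8 <= ra * P3 by apply: ler_pM => //; lra.
  have : (r * 8) * s <= (ra * P3) * s by rewrite ler_wpM2r.
  by move: small; rewrite -[8 * ra * _]mulrA; clear; lra.
have h2 : (r * s * 64) * q <= n * q by rewrite ler_wpM2r.
have nq : 0 <= n * q by rewrite -nrE.
have low : 3 / 4 * (n * q) <= (r * ra) * t by rewrite nrE in hN; clear -hN h2 ht nq; lra.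
(* With [P3 >= r^3] this absorbs the factor [k^2 + 1]; at [r = 2] it is an equality. *)
have h3 : 2 * ((r + 1) ^+ 2 + 1) * r <= 5 * r ^+ 3.
  have r20 : 0 <= r - 2 by rewrite subr_ge0.
  have r0 : 0 <= r by apply: le_trans r2.
  have a1 : 0 <= (r - 2) * (r * r) by apply: mulr_ge0 => //; apply: mulr_ge0.
  have a2 : 0 <= (r - 2) * r by apply: mulr_ge0.
  by rewrite !exprS expr0 mulr1; clear -a1 a2; lra.
have h4 : (2 * ((r + 1) ^+ 2 + 1) * r) * (ra * s) <= 5 * P3 * (ra * s).
  rewrite ler_wpM2r ?mulr_ge0 //; apply: le_trans h3 _; by rewrite ler_wpM2l.
have h5 : 2 * ((r + 1) ^+ 2 + 1) * r * (ra * s) <= 5 / 8 * n.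
  by clear -h4 small; lra.
have h6 : (2 * ((r + 1) ^+ 2 + 1) * r * (ra * s)) * q <= (5 / 8 * n) * q by rewrite ler_wpM2r.
split; last by rewrite nrE; clear -low nq; lra.
apply: le_trans low; clear -h6 nq; lra.
Qed.

Lemma turan_order (rho p : nat) : (1 <= rho)%N -> (rho <= p)%N ->
  exists n0 : nat, forall n s : nat, (n0 <= n)%N -> (8 * rho.+1 ^ rho * p.+1 ^ 3 * s < n)%N ->
    (2 * (rho.+2 ^ 2 + 1) * s * n ^ rho <= turan_number rho.+1 (n - s) p.+1)%N /\
    (n ^ rho.+1 <= 4 * (rho.+1 ^ rho.+1 * turan_number rho.+1 (n - s) p.+1))%N.
Proof.
move=> rho1 rhop.
have r0 : 0 < rho.+1%:R :> rat by rewrite ltr0n.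
have r2 : 2 <= rho.+1%:R :> rat by rewrite ler_nat.
have P0 : 0 < p.+1%:R :> rat by rewrite ltr0n.
have c0 : 0 < 1 / (16 * rho.+1%:R) :> rat := divr_gt0 ltr01 (mulr_gt0 (ltr0n _ 16) r0).
have [n0 hn0] := nat_threshold p.+1%:R c0.
exists n0 => n s /hn0 n_large small.
have small' := ltnW small.
have sn : (s <= n)%N.
  by apply: leq_trans small'; rewrite leq_pmull // !muln_gt0 !expn_gt0.
set t := turan_number _ _ _.
have n_gt0 : (0 < n)%N by apply: leq_ltn_trans small.
have n0R : 0 < n%:R :> rat by rewrite ltr0n.
have NE : (n - s)%:R = n%:R - s%:R :> rat by rewrite natrB.
have P8n : (8 <= p.+1 ^ 3)%N by rewrite -[8%N]/(2 ^ 3)%N leq_exp2r // ltnS (leq_trans rho1).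
have rra : (rho.+1 <= rho.+1 ^ rho)%N.
  by rewrite -[X in (X <= _)%N]expn1 leq_exp2l.
have s2n : (2 * s <= n)%N.
  apply: leq_trans small'; rewrite leq_mul2r; apply/orP; right.
  by apply: (@leq_trans (8 * 1 * 1)%N) => //; rewrite !leq_mul ?expn_gt0.
have N0 : 0 <= (n - s)%:R :> rat by apply: ler0n.
(* Large enough to allow for rounding by [p.+1], while the relative loss [r x] is only [1/8]. *)
pose x : rat := 1 / (8 * rho.+1%:R).
have x01 : 0 <= x <= 1.
  have c8 : 0 < 8 * rho.+1%:R :> rat := mulr_gt0 (ltr0n _ 8) r0.
  rewrite (divr_ge0 ler01 (ltW c8)) /= ler_pdivrMr // !mul1r.
  by rewrite -natrM ler1n.
have E1 (R : numFieldType) (a : R) : a != 0 -> a * (1 / (8 * a)) = 1 / 8.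
  by move=> a0; field.
have E2 (R : numFieldType) (a b : R) : a != 0 -> 1 / (16 * a) * b = b / 2 * (1 / (8 * a)).
  by move=> a0; field.
have rx : rho.+1%:R * x = 1 / 8 by rewrite /x E1 // gt_eqF.
have hN : (n - s)%:R * (1 - x) <= (n - s)%:R - p.+1%:R.
  rewrite mulrBr mulr1 lerD2l lerN2; apply: le_trans n_large _.
  rewrite E2 ?gt_eqF // -/x.
  apply: ler_wpM2r; first by case/andP: x01.
  have : 2%:R * s%:R <= n%:R :> rat by rewrite -natrM ler_nat.
  by rewrite ler_pdivrMr // NE; clear; lra.
have tl := turan_number_real rho.+1 N0 x01 hN; rewrite -/t rx in tl.
have td : 1 <= (rho.+1 ^ rho.+1)%:R * tdens p.+1 rho.+1.
  rewrite /tdens exprVn mulrA ler_pdivlMr ?exprn_gt0 // mul1r -natrX -natrM ler_nat.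
  by apply: bin_mul_expn_ge; rewrite ltnS.
have ht : (n - s)%:R ^+ rho.+1 * (7 / 8) <= (rho.+1%:R * rho.+1%:R ^+ rho) * t%:R :> rat.
  have M0 : 0 <= (n - s)%:R ^+ rho.+1 * (7 / 8) :> rat.
    exact: mulr_ge0 (exprn_ge0 _ N0) (divr_ge0 (ler0n _ 7) (ler0n _ 8)).
  have -> : rho.+1%:R * rho.+1%:R ^+ rho = (rho.+1 ^ rho.+1)%:R :> rat by rewrite -exprS natrX.
  apply: le_trans (_ : (rho.+1 ^ rho.+1)%:R *
    (tdens p.+1 rho.+1 * (n - s)%:R ^+ rho.+1 * (1 - 1 / 8)) <= _); last first.
    exact: ler_wpM2l (ler0n _ _) _ _ tl.
  have -> : 1 - 1 / 8 = 7 / 8 :> rat by field.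
  rewrite -[tdens _ _ * _ * _]mulrA [X in _ <= X]mulrA.
  by rewrite ler_peMl.
have qE : n%:R ^+ rho.+1 / n%:R = n%:R ^+ rho :> rat by rewrite exprS mulrC mulKf // gt_eqF.
have hB : n%:R ^+ rho.+1 - rho.+1%:R * (s%:R * (n%:R ^+ rho.+1 / n%:R)) <= (n - s)%:R ^+ rho.+1 :> rat.
  have := bernoulli_tangent rho (ltW n0R) N0; apply: le_trans.
  rewrite qE NE le_eqVlt; apply/orP; left; apply/eqP.
  by move: (n%:R ^+ rho.+1) (n%:R ^+ rho) => a b; ring.
have [||||||h1 h2] := @turan_order_facts _ n%:R s%:R (n - s)%:R (n%:R ^+ rho.+1) ((n - s)%:R ^+ rho.+1)
  (rho.+1%:R ^+ rho) 1 (p.+1%:R ^+ 3) rho.+1%:R t%:R (ler0n _ _) _ hB n0R r2 _ _ _ _ _ ht.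
- by rewrite exprn_ge0.
- by rewrite exprn_ge0.
- by rewrite -!natrX -!natrM ler_nat.
- by rewrite -!natrX ler_nat leq_exp2r.
- by rewrite -natrX ler_nat.
- by rewrite -natrX ler_nat.
split.
  rewrite -(ler_nat rat) -(ler_pM2l (_ : 0 < rho.+1%:R * rho.+1%:R ^+ rho)) ?mulr_gt0 ?exprn_gt0 //.
  rewrite qE in h1; apply: le_trans h1.
  rewrite !natrM natrD !natrX -(natr1 rho.+1) le_eqVlt; apply/orP; left; apply/eqP.
  by move: (n%:R ^+ rho) (rho.+1%:R ^+ rho) => a b; ring.
rewrite -(ler_nat rat); apply: le_trans (_ : n%:R ^+ rho.+1 <= _); first by rewrite natrX.
by apply: le_trans h2 _; rewrite !natrM natrX exprS.
Qed.

Local Open Scope nat_scope.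

(** * The extremal number *)

Lemma turan_number_steps_le r m x P : 0 < P ->
  turan_number r.+1 (m + x) P <= turan_number r.+1 m P + x * (m + x) ^ r.
Proof.
move=> P0; elim: x => [|x IH]; first by rewrite mul0n !addn0.
rewrite addnS; apply: leq_trans (turan_number_step_le r (m + x) P0) _.
have h : (m + x) ^ r <= (m + x).+1 ^ r by case: r {IH} => // r; rewrite leq_exp2r.
apply: leq_trans (leq_add IH (leqnn _)) _.
by rewrite -addnA leq_add2l mulSn addnC leq_add // leq_mul2l h orbT.
Qed.

(** * The extremal construction *)

Section Construction.
Variables (n s rho p : nat).
Hypothesis sn : s <= n.

Definition block_color (i : 'I_n) : nat := if i < s then p.+1 else (i - s) %% p.+1.

Let S : {set 'I_n} := [set i : 'I_n | i < s].

(** [S] is a single colour class, so an edge consists of one vertex of [S] and an edge of the Turán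
    [rho.+1]-graph on the other vertices. *)
Definition block_edges : {set {set 'I_n}} :=
  [set e in cliques (bichromatic block_color) setT rho.+2 | e :&: S != set0].

Let colS (i : 'I_n) : (block_color i < p.+1) = (i \notin S).
Proof.
rewrite /block_color inE; case: ifP => _ /=; first by rewrite ltnn.
by rewrite ltn_pmod.
Qed.

Lemma card_block_edges : #|block_edges| = s * turan_number rho.+1 (n - s) p.+1.
Proof.
pose e := bichromatic block_color.
have cS : #|S| = s.
  have winj : injective (widen_ord sn) by move=> i j /(congr1 val) /= h; apply: val_inj.
  rewrite -[RHS]card_ord -(card_imset _ winj).
  apply: eq_card => i; rewrite inE; apply/idP/imsetP => [h|[j _ ->]]; last by rewrite /= ltn_ord.
  by exists (Ordinal h) => //; apply: val_inj.
have cT : #|cliques e (~: S) rho.+1| = turan_number rho.+1 (n - s) p.+1.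
  rewrite turan_number_elsym // (_ : ~: S = [set x | block_color x < p.+1]); last first.
    by apply/setP => i; rewrite in_setC [RHS]in_set colS.
  rewrite cliques_bichromatic /turan_sizes; congr (elsym _ _); apply/eq_in_map => j.
  rewrite mem_iota add0n => /= jp.
  have hlt (i : 'I_(n - s)) : i + s < n by have := ltn_ord i; rewrite ltn_subRL addnC.
  pose f i := Ordinal (hlt i).
  have f_inj : injective f by move=> i1 i2 /(congr1 val) /= /addIn h; apply: val_inj.
  rewrite -(card_imset _ f_inj); apply: eq_card => i; rewrite in_set.
  apply/eqP/imsetP => [|[i' ij ->]]; last first.
    by move: ij; rewrite in_set /block_color /= ltnNge leq_addl /= addnK => /eqP.
  rewrite /block_color; case: ltnP => [_ h|si h]; first by rewrite h ltnn in jp.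
  have lt : i - s < n - s by rewrite ltn_sub2r // (leq_ltn_trans si).
  exists (Ordinal lt); first by rewrite in_set /= h.
  by apply: val_inj; rewrite /= subnK.
have ind : {in setT :\: ~: S &, forall x y, ~~ e x y}.
  move=> x y; rewrite !in_setD !in_setC !negbK !inE => /andP[xS _] /andP[yS _].
  by rewrite /e /bichromatic /block_color /= xS yS eqxx.
have := cliques_split_eq (bichromatic_sym block_color) (bichromatic_irr block_color) rho.+1 ind.
rewrite setTI setTD setCK (eq_bigr (fun _ => turan_number rho.+1 (n - s) p.+1)); last first.
  move=> w wS; rewrite -cT; congr #|pred_of_set (cliques _ _ _)|; rewrite setTI.
  apply/setP => x; rewrite inE in_setC /bichromatic /=.
  move: wS; rewrite inE => wS; rewrite {1}/block_color wS -colS.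
  by rewrite neq_ltn orbC /block_color; case: ifP => h; rewrite ?ltnn //= ltn_pmod.
rewrite sum_nat_const cS => h.
apply/eqP; rewrite -(eqn_add2l #|cliques e (~: S) rho.+2|) h; apply/eqP.
rewrite -(cardsID [set f : {set 'I_n} | f :&: S != set0] (cliques e setT rho.+2)) addnC.
congr (_ + _); first by apply: eq_card => f; rewrite !inE.
apply: eq_card => f; rewrite in_setD !inE negbK subsetT /=.
by rewrite setI_eq0 -disjoints_subset andbA.
Qed.

Lemma uniform_block_edges : uniform rho.+2 (Hypergraph block_edges).
Proof. by apply/forall_inP => e; rewrite !inE => /andP[/and3P[]]. Qed.

(** Two of the [p.+3] core vertices share one of the [p.+2] colours, yet they lie in a common
    edge. *)
Lemma block_edges_expanded_free :
  ~~ contains (Hypergraph block_edges) (expanded_clique rho.+2 p.+3).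
Proof.
apply/existsPn => f; apply/negP => /andP[/injectiveP f_inj /forall_inP fE].
have col_lt i : block_color i < p.+2.
  by rewrite /block_color; case: ifP => // _; apply: ltn_trans (ltn_pmod _ _) _.
pose g (i : 'I_p.+3) : 'I_p.+2 := Ordinal (col_lt (f (inl i))).
have /injectivePn[i [j ij gij]] : ~~ injectiveb g.
  apply/negP => /injectiveP /leq_card; by rewrite !card_ord ltnn.
have pij : #|[set i; j]| == 2 by rewrite cards2 ij.
pose q : pair_of p.+3 := exist _ [set i; j] pij.
have : f @: ([set inl v | v in val q] :|: [set inr (q, t) | t : 'I_(rho.+2 - 2)]) \in block_edges.
  by apply: fE; apply/imsetP; exists q.
rewrite in_set in_set => /andP[/and3P[_ _ /cliqueP cl] _].
have := cl (f (inl i)) (f (inl j)).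
rewrite !imset_f ?inE ?imset_f ?inE ?eqxx ?orbT //= => /(_ isT isT).
rewrite (inj_eq f_inj) /bichromatic /=.
have -> : block_color (f (inl i)) = block_color (f (inl j)) by move/(congr1 val): gij.
have nij : (inl i : vertex (expanded_clique rho.+2 p.+3)) != inl j.
  by apply: contra ij => /eqP[->].
by rewrite eqxx => /(_ nij).
Qed.

Lemma block_edges_matching_free :
  ~~ contains (Hypergraph block_edges) (matching rho.+2 s.+1).
Proof.
apply/existsPn => f; apply/negP => /andP[/injectiveP f_inj /forall_inP fE].
have hit i : exists t : 'I_rho.+2, f (i, t) < s.
  have : f @: [set (i, t) | t : 'I_rho.+2] \in block_edges by apply: fE; apply/imsetP; exists i.
  rewrite in_set => /andP[_ /set0Pn[x /setIP[/imsetP[_ /imsetP[t _ ->] ->]]]].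
  by rewrite inE; exists t.
pose t i := xchoose (hit i).
have ts i : f (i, t i) < s := xchooseP (hit i).
pose g i := Ordinal (ts i).
have g_inj : injective g.
  by move=> i j /(congr1 val) /= /val_inj/f_inj[].
by have := leq_card g g_inj; rewrite !card_ord ltnn.
Qed.

End Construction.

Theorem theorem1p10 (k l : nat) (hk : 3 <= k) (hkl : k <= l) :
  exists s0 n0 : nat, forall n s : nat,
    s0 <= s ->
    (s%:R < n%:R / (8 * (k - 1) ^ (k - 2) * (l - 1) ^ 3)%:R :> rat)%R ->
    n0 <= n ->
    ex_number k n [:: expanded_clique k l.+1; matching k s.+1]
      = s * turan_number (k - 1) (n - s) (l - 1).
Proof.
have [rho kE] : exists rho, k = rho.+2 by exists (k - 2); lia.
have [p lE] : exists p, l = p.+2 by exists (l - 2); lia.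
move: hk hkl; rewrite {}kE {}lE !ltnS => rho1 rhop.
rewrite !subn1 !subSS !subn0 /=.
have [s1 [n1 touch]] := touching_bound rho1 rhop.
have [n2 order] := turan_order rho1 rhop.
(* The second threshold on [s] is for hypergraphs with fewer than [s1] heavy vertices, to which
   [touching_bound] does not apply. *)
exists (maxn s1 (8 * (rho.+1 ^ rho.+1) * s1)), (maxn n1 n2).
move=> n s; rewrite !geq_max => /andP[s1s s2s] small /andP[n1n n2n].
have {}small : 8 * rho.+1 ^ rho * p.+1 ^ 3 * s < n.
  move: small; rewrite ltr_pdivlMr ?ltr0n ?muln_gt0 ?expn_gt0 // -natrM ltr_nat mulnC.
  by [].
have sn : s <= n.
  by apply: leq_trans (ltnW small); rewrite leq_pmull // !muln_gt0 !expn_gt0.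
have [ord1 ord2] := order n s n2n small.
apply/eqP; rewrite eqn_leq; apply/andP; split; last first.
  rewrite -(card_block_edges rho p sn).
  apply: (@leq_bigmax_cond _ _ (fun E : {set {set 'I_n}} => #|E|)).
  rewrite uniform_block_edges /= block_edges_expanded_free block_edges_matching_free //.
apply/bigmax_leqP => E /and4P[unifE freeE matchE _].
have heavy_s := card_heavy unifE matchE.
have := edges_heavy_le unifE matchE; rewrite card_ord.
set H := heavy _ _ _ in heavy_s *; set h := #|H| in heavy_s *; set t := turan_number _ _ _.
move=> upE; set q := n ^ rho in ord1 upE.
have [s1h|hs1] := leqP s1 h.
  have hn : 8 * rho.+1 * p.+1 ^ 3 * h <= n.
    apply: leq_trans (ltnW small); rewrite leq_mul // leq_mul // leq_mul2l /=.
    by rewrite -[X in X <= _]expn1 leq_exp2l.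
  have := touch _ E H unifE freeE s1h; rewrite card_ord => /(_ n1n hn).
  have -> : #|~: H| = (n - s) + (s - h).
    by rewrite cardsCs setCK card_ord -/h addnBA // subnK.
  have := turan_number_steps_le rho (n - s) (s - h) (ltn0Sn p).
  rewrite -/t; have : (n - s + (s - h)) ^ rho <= q.
    by rewrite /q; case: (rho) rho1 => // r' _; rewrite leq_exp2r // addnBA // subnK // leq_subr.
  set Q := (n - s + (s - h)) ^ rho; set t' := turan_number _ (n - s + (s - h)) _.
  move=> Qq t't tch.
  have a1 : h * t' <= h * (t + (s - h) * q).
    by rewrite leq_mul2l (leq_trans t't) ?orbT // leq_add2l leq_mul2l Qq orbT.
  (* For each of the [s - h] vertices missing from [H], the larger Turán number and the edges
     avoiding [H] gain at most [h q + k^2 s q], which is at most [t]. *)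
  have a2 : (s - h) * (h * q + rho.+2 ^ 2 * s * q) <= (s - h) * t.
    rewrite leq_mul2l; apply/orP; right; apply: leq_trans ord1.
    have : h * q <= s * q by rewrite leq_mul2r heavy_s orbT.
    by clear; nia.
  have -> : s * t = h * t + (s - h) * t by rewrite -mulnDl subnKC.
  by clear -upE tch a1 a2; nia.
(* With fewer than [s1] heavy vertices the trivial degree bound suffices: the edges meeting [H] and
   those avoiding it each take up at most half of [s t]. *)
have tch : #|touching E H| <= s1 * n ^ rho.+1.
  apply: leq_trans (_ : \sum_(v in H) codeg E [set v] <= _).
    apply: union_bound => e; rewrite in_set => /andP[eE /set0Pn[v /setIP[ve vH]]].
    by exists v => //; rewrite inE eE sub1set.
  apply: leq_trans (_ : \sum_(v in H) n ^ rho.+1 <= _).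
    apply: leq_sum => v _; have := codeg_le_expn unifE (B := [set v]).
    by rewrite cards1 card_ord subn1 => /(_ isT).
  by rewrite sum_nat_const leq_mul2r (ltnW hs1) orbT.
have a1 : s1 * n ^ rho.+1 <= s1 * (4 * (rho.+1 ^ rho.+1 * t)) by rewrite leq_mul2l ord2 orbT.
have a2 : 8 * rho.+1 ^ rho.+1 * s1 * t <= s * t by rewrite leq_mul2r s2s orbT.
have a3 : s * (2 * (rho.+2 ^ 2 * s * q)) <= s * t.
  rewrite leq_mul2l; apply/orP; right; apply: leq_trans ord1; clear; nia.
have a4 : (s - h) * (rho.+2 ^ 2 * s * q) <= s * (rho.+2 ^ 2 * s * q).
  by rewrite leq_mul2r leq_subr orbT.
by clear -upE tch a1 a2 a3 a4; nia.
Qed.
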